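(* Assume that $H$ satisfies (H1)–(H4) and (H$^\infty$) listed in the context. Suppose that (1) there is an element $(\lambda,x^0)\in\mathbb{R}\times H^1$ such that $D_xF(\lambda,x^0)\in\Phi_0(H^1,L^2)$, and (2) $\{x\in H^1:F^+(\lambda,x)=0\}=\{x\in H^1:F^-(\lambda,x)=0\}=\{0\}$ (for this same $\lambda$). Then the restriction of $F(\lambda,\cdot):H^1\to L^2$ to the closed bounded subsets of $H^1$ is proper; that is, for every closed bounded $W\subset H^1$ and every compact $K\subset L^2$, the set $\{x\in W:F(\lambda,x)\in K\}$ is compact in $H^1$.
   Context: Let $N\ge 1$ be an integer and $J$ a real $2N\times 2N$ matrix with $J^T=J^{-1}=-J$. Write $L^2=L^2(\mathbb{R},\mathbb{R}^{2N})$ and $H^1=H^1(\mathbb{R},\mathbb{R}^{2N})$ with their usual norms; elements of $H^1$ are identified with their continuous representatives. $\Phi_0(X,Y)$ is the set of bounded linear Fredholm operators of index zero from $X$ to $Y$. Bundle maps: $f:\mathbb{R}\times\mathbb{R}^M\to\mathbb{R}$, $(t,\xi)\mapsto f(t,\xi)$, is an equicontinuous $C^0_\xi$-bundle map if $f$ is continuous and the family $\{f(t,\cdot)\}_{t\in\mathbb{R}}$ is equicontinuous at every point $\xi\in\mathbb{R}^M$; it is an equicontinuous $C^k_\xi$-bundle map if all partial derivatives $\partial^\kappa f/\partial\xi^\kappa$, $|\kappa|\le k$, exist and are equicontinuous $C^0_\xi$-bundle maps. For vector- or matrix-valued functions this is required of each component. Hypotheses on $H:\mathbb{R}\times\mathbb{R}^{2N}\times\mathbb{R}\to\mathbb{R}$,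 $(t,\xi,\lambda)\mapsto H(t,\xi,\lambda)$: (H1) $H$ is continuous, $H(t,\cdot,\lambda)\in C^2(\mathbb{R}^{2N})$ and $D_\xi H(t,0,\lambda)=0$ for all $t,\lambda\in\mathbb{R}$. (H2) The partial derivatives $D_\xi H$, $D_\xi^2H$, $D_\lambda D_\xi H$, $D_\lambda D_\xi^2H$ and $D_\xi D_\lambda D_\xi H$ exist and are continuous on $\mathbb{R}\times\mathbb{R}^{2N}\times\mathbb{R}$. (H3) For each $\lambda\in\mathbb{R}$, $D_\xi H(\cdot,\cdot,\lambda):\mathbb{R}\times\mathbb{R}^{2N}\to\mathbb{R}^{2N}$ is an equicontinuous $C^1_\xi$-bundle map, and $D_\lambda D_\xi^2H$, viewed as a matrix-valued function on $\mathbb{R}\times(\mathbb{R}^{2N}\times\mathbb{R})$, is an equicontinuous $C^0_{(\xi,\lambda)}$-bundle map. (H4) $D_\xi^2H(\cdot,0,0)$ and $D_\lambda D_\xi^2H(\cdot,0,0)$ belong to $L^\infty(\mathbb{R})$. (H$^\infty$) For every $\lambda\in\mathbb{R}$ there exist two equicontinuous $C^1_\xi$-bundle maps $g^+(\cdot,\cdot,\lambda),g^-(\cdot,\cdot,\lambda):\mathbb{R}\times\mathbb{R}^{2N}\to\mathbb{R}^{2N}$ such that: (1) $g^\pm(t,0,\lambda)=0$ for all $t,\lambda\in\mathbb{R}$; (2) $\lim_{t\to\infty}\{D_\xi^2H(t,\xi,\lambda)-D_\xi g^+(t,\xi,\lambda)\}=\lim_{t\to-\infty}\{D_\xi^2H(t,\xi,\lambda)-D_\xi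 g^-(t,\xi,\lambda)\}=0$ uniformly for $\xi$ in bounded subsets of $\mathbb{R}^{2N}$; (3) there are $T^+,T^->0$ (possibly depending on $\lambda$) with $g^\pm(t+T^\pm,\xi,\lambda)=g^\pm(t,\xi,\lambda)$ for all $(t,\xi)$. Define $F,F^\pm:\mathbb{R}\times H^1\to L^2$ by $F(\lambda,x)(t)=Jx'(t)-D_\xi H(t,x(t),\lambda)$ and $F^\pm(\lambda,x)(t)=Jx'(t)-g^\pm(t,x(t),\lambda)$; these are well defined when $H$ satisfies (H1)–(H4) and (H$^\infty$), and $F$ is $C^1$ with $D_xF(\lambda,x)u=Ju'-D_\xi^2H(\cdot,x(\cdot),\lambda)u$. *)

(* Defs.v *)
From HB Require Import structures.
From mathcomp Require Import all_boot all_order all_algebra generic_quotient.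
From mathcomp Require Import all_classical all_reals all_analysis.
From mathcomp Require Import measurable_realfun ring.

Set Implicit Arguments.
Unset Strict Implicit.
Unset Printing Implicit Defensive.

Import Order.TTheory GRing.Theory Num.Theory.
Import numFieldNormedType.Exports.

Local Open Scope classical_set_scope.
Local Open Scope ring_scope.
Local Open Scope quotient_scope.

Section Euclid.
Variables (R : rcfType) (I : finType).
Implicit Types a b : I -> R.

Lemma sum_cauchy_schwarz a b :
  (\sum_i a i * b i) ^+ 2 <= (\sum_i a i ^+ 2) * (\sum_i b i ^+ 2).
Proof.
have : 0 <= \sum_i \sum_j (a i * b j - a j * b i) ^+ 2.
  by apply: sumr_ge0 => i _; apply: sumr_ge0 => j _; exact: sqr_ge0.
have -> : \sum_i \sum_j (a i * b j - a j * b i) ^+ 2 =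
    \sum_i \sum_j (a i ^+ 2 * b j ^+ 2) + \sum_i \sum_j (a j ^+ 2 * b i ^+ 2)
    - (\sum_i \sum_j (a i * b i * (a j * b j))) *+ 2.
  rewrite -big_split/= -sumrMnl -sumrN -big_split/=; apply: eq_bigr => i _.
  rewrite -big_split/= -sumrMnl -sumrN -big_split/=; apply: eq_bigr => j _.
  by ring.
have E (f g : I -> R) : \sum_i \sum_j (f i * g j) = (\sum_i f i) * (\sum_j g j).
  by rewrite mulr_suml; apply: eq_bigr => i _; rewrite mulr_sumr.
rewrite [X in _ + X - _]exchange_big/= !E -mulr2n -expr2 -mulrnBl.
by rewrite pmulrn_lge0// subr_ge0.
Qed.

Lemma sqrt_sum_triangle a b c :
  (forall i, 0 <= a i) -> (forall i, a i <= b i + c i) ->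
  Num.sqrt (\sum_i a i ^+ 2) <=
  Num.sqrt (\sum_i b i ^+ 2) + Num.sqrt (\sum_i c i ^+ 2).
Proof.
move=> a0 abc.
have S0 (d : I -> R) : 0 <= \sum_i d i ^+ 2.
  by apply: sumr_ge0 => i _; exact: sqr_ge0.
rewrite -(@ler_pXn2r _ 2)// ?nnegrE ?addr_ge0 ?sqrtr_ge0//.
rewrite sqrrD !sqr_sqrtr//.
apply: (@le_trans _ _ (\sum_i (b i + c i) ^+ 2)).
  apply: ler_sum => i _; apply: lerXn2r; rewrite ?nnegrE ?abc//.
  exact: le_trans (abc i).
under eq_bigr do rewrite sqrrD.
rewrite !big_split/= lerD2r lerD2l. rewrite -mulr2n lerMn2r/=.
apply: (le_trans (ler_norm _)).
rewrite -sqrtrM// -sqrtr_sqr ler_wsqrtr//; exact: sum_cauchy_schwarz.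
Qed.

Lemma sqrt_sumZ (k : R) a b : (forall i, b i = `|k| * a i) ->
  Num.sqrt (\sum_i b i ^+ 2) = `|k| * Num.sqrt (\sum_i a i ^+ 2).
Proof.
move=> ba; under eq_bigr do rewrite ba exprMn.
by rewrite -mulr_sumr sqrtrM ?sqr_ge0// sqrtr_sqr normr_id.
Qed.

Lemma sqrt_sum_eq0 a :
  Num.sqrt (\sum_i a i ^+ 2) = 0 -> forall i, a i = 0.
Proof.
move=> /eqP; rewrite sqrtr_eq0 => a0 i; apply/eqP.
have -> : (a i == 0) = (a i ^+ 2 == 0) by rewrite expf_eq0.
rewrite eq_le sqr_ge0 andbT (le_trans _ a0)//.
by rewrite (bigD1 i)//= lerDl sumr_ge0// => j _; exact: sqr_ge0.
Qed.

End Euclid.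

Section L2_functions.
Variables (R : realType) (n : nat).
Local Notation mu := (@lebesgue_measure R).
Local Notation fT := (R -> 'cV[R]_n).

Definition coord (f : fT) (i : 'I_n) : R -> R := fun t => f t i 0.

Let le12 : (1 <= 2%:E :> \bar R)%E.
Proof. by rewrite lee_fin ler1n. Qed.

Lemma coordP (a : R) (f g : fT) i :
  coord (a *: f + g) i = a *: coord f i + coord g i.
Proof. by apply/funext => t; rewrite /coord !mxE. Qed.

Lemma coordD (f g : fT) i : coord (f + g) i = coord f i + coord g i.
Proof. by apply/funext => t; rewrite /coord !mxE. Qed.

Lemma coordZ (a : R) (f : fT) i : coord (a *: f) i = a *: coord f i.
Proof. by apply/funext => t; rewrite /coord !mxE. Qed.

Definition L2fun : {pred fT} :=
  fun f => [forall i, coord f i \in Lfun mu 2%:E].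

Lemma L2fun_submod_closed : submod_closed L2fun.
Proof.
split.
  apply/forallP => i; rewrite (_ : coord _ i = 0); last first.
    by apply/funext => t; rewrite /coord mxE.
  by have [h _] := Lfun_submod_closed mu le12.
move=> a f g /forallP lf /forallP lg; apply/forallP => i.
rewrite coordP.
by have [_ h] := Lfun_submod_closed mu le12; exact: h.
Qed.

HB.instance Definition _ :=
  GRing.isSubmodClosed.Build R fT L2fun L2fun_submod_closed.

Record L2rep := MkL2rep { L2rep_val :> fT; _ : L2rep_val \in L2fun }.
HB.instance Definition _ := [isSub for L2rep_val].
HB.instance Definition _ := [Choice of L2rep by <:].
HB.instance Definition _ := [SubChoice_isSubLmodule of L2rep by <:].

(* Euclidean norm on R^n: the square is the sum of the squared L^2 norms of the
   coordinates *)
Definition L2norm (f : fT) : R :=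
  Num.sqrt (\sum_i fine ('N[mu]_2%:E[EFin \o coord f i]) ^+ 2).

Lemma L2norm_ge0 f : 0 <= L2norm f. Proof. exact: sqrtr_ge0. Qed.

Lemma L2norm_coord_ge0 f i : 0 <= fine ('N[mu]_2%:E[EFin \o coord f i]).
Proof. by rewrite fine_ge0// Lnorm_ge0. Qed.

Lemma L2normD f g : f \in L2fun -> g \in L2fun ->
  L2norm (f + g) <= L2norm f + L2norm g.
Proof.
move=> /forallP lf /forallP lg; apply: sqrt_sum_triangle => i.
  exact: L2norm_coord_ge0.
rewrite coordD.
exact: (ler_LnormD (Lfun_Sub le12 (lf i)) (Lfun_Sub le12 (lg i))).
Qed.

Lemma L2normZ a f : f \in L2fun -> L2norm (a *: f) = `|a| * L2norm f.
Proof.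
move=> /forallP lf; apply: sqrt_sumZ => i; rewrite coordZ.
have := LnormZ (Lfun_Sub le12 (lf i)) a.
rewrite (_ : (_ \*: _) = a *: coord f i)// => ->.
by rewrite fineM//= -(finite_norm_fine (Lfun_Sub le12 (lf i))).
Qed.

Lemma L2norm_eq0 f : f \in L2fun -> L2norm f = 0 -> f = 0 %[ae mu].
Proof.
move=> /forallP lf /sqrt_sum_eq0 f0.
have {}f0 i : coord f i = 0 %[ae mu].
  have := @fine_Lnormr_eq0 _ _ _ mu _ _ (Lfun_Sub le12 (lf i)) (f0 i).
  exact.
have : \forall t \ae mu, forall i, setT t -> coord f i t = 0.
  exact: (@filter_forall _ _ _ (almost_everywhere mu)).
have F : Filter (almost_everywhere mu) := ae_filter_ringOfSetsType mu.
apply: (@filterS _ (almost_everywhere mu)) => t ft _; apply/colP => i; rewrite mxE; exact: ft.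
Qed.

Lemma eq_L2norm f g : f \in L2fun -> g \in L2fun ->
  f = g %[ae mu] -> L2norm f = L2norm g.
Proof.
move=> /forallP lf /forallP lg fg; congr Num.sqrt; apply: eq_bigr => i _.
congr (fine _ ^+ 2); rewrite unlock /Lnorm; congr (_ `^ _)%E.
have mL h : h \in Lfun mu 2%:E -> measurable_fun setT h.
  by move=> /sub_Lfun_mfun/set_mem.
have F : Filter (almost_everywhere mu) := ae_filter_ringOfSetsType mu.
apply: ae_eq_integral => //.
- apply/measurable_EFinP/(@measurableT_comp _ _ _ _ _ _ (fun x => x `^ 2)) => //.
  by apply: measurableT_comp => //; exact: mL.
- apply/measurable_EFinP/(@measurableT_comp _ _ _ _ _ _ (fun x => x `^ 2)) => //.
  by apply: measurableT_comp => //; exact: mL.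
- by move: fg; apply: filterS => t /[apply]; rewrite /coord /= => ->.
Qed.

End L2_functions.

Section L2_space.
Variables (R : realType) (n : nat).
Local Notation mu := (@lebesgue_measure R).
Local Notation rep := (L2rep R n).
Implicit Types f g h : rep.

Let aeF : Filter (nbhs (almost_everywhere mu)) := ae_filter_ringOfSetsType mu.
#[local] Existing Instance aeF.

Definition L2eq : rel rep := fun f g => `[< (f : R -> _) = g %[ae mu] >].

Let L2eq_refl : reflexive L2eq.
Proof. by move=> f; apply/asboolP; apply: filterE. Qed.

Let L2eq_sym : symmetric L2eq.
Proof.
suff S f g : L2eq f g -> L2eq g f by move=> f g; apply/idP/idP; exact: S.
move=> /asboolP fg; apply/asboolP.
by move: fg; apply: filterS => t /[apply].
Qed.

Let L2eq_trans : transitive L2eq.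
Proof.
move=> g f h /asboolP fg /asboolP gh; apply/asboolP.
by move: fg gh; apply: filterS2 => t fg gh _; rewrite fg// gh.
Qed.

Canonical L2eq_equiv := EquivRel L2eq L2eq_refl L2eq_sym L2eq_trans.

Definition L2 : Type := {eq_quot L2eq}.
HB.instance Definition _ := Choice.on L2.
HB.instance Definition _ := EqQuotient.on L2.

Definition L2fun_of (u : L2) : R -> 'cV[R]_n := L2rep_val (repr u).
Coercion L2fun_of : L2 >-> Funclass.

Definition L2pi f : L2 := \pi f.

Definition L2class (f : R -> 'cV[R]_n) : L2 := L2pi (insubd 0 f).

Let L2W (P : L2 -> Prop) : (forall f, P (L2pi f)) -> forall u, P u.
Proof. by move=> Pf; elim/quotW => f; exact: Pf. Qed.

Lemma L2_piP f g :
  (L2pi f = L2pi g) <-> (f : R -> 'cV[R]_n) = g %[ae mu].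
Proof. by split=> [/eqmodP/asboolP//|fg]; apply/eqmodP/asboolP. Qed.

Lemma L2_reprK f : (repr (L2pi f) : R -> 'cV[R]_n) = f %[ae mu].
Proof. by apply/L2_piP; rewrite /L2pi reprK. Qed.

Definition L2zero : L2 := L2pi 0.
Definition L2add (u v : L2) : L2 := L2pi (repr u + repr v).
Definition L2opp (u : L2) : L2 := L2pi (- repr u).
Definition L2scale (a : R) (u : L2) : L2 := L2pi (a *: repr u).

Lemma L2addE f g : L2add (L2pi f) (L2pi g) = L2pi (f + g).
Proof.
apply/L2_piP; have := L2_reprK g; have := L2_reprK f.
by apply: filterS2 => t fE gE _; rewrite /= !fctE fE// gE.
Qed.

Lemma L2oppE f : L2opp (L2pi f) = L2pi (- f).
Proof.
apply/L2_piP; have := L2_reprK f.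
by apply: filterS => t fE _; rewrite /= !fctE fE.
Qed.

Lemma L2scaleE a f : L2scale a (L2pi f) = L2pi (a *: f).
Proof.
apply/L2_piP; have := L2_reprK f.
by apply: filterS => t fE _; rewrite /= !fctE fE.
Qed.

Let L2addA : associative L2add.
Proof.
elim/L2W => f; elim/L2W => g; elim/L2W => h.
by rewrite !L2addE addrA.
Qed.

Let L2addC : commutative L2add.
Proof. by elim/L2W => f; elim/L2W => g; rewrite !L2addE addrC. Qed.

Let L2add0 : left_id L2zero L2add.
Proof. by elim/L2W => f; rewrite L2addE add0r. Qed.

Let L2addN : left_inverse L2zero L2opp L2add.
Proof. by elim/L2W => f; rewrite L2oppE L2addE addNr. Qed.

HB.instance Definition _ := GRing.isZmodule.Build L2 L2addA L2addC L2add0 L2addN.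

Lemma L2piD f g : L2pi f + L2pi g = L2pi (f + g).
Proof. exact: L2addE. Qed.

Let L2scaleA a b v : L2scale a (L2scale b v) = L2scale (a * b) v.
Proof. by elim/L2W: v => f; rewrite !L2scaleE scalerA. Qed.

Let L2scale1 : left_id 1 L2scale.
Proof. by elim/L2W => f; rewrite L2scaleE scale1r. Qed.

Let L2scaleDr : right_distributive L2scale +%R.
Proof.
move=> a; elim/L2W => f; elim/L2W => g.
by rewrite !(L2piD, L2scaleE) scalerDr.
Qed.

Let L2scaleDl v : {morph L2scale^~ v : a b / a + b}.
Proof.
move=> a b; elim/L2W: v => f.
by rewrite !(L2piD, L2scaleE) scalerDl.
Qed.

HB.instance Definition _ := GRing.Zmodule_isLmodule.Build R L2
  L2scaleA L2scale1 L2scaleDr L2scaleDl.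

Lemma L2D_ae (u v : L2) : ((u + v : L2) : R -> _) = u \+ v %[ae mu].
Proof. exact: L2_reprK. Qed.

Lemma L2Z_ae a (u : L2) : ((a *: u : L2) : R -> _) = a \*: u %[ae mu].
Proof. exact: L2_reprK. Qed.

Lemma L2classE (f : R -> 'cV[R]_n) : f \in @L2fun R n ->
  (L2class f : R -> _) = f %[ae mu].
Proof.
move=> lf; have E : L2rep_val (insubd 0 f) = f := insubdK _ lf.
by have := L2_reprK (insubd 0 f); rewrite E.
Qed.

Lemma L2_mem (u : L2) : L2fun_of u \in @L2fun R n.
Proof. exact: valP. Qed.

Lemma L2_ae_eq (u v : L2) : (u : R -> _) = v %[ae mu] -> u = v.
Proof. by move=> uv; rewrite -[u]reprK -[v]reprK; apply/L2_piP. Qed.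

Let L2normD' (u v : L2) : L2norm (u + v : L2) <= L2norm u + L2norm v.
Proof.
rewrite (eq_L2norm (L2_mem _) _ (L2D_ae u v)).
  exact: L2normD (L2_mem u) (L2_mem v).
exact: rpredD (L2_mem u) (L2_mem v).
Qed.

Let L2normZ' a (u : L2) : L2norm (a *: u : L2) = `|a| * L2norm u.
Proof.
rewrite (eq_L2norm (L2_mem _) _ (L2Z_ae a u)).
  exact: L2normZ (L2_mem u).
exact: rpredZ (L2_mem u).
Qed.

Let L2norm0_eq0 (u : L2) : L2norm u = 0 -> u = 0.
Proof.
move=> /(L2norm_eq0 (L2_mem u)) u0; apply: L2_ae_eq.
have := L2_reprK 0; move: u0; apply: filterS2 => t u0 z0 _.
by rewrite u0//; symmetry; exact: z0.
Qed.

HB.instance Definition _ := Lmodule_isNormed.Build R L2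
  L2normD' L2normZ' L2norm0_eq0.

Lemma normL2E (u : L2) : `|u| = L2norm u. Proof. by []. Qed.

End L2_space.

Section weak_derivative.
Variables (R : realType) (n : nat).
Local Notation mu := (@lebesgue_measure R).
Implicit Types (x v : R -> 'cV[R]_n) (phi : R -> R).

(* C^1 functions with compact support; by mollification they define the same
   weak derivatives as the smooth ones *)
Definition test_function phi :=
  [/\ forall t, derivable phi t 1, continuous (derive1 phi) &
      exists A : R, forall t, A < `|t| -> phi t = 0].

Definition weak_derivative x v := forall (i : 'I_n) phi, test_function phi ->
  \int[mu]_t (x t i 0 * derive1 phi t) = - \int[mu]_t (v t i 0 * phi t).


Lemma Lfun2_compact_support (g : R -> R) (A : R) :
  continuous g -> (forall t, A < `|t| -> g t = 0) -> g \in Lfun mu 2%:E.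
Proof.
move=> cg gA.
have mg : measurable_fun setT g by exact: continuous_measurable_fun.
apply/andP; split; rewrite inE//=.
rewrite /finite_norm unlock; apply: poweR_lty.
pose B : set R := `[- A, A]%classic.
have -> : (\int[mu]_t (`|(EFin \o g) t| `^ 2))%E =
    (\int[mu]_(t in B) `|(g t ^+ 2)%R%:E|)%E.
  rewrite [RHS]integral_mkcond; apply: eq_integral => t _.
  rewrite /= patchE powR_mulrn// -normrX.
  case: ifPn => // /negP tA; rewrite gA ?expr0n/= ?normr0//.
  rewrite ltNge; apply/negP => h; apply: tA.
  by rewrite inE /B/= in_itv/= -ler_norml.
suff /integrableP[_ //] : mu.-integrable B (EFin \o (fun t => g t ^+ 2)).
apply: continuous_compact_integrable; first exact: segment_compact.
apply: continuous_subspaceT => t; under eq_fun do rewrite expr2.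
exact: (@continuousM _ _ g g t (cg t) (cg t)).

Qed.

Lemma test_function_L2 phi : test_function phi ->
  phi \in Lfun mu 2%:E /\ derive1 phi \in Lfun mu 2%:E.
Proof.
case=> dphi cphi [A phiA]; split.
  apply: (Lfun2_compact_support (A := A)) => // t.
  exact/differentiable_continuous/derivable1_diffP.
apply: (Lfun2_compact_support (A := A)) => // t At.
rewrite derive1E (near_eq_derive (g := cst 0)) ?derive_cst//.
have : nbhs t [set s | A < `|s|].
  have := @norm_continuous _ R t; move/cvgr_gt; exact.
by apply: filterS => s /phiA.
Qed.

Lemma integrable_L2_mul (f g : R -> R) : f \in Lfun mu 2%:E ->
  g \in Lfun mu 2%:E -> mu.-integrable setT (EFin \o (fun t => f t * g t)).
Proof. by move=> lf lg; apply/Lfun1_integrable; exact: Lfun2_mul_Lfun1. Qed.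

Lemma weak_derivativeP (a : R) x v y w :
  x \in @L2fun R n -> v \in @L2fun R n -> y \in @L2fun R n -> w \in @L2fun R n ->
  weak_derivative x v -> weak_derivative y w ->
  weak_derivative (a *: x + y) (a *: v + w).
Proof.
move=> /forallP lx /forallP lv /forallP ly /forallP lw xv yw i phi tphi.
have [lphi ldphi] := test_function_L2 tphi.
have E (f g : R -> 'cV[R]_n) psi : coord f i \in Lfun mu 2%:E ->
    coord g i \in Lfun mu 2%:E -> psi \in Lfun mu 2%:E ->
  \int[mu]_t ((a *: f + g) t i 0 * psi t) =
  a * \int[mu]_t (f t i 0 * psi t) + \int[mu]_t (g t i 0 * psi t).
  move=> lf lg lpsi.
  rewrite -RintegralZl//; last exact: integrable_L2_mul lf lpsi.
  rewrite -RintegralD//.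
  - by apply: eq_Rintegral => t _; rewrite !mxE; ring.
  - have := integrableZl measurableT a (integrable_L2_mul lf lpsi).
    by apply: eq_integrable.
  - exact: integrable_L2_mul lg lpsi.
by rewrite !E// xv// yw// mulrN -opprD.
Qed.

Lemma weak_derivative_ae x v w :
  v \in @L2fun R n -> w \in @L2fun R n -> v = w %[ae mu] ->
  weak_derivative x v -> weak_derivative x w.
Proof.
move=> /forallP lv /forallP lw vw xv i phi tphi; rewrite xv//; congr (- fine _).
have [lphi _] := test_function_L2 tphi.
apply: ae_eq_integral => //.
- by have /integrableP[] := integrable_L2_mul (lv i) lphi.
- by have /integrableP[] := integrable_L2_mul (lw i) lphi.
have F : Filter (nbhs (almost_everywhere mu)) := ae_filter_ringOfSetsType mu.
by move: vw; apply: filterS => t /[apply] ->.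
Qed.

End weak_derivative.

Section H1_space.
Variables (R : realType) (n : nat).
Local Notation mu := (@lebesgue_measure R).

(* An element of H^1(R, R^n) is carried by its continuous representative x
   together with the class of its weak derivative, which x determines: H^1 is
   the graph of the weak derivative, with the graph norm. *)
Definition H1pred : {pred (R -> 'cV[R]_n) * L2 R n} := fun p =>
  `[< [/\ continuous p.1, p.1 \in @L2fun R n & weak_derivative p.1 p.2] >].

Lemma H1_submod_closed : submod_closed H1pred.
Proof.
have aeF : Filter (nbhs (almost_everywhere mu)) := ae_filter_ringOfSetsType mu.
split.
  apply/asboolP; split => /=; [exact: cst_continuous|exact: rpred0|].
  move=> i phi tphi; under eq_Rintegral do rewrite mxE mul0r.
  have [lphi _] := test_function_L2 tphi.
  apply/esym/eqP; rewrite Rintegral_cst// mul0r oppr_eq0; apply/eqP.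
  transitivity (\int[mu]_t ((0 : R -> 'cV[R]_n) t i 0 * phi t)).
    congr fine; have lz : 0 \in @L2fun R n by exact: rpred0.
    apply: ae_eq_integral => //.
    - have /integrableP[]// := integrable_L2_mul (forallP (L2_mem (0 : L2 R n)) i) lphi.
    - have /integrableP[]// := integrable_L2_mul (forallP lz i) lphi.
    - have := L2_reprK (0 : L2rep R n); apply: filterS => t E _.
      by have /= := E I; rewrite /L2fun_of => ->.
  by under eq_Rintegral do rewrite mxE mul0r; rewrite Rintegral_cst// mul0r.
move=> a [x v] [y w] /asboolP[/= cx lx xv] /asboolP[/= cy ly yw].
apply/asboolP; split => /=.
- by move=> t; apply: cvgD; [apply: cvgZr; exact: cx|exact: cy].
- by rewrite rpredD// rpredZ.
- apply: (@weak_derivative_ae R n (a *: x + y)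
    (a *: L2fun_of v + L2fun_of w) (L2fun_of (a *: v + w))).
  + by rewrite rpredD ?rpredZ ?L2_mem.
  + exact: L2_mem.
  + have := L2Z_ae a v; have := L2D_ae (a *: v) w.
    by apply: filterS2 => t Dt Zt _; rewrite !fctE Dt// /= Zt.
  + by apply: weak_derivativeP => //; exact: L2_mem.
Qed.

HB.instance Definition _ :=
  GRing.isSubmodClosed.Build R _ H1pred H1_submod_closed.

Record H1 := MkH1 {
  H1_graph : (R -> 'cV[R]_n) * L2 R n;
  _ : H1_graph \in H1pred }.
HB.instance Definition _ := [isSub for H1_graph].
HB.instance Definition _ := [Choice of H1 by <:].
HB.instance Definition _ := [SubChoice_isSubLmodule of H1 by <:].

Definition H1fun (x : H1) : R -> 'cV[R]_n := (H1_graph x).1.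
Coercion H1fun : H1 >-> Funclass.

Definition H1deriv (x : H1) : L2 R n := (H1_graph x).2.

Definition H1norm (x : H1) : R :=
  Num.sqrt (L2norm x ^+ 2 + `|H1deriv x| ^+ 2).

Lemma H1_continuous (x : H1) : continuous x.
Proof. by have /asboolP[] := valP x. Qed.

Lemma H1_L2 (x : H1) : (x : R -> _) \in @L2fun R n.
Proof. by have /asboolP[] := valP x. Qed.

Lemma H1_weak_derivative (x : H1) : weak_derivative x (H1deriv x).
Proof. by have /asboolP[] := valP x. Qed.

Let H1normE (x : H1) :
  H1norm x = Num.sqrt (\sum_b (if b then L2norm x else `|H1deriv x|) ^+ 2).
Proof. by rewrite big_bool. Qed.

Let H1normD (x y : H1) : H1norm (x + y) <= H1norm x + H1norm y.
Proof.
rewrite !H1normE; apply: sqrt_sum_triangle => -[]/=.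
- exact: L2norm_ge0.
- exact: normr_ge0.
- exact: L2normD (H1_L2 x) (H1_L2 y).
- exact: ler_normD.
Qed.

Let H1normZ a (x : H1) : H1norm (a *: x) = `|a| * H1norm x.
Proof.
rewrite !H1normE; apply: sqrt_sumZ => -[]/=.
- exact: L2normZ (H1_L2 x).
- exact: normrZ.
Qed.

Let H1norm_eq0 (x : H1) : H1norm x = 0 -> x = 0.
Proof.
rewrite H1normE => /sqrt_sum_eq0 x0.
have /(L2norm_eq0 (H1_L2 x)) xae := x0 true.
have /normr0_eq0 v0 := x0 false.
apply: val_inj; rewrite [LHS]surjective_pairing; congr pair; last exact: v0.
apply/funext => t; apply/eqP/negPn/negP => /eqP/eqP xt.
have /nbhs_ballP[e /= e0 te] : \forall s \near t, (x : R -> _) s != 0.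
  have := H1_continuous (x := x) (x0 := t); move/cvgr_neq0; exact.
case: xae => N [mN N0 sN].
have : (mu (ball t e) <= mu N)%E.
  apply: le_measure; rewrite ?inE//; first exact: measurable_ball.
  move=> s /te xs; apply: sN => /= /(_ I) /eqP.
  by rewrite (negbTE xs).
rewrite N0 (lebesgue_measure_ball t (ltW e0)).
by rewrite -[leRHS]/(0%:E) lee_fin leNgt mulrn_wgt0.
Qed.

HB.instance Definition _ := Lmodule_isNormed.Build R H1
  H1normD H1normZ H1norm_eq0.

Lemma normH1E (x : H1) : `|x| = H1norm x. Proof. by []. Qed.

End H1_space.

Section Fredholm.
Variables (R : realType) (X Y : normedModType R).

Definition has_dim (A : set X) (n : nat) := exists e : 'I_n -> X,
  (forall c : 'I_n -> R, A (\sum_i c i *: e i)) /\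
  (forall x, A x -> exists! c : 'I_n -> R, x = \sum_i c i *: e i).

(* the classes of the e i form a basis of the quotient Y / A *)
Definition has_codim (A : set Y) (n : nat) := exists e : 'I_n -> Y,
  forall y, exists! c : 'I_n -> R, A (y - \sum_i c i *: e i).

Definition Phi0 (T : {linear X -> Y}) :=
  [/\ continuous T, closed (range T) &
      exists n, has_dim [set x | T x = 0] n /\ has_codim (range T) n].

End Fredholm.

Section derivatives.
Variables (R : realType) (n : nat).
Local Notation V := 'cV[R]_n.

Definition grad (f : V -> R) (xi : V) : V :=
  \col_i 'D_(delta_mx i 0) f xi.

Definition jac (f : V -> V) (xi : V) : 'M[R]_n :=
  \matrix_(i, j) 'D_(delta_mx j 0) (fun eta => f eta i 0) xi.

Definition C2 (f : V -> R) :=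
  [/\ forall xi, differentiable f xi,
      forall xi, differentiable (grad f) xi &
      continuous (jac (grad f))].

Definition jointly_continuous (W : topologicalType) (f : R -> V -> R -> W) :=
  continuous (fun p : R * V * R => f p.1.1 p.1.2 p.2).

Definition bundle0 (U : topologicalType) (f : R -> U -> R) :=
  continuous (fun p : R * U => f p.1 p.2) /\ equicontinuous [set: R] f.

(* equicontinuous C^k_xi-bundle maps; unfolding the recursion gives all the
   iterated partial derivatives of order at most k *)
Fixpoint bundle (k : nat) (f : R -> V -> R) : Prop :=
  bundle0 f /\
  if k is k'.+1 then forall j : 'I_n,
    (forall t xi, derivable (f t) xi (delta_mx j 0)) /\
    bundle k' (fun t xi => 'D_(delta_mx j 0) (f t) xi)
  else True.

End derivatives.

Section Hamiltonian.
Variables (R : realType) (n : nat).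
Local Notation V := 'cV[R]_n.
Local Notation mu := (@lebesgue_measure R).
Implicit Types (H : R -> V -> R -> R) (g : R -> V -> R -> V) (J : 'M[R]_n).

Definition D_xi H (t : R) (xi : V) (lam : R) : V :=
  grad (fun eta => H t eta lam) xi.

Definition D2_xi H (t : R) (xi : V) (lam : R) : 'M[R]_n :=
  jac (fun eta => D_xi H t eta lam) xi.

Definition Dlam_D_xi H (t : R) (xi : V) (lam : R) : V :=
  derive1 (fun l => D_xi H t xi l) lam.

Definition Dlam_D2_xi H (t : R) (xi : V) (lam : R) : 'M[R]_n :=
  derive1 (fun l => D2_xi H t xi l) lam.

Definition D_xi_Dlam_D_xi H (t : R) (xi : V) (lam : R) : 'M[R]_n :=
  jac (fun eta => Dlam_D_xi H t eta lam) xi.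

Definition hypH1 H :=
  [/\ jointly_continuous H,
      forall t lam, C2 (fun xi => H t xi lam) &
      forall t lam, D_xi H t 0 lam = 0].

Definition hypH2 H :=
  [/\ (forall t xi lam, differentiable (fun eta => H t eta lam) xi) /\
      jointly_continuous (D_xi H),
      (forall t xi lam, differentiable (fun eta => D_xi H t eta lam) xi) /\
      jointly_continuous (D2_xi H),
      (forall t xi lam, derivable (fun l => D_xi H t xi l) lam 1) /\
      jointly_continuous (Dlam_D_xi H),
      (forall t xi lam, derivable (fun l => D2_xi H t xi l) lam 1) /\
      jointly_continuous (Dlam_D2_xi H) &
      (forall t xi lam, differentiable (fun eta => Dlam_D_xi H t eta lam) xi) /\
      jointly_continuous (D_xi_Dlam_D_xi H)].

Definition hypH3 H :=
  (forall lam i, bundle 1 (fun t xi => D_xi H t xi lam i 0)) /\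
  (forall i j, bundle0 (fun t (p : V * R) => Dlam_D2_xi H t p.1 p.2 i j)).

Definition hypH4 H := forall i j,
  (fun t => D2_xi H t 0 0 i j) \in Lfun mu +oo%E /\
  (fun t => Dlam_D2_xi H t 0 0 i j) \in Lfun mu +oo%E.

Definition asymptotic H g (lam : R) (infty : set_system R) :=
  [/\ forall i, bundle 1 (fun t xi => g t xi lam i 0),
      forall t, g t 0 lam = 0,
      forall B : set V, bounded_set B ->
        {uniform B, (fun t xi =>
           D2_xi H t xi lam - jac (fun eta => g t eta lam) xi) @ infty
             --> (fun=> 0 : 'M[R]_n)} &
      exists2 T : R, 0 < T & forall t xi, g (t + T) xi lam = g t xi lam].

Definition hypHinfty H gp gm := forall lam,
  asymptotic H gp lam (pinfty_nbhs R) /\ asymptotic H gm lam (ninfty_nbhs R).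

(* L2class sends a function outside L^2 to 0; under the hypotheses above the
   functions below always belong to L^2. *)
Definition Fham J H (lam : R) (x : H1 R n) : L2 R n :=
  L2class (fun t => J *m H1deriv x t - D_xi H t (x t) lam).

Definition Fasym J g (lam : R) (x : H1 R n) : L2 R n :=
  L2class (fun t => J *m H1deriv x t - g t (x t) lam).

End Hamiltonian.

(* Main.v *)
Require Import Defs.
From HB Require Import structures.
From mathcomp Require Import all_boot all_order all_algebra.
From mathcomp Require Import all_classical all_reals all_analysis.
From mathcomp Require Import measurable_realfun ring lra.

(** Let U be an ultrafilter on the preimage of the compact set K in the closed
bounded set W, and write h = D_xi H(., ., lambda). Along U the values F(x)
converge to some y in K and the norms of the x are bounded; it has to be shown
that the x themselves converge in H^1. This happens in three stages.

Local limit. Bounded subsets of H^1 are bounded in the sup norm and equi-Hoelder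
of exponent 1/2, so the x converge locally uniformly to some X. The equation
J x' = F(x) + h(t, x) then makes the derivatives converge in L^2 of every bounded
interval, hence X is in H^1 and F(X) = y ([H1_ultra_equation]).

Uniform limit. If the convergence were not uniform on the line, there would be
times tau x, escaping to plus or minus infinity along U, at which x - X, and hence
x, stays away from 0. Translate x by the multiple of the period T^+ or T^- next to
tau x. The translates are bounded in H^1, and they satisfy translated equations in
which the right-hand side tends to 0 locally in L^2 while the nonlinearity tends
to g^+ or g^-. By the first stage they converge locally uniformly to a zero of F^+
or F^-, that is, to 0: a contradiction ([drift_vanishes], [uniform_convergence]).

Strong limit. Let T u = J u' - B u, with B(t) = D_xi h(t, x0(t)), be the
derivative of F(lambda, .) at x0 ([diff_Fop]). As J is antisymmetric and B is a
matrix of second derivatives, T is symmetric for the inner product of L^2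
([ip_T_sym]), so its kernel is orthogonal to its range; since the index is zero,
L^2 is the sum of the kernel and the range. The principle of uniform boundedness
turns this into a bound of the L^2 norm of u by T u and the inner products of u
with a basis of the kernel ([a_priori_bound]). For u = x - X those inner
products tend to 0, because u is bounded in L^2 and tends to 0 locally
([pairing_vanishes]). So does T u: up to F(x) - F(X) it is u(t) times a
difference between derivatives of h on the segment from X(t) to x(t) and at
x0(t). On a bounded interval u is uniformly small; outside a large interval x, X
and x0 are all uniformly small, and the derivatives of h near 0 are close to
each other by equicontinuity ([linearized_residual_vanishes]). Thus u tends to 0
in L^2, and in H^1 by the equation ([strong_convergence]). *)

Set Implicit Arguments.
Unset Strict Implicit.
Unset Printing Implicit Defensive.

Import Order.TTheory GRing.Theory Num.Theory.
Import numFieldNormedType.Exports.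

Local Open Scope classical_set_scope.
Local Open Scope ring_scope.

(** * Euclidean vectors *)

Section euclidean.
Variables (R : realType) (n : nat).
Local Notation V := 'cV[R]_n.
Implicit Types a b : V.

Definition sq a : R := \sum_i a i 0 ^+ 2.
Definition dot a b : R := \sum_i a i 0 * b i 0.

Lemma sq_ge0 a : 0 <= sq a.
Proof. by apply: sumr_ge0 => i _; exact: sqr_ge0. Qed.

Lemma dotaa a : dot a a = sq a.
Proof. by apply: eq_bigr => i _; rewrite expr2. Qed.

Lemma dotC a b : dot a b = dot b a.
Proof. by apply: eq_bigr => i _; rewrite mulrC. Qed.

Lemma dotDr a b c : dot a (b + c) = dot a b + dot a c.
Proof. by rewrite -big_split; apply: eq_bigr => i _; rewrite mxE mulrDr. Qed.

Lemma dotZr k a b : dot a (k *: b) = k * dot a b.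
Proof. by rewrite mulr_sumr; apply: eq_bigr => i _; rewrite mxE; ring. Qed.

Lemma dot_mulmx (A : 'M[R]_n) a b : dot (A *m a) b = dot a (A^T *m b).
Proof.
rewrite /dot; under eq_bigr do rewrite mxE mulr_suml.
rewrite exchange_big/=; apply: eq_bigr => i _.
by rewrite mxE mulr_sumr; apply: eq_bigr => j _; rewrite mxE; ring.
Qed.

Lemma sqN a : sq (- a) = sq a.
Proof. by apply: eq_bigr => i _; rewrite mxE sqrrN. Qed.

Lemma sq0 : sq 0 = 0.
Proof. by rewrite /sq big1// => i _; rewrite mxE expr0n. Qed.

Lemma sqD a b : sq (a + b) <= 2 * sq a + 2 * sq b.
Proof.
rewrite !mulr_sumr -big_split /=; apply: ler_sum => i _; rewrite mxE.
have := sqr_ge0 (a i 0 - b i 0); nra.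
Qed.

Lemma sqB a b : sq (a - b) <= 2 * sq a + 2 * sq b.
Proof. by rewrite -(sqN b); exact: sqD. Qed.

Lemma sq_orthogonal (J : 'M[R]_n) a : J^T *m J = 1%:M -> sq (J *m a) = sq a.
Proof. by move=> JJ; rewrite -!dotaa dot_mulmx mulmxA JJ mul1mx. Qed.

Lemma le_coord_norm a i : `|a i 0| <= `|a|.
Proof.
rewrite [leRHS]/Num.norm/= mx_normrE.
by apply/bigmax_geP; right; exists (i, 0).
Qed.

Lemma norm_le_coord a (M : R) : 0 <= M -> (forall i, `|a i 0| <= M) -> `|a| <= M.
Proof.
move=> M0 aM; rewrite [leLHS]/Num.norm/= mx_normrE bigmax_le// => -[i j] _ /=.
by rewrite ord1.
Qed.

Lemma le_coord_sq a i : a i 0 ^+ 2 <= sq a.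
Proof. by rewrite /sq (bigD1 i)//= lerDl sumr_ge0// => j _; exact: sqr_ge0. Qed.

Lemma norm_sq a : `|a| ^+ 2 <= sq a.
Proof.
rewrite -[leRHS]sqr_sqrtr ?sq_ge0// lerXn2r ?nnegrE ?sqrtr_ge0//.
apply: norm_le_coord => [|i]; first exact: sqrtr_ge0.
by rewrite -sqrtr_sqr ler_wsqrtr// le_coord_sq.
Qed.

Lemma sq_norm a : sq a <= n%:R * `|a| ^+ 2.
Proof.
have -> : n%:R * (`|a| ^+ 2) = \sum_(i < n) (`|a| ^+ 2).
  by rewrite sumr_const card_ord mulr_natl.
apply: ler_sum => i _.
by rewrite -real_normK ?num_real// lerXn2r ?nnegrE// le_coord_norm.
Qed.

Lemma sq_le_norm a (M : R) : `|a| <= M -> sq a <= n%:R * M ^+ 2.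
Proof.
move=> aM; apply: le_trans (sq_norm a) _; rewrite ler_wpM2l//.
by rewrite lerXn2r ?nnegrE// (le_trans _ aM).
Qed.

Lemma sum_coord_norm a : \sum_i `|a i 0| <= n%:R * `|a|.
Proof.
have -> : n%:R * `|a| = \sum_(i < n) `|a|.
  by rewrite sumr_const card_ord mulr_natl.
apply: ler_sum => i _.
exact: le_coord_norm.
Qed.

End euclidean.

(** * Square-integrable functions *)

Section square_integrable.
Variables (R : realType) (n : nat).
Local Notation V := 'cV[R]_n.
Local Notation mu := (@lebesgue_measure R).
Local Notation coord := Defs.coord.
Implicit Types (f g h : R -> V) (D : set R).

Definition vmeasurable f := forall i, measurable_fun setT (coord f i).

(** The squared L^2 norm of f over D, kept as an extended real so that it makes
    sense before f is known to be square integrable. *)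
Definition energy D f : \bar R := (\int[mu]_(t in D) (sq (f t))%:E)%E.

Lemma vmeasurableD f g : vmeasurable f -> vmeasurable g -> vmeasurable (f \+ g).
Proof.
move=> mf mg i; rewrite (_ : coord _ i = coord f i \+ coord g i).
  by apply: measurable_funD; [exact: mf|exact: mg].
by apply/funext => t; rewrite /coord !mxE.
Qed.

Lemma vmeasurableB f g : vmeasurable f -> vmeasurable g -> vmeasurable (f \- g).
Proof.
move=> mf mg i; rewrite (_ : coord _ i = coord f i \- coord g i).
  by apply: measurable_funB; [exact: mf|exact: mg].
by apply/funext => t; rewrite /coord !mxE.
Qed.

Lemma vmeasurable_mulmx (A : R -> 'M[R]_n) f :
  (forall i j, measurable_fun setT (fun t => A t i j)) ->
  vmeasurable f -> vmeasurable (fun t => A t *m f t).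
Proof.
move=> mA mf i; rewrite (_ : coord _ i = fun t => \sum_j A t i j * f t j 0).
  by apply: measurable_sum => j; apply: measurable_funM; [exact: mA|exact: mf].
by apply/funext => t; rewrite /coord !mxE.
Qed.

Lemma vmeasurable_continuous f : continuous f -> vmeasurable f.
Proof.
move=> cf i; apply: continuous_measurable_fun => t.
exact: (continuous_comp (cf t) (@coord_continuous _ _ _ i 0 _)).
Qed.

Lemma measurable_dot f g : vmeasurable f -> vmeasurable g ->
  measurable_fun setT (fun t => dot (f t) (g t)).
Proof.
move=> mf mg; apply: measurable_sum => i.
by apply: measurable_funM; [exact: mf|exact: mg].
Qed.

Lemma measurable_sq f : vmeasurable f -> measurable_fun setT (fun t => sq (f t)).
Proof.
move=> mf; under eq_fun do rewrite -dotaa; exact: measurable_dot.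
Qed.

Lemma measurable_sqE f D : vmeasurable f ->
  measurable_fun D (fun t => (sq (f t))%:E).
Proof.
move=> mf; apply/measurable_EFinP; apply: measurable_funTS; exact: measurable_sq.
Qed.

Lemma energy_ge0 D f : (0 <= energy D f)%E.
Proof. by apply: integral_ge0 => t _; rewrite lee_fin sq_ge0. Qed.

Lemma energyS D D' f : measurable D -> measurable D' -> vmeasurable f ->
  D `<=` D' -> (energy D f <= energy D' f)%E.
Proof.
move=> mD mD' mf DD'; apply: ge0_subset_integral => //.
- exact: measurable_sqE.
- by move=> t _; rewrite lee_fin sq_ge0.
Qed.

(** All the quadratic estimates below reduce to a pointwise comparison of squared
    norms. *)
Lemma energy_le_comb D f g h (k l : R) : measurable D -> 0 <= k -> 0 <= l ->
  vmeasurable f -> vmeasurable g -> vmeasurable h ->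
  (forall t, D t -> sq (f t) <= k * sq (g t) + l * sq (h t)) ->
  (energy D f <= k%:E * energy D g + l%:E * energy D h)%E.
Proof.
move=> mD k0 l0 mf mg mh fgh.
have mZ c u : vmeasurable u -> measurable_fun D (fun t => (c%:E * (sq (u t))%:E)%E).
  by move=> mu'; apply: emeasurable_funM => //; exact: measurable_sqE.
rewrite /energy -!ge0_integralZl_EFin//; try (by move=> t _; rewrite lee_fin sq_ge0);
  try exact: measurable_sqE.
rewrite -ge0_integralD//; try (by move=> t _; rewrite mule_ge0// lee_fin sq_ge0);
  try exact: mZ.
apply: ge0_le_integral => //; try exact: measurable_sqE.
- by move=> t _; rewrite lee_fin sq_ge0.
- by apply: emeasurable_funD; exact: mZ.
Qed.

Lemma energy_leZ D f g (k : R) : measurable D -> 0 <= k ->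
  vmeasurable f -> vmeasurable g ->
  (forall t, D t -> sq (f t) <= k * sq (g t)) ->
  (energy D f <= k%:E * energy D g)%E.
Proof.
move=> mD k0 mf mg fg.
have -> : (k%:E * energy D g = k%:E * energy D g + 0%:E * energy D g)%E.
  by rewrite mul0e adde0.
by apply: energy_le_comb => // t Dt; rewrite mul0r addr0 fg.
Qed.

Lemma energyD D f g : measurable D -> vmeasurable f -> vmeasurable g ->
  (energy D (f \+ g)%R <= 2%:E * energy D f + 2%:E * energy D g)%E.
Proof.
move=> mD mf mg; apply: energy_le_comb => //; first exact: vmeasurableD.
by move=> t _; exact: sqD.
Qed.

Lemma energy_le_cst (a b : R) f (c : R) : a <= b -> vmeasurable f ->
  (forall t, a <= t <= b -> sq (f t) <= c) ->
  (energy `[a, b] f <= (c * (b - a))%:E)%E.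
Proof.
move=> ab mf fc.
apply: (@le_trans _ _ (\int[mu]_(t in `[a, b]) (cst c%:E t))%E).
  apply: ge0_le_integral => //.
  - by move=> t _; rewrite lee_fin sq_ge0.
  - exact: measurable_sqE.
rewrite integral_cst//= lebesgue_measure_itv/= lte_fin.
case: ltgtP ab => [ab _|//|-> _]; first by rewrite -EFinB -EFinM.
by rewrite subrr mulr0 mule0.
Qed.

Lemma energy_ae D f g : measurable D -> vmeasurable f -> vmeasurable g ->
  f = g %[ae mu] -> energy D f = energy D g.
Proof.
move=> mD mf mg fg.
have F : Filter (nbhs (almost_everywhere mu)) := ae_filter_ringOfSetsType mu.
apply: ge0_ae_eq_integral => //; try exact: measurable_sqE;
  try by move=> t _; rewrite lee_fin sq_ge0.
by move: fg; apply: filterS => t /= fg _; rewrite fg.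
Qed.

Lemma Lfun2P (f : R -> R) : (f \in Lfun mu 2%:E) <->
  measurable_fun setT f /\ (\int[mu]_t ((f t) ^+ 2)%:E < +oo)%E.
Proof.
have E : (\int[mu]_t (`|(EFin \o f) t| `^ 2) = \int[mu]_t ((f t) ^+ 2)%:E)%E.
  apply: eq_integral => t _ /=.
  by rewrite powR_mulrn// -normrX ger0_norm// sqr_ge0.
split=> [/andP[mf lf]|[mf lf]].
  rewrite !inE /= in mf lf; split=> //; rewrite -E -powR_Lnorm//.
  exact: poweR_lty.
apply/andP; rewrite !inE /=; split => //; rewrite /finite_norm unlock.
by apply: poweR_lty; rewrite E.
Qed.

Lemma sqr_fine_Lnorm2 (f : R -> R) : f \in Lfun mu 2%:E ->
  ((fine ('N[mu]_2%:E[EFin \o f])) ^+ 2)%:E = (\int[mu]_t ((f t) ^+ 2)%:E)%E.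
Proof.
move=> /andP[]; rewrite !inE /= => mf lf.
rewrite -powR_mulrn ?fine_ge0 ?Lnorm_ge0// -poweR_EFin fineK; last first.
  by rewrite ge0_fin_numE// Lnorm_ge0.
rewrite powR_Lnorm//; apply: eq_integral => t _ /=.
by rewrite powR_mulrn// -normrX ger0_norm// sqr_ge0.
Qed.

Lemma energyT_sum f : vmeasurable f ->
  energy setT f = (\sum_i \int[mu]_t ((coord f i t) ^+ 2)%:E)%E.
Proof.
move=> mf; rewrite -ge0_integral_sum//.
- by apply: eq_integral => t _; rewrite sumEFin.
- by move=> i; apply/measurable_EFinP/measurable_funX; exact: mf.
- by move=> i t _; rewrite lee_fin sqr_ge0.
Qed.

Lemma L2funP f : f \in @L2fun R n <->
  vmeasurable f /\ (energy setT f < +oo)%E.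
Proof.
split.
  move=> /forallP lf; have mf : vmeasurable f by move=> i; have /Lfun2P[] := lf i.
  split=> //; rewrite energyT_sum//; apply/lte_sum_pinfty => i _.
  by have /Lfun2P[] := lf i.
move=> [mf]; rewrite energyT_sum// => fy; apply/forallP => i; apply/Lfun2P.
split; first exact: mf.
apply: le_lt_trans fy; rewrite (bigD1 i)//=; apply: leeDl.
by apply: sume_ge0 => j _; apply: integral_ge0 => t _; rewrite lee_fin sqr_ge0.
Qed.

Lemma L2fun_vmeasurable f : f \in @L2fun R n -> vmeasurable f.
Proof. by case/L2funP. Qed.

Lemma L2_vmeasurable (u : L2 R n) : vmeasurable u.
Proof. apply: L2fun_vmeasurable; exact: L2_mem. Qed.

Lemma L2norm_energy f : f \in @L2fun R n ->
  (L2norm f ^+ 2)%:E = energy setT f.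
Proof.
move=> lf; have /L2funP[mf _] := lf; move: lf => /forallP lf.
rewrite energyT_sum// /L2norm sqr_sqrtr; last first.
  by apply: sumr_ge0 => i _; exact: sqr_ge0.
by rewrite -sumEFin; apply: eq_bigr => i _; rewrite sqr_fine_Lnorm2.
Qed.

Lemma L2norm_le f (c : R) : 0 <= c -> f \in @L2fun R n ->
  (L2norm f <= c) = (energy setT f <= (c ^+ 2)%:E)%E.
Proof.
move=> c0 lf; rewrite -L2norm_energy// lee_fin ler_pXn2r// nnegrE//.
exact: L2norm_ge0.
Qed.

Lemma energy_le_L2norm f D : measurable D -> f \in @L2fun R n ->
  (energy D f <= (L2norm f ^+ 2)%:E)%E.
Proof.
by move=> mD lf; rewrite L2norm_energy// energyS//; exact: L2fun_vmeasurable.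
Qed.

Lemma L2fun_le_comb f g h k l : 0 <= k -> 0 <= l ->
  vmeasurable f -> g \in @L2fun R n -> h \in @L2fun R n ->
  (forall t, sq (f t) <= k * sq (g t) + l * sq (h t)) -> f \in @L2fun R n.
Proof.
move=> k0 l0 mf lg lh fgh; apply/L2funP; split => //.
apply: (@le_lt_trans _ _ (k%:E * energy setT g + l%:E * energy setT h)%E).
  by apply: energy_le_comb => //; exact: L2fun_vmeasurable.
by rewrite -!L2norm_energy// -!EFinM -EFinD ltry.
Qed.

Lemma L2fun_leZ f g k : 0 <= k -> vmeasurable f -> g \in @L2fun R n ->
  (forall t, sq (f t) <= k * sq (g t)) -> f \in @L2fun R n.
Proof.
move=> k0 mf lg fg; apply: (@L2fun_le_comb f g g k 0) => // t.
by rewrite mul0r addr0.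
Qed.

End square_integrable.

(** * The Cauchy-Schwarz inequality and tails *)

Section cauchy_schwarz.
Variables (R : realType).
Local Notation mu := (@lebesgue_measure R).
Local Notation coord := Defs.coord.
Implicit Types (D : set R).

(** The inequality of the means with a free weight k becomes Cauchy-Schwarz once
    it is integrated and optimized over k. *)
Lemma integral_amgm D (w F G : R -> R) (a b : R) :
  measurable D -> measurable_fun D w -> measurable_fun D F ->
  measurable_fun D G ->
  (forall t, D t -> 0 <= w t) -> (forall t, D t -> 0 <= F t) ->
  (forall t, D t -> 0 <= G t) ->
  (forall k t, 0 < k -> D t -> 2 * w t <= k * F t + k^-1 * G t) ->
  0 <= a -> 0 <= b ->
  (\int[mu]_(t in D) (F t)%:E <= (a ^+ 2)%:E)%E ->
  (\int[mu]_(t in D) (G t)%:E <= (b ^+ 2)%:E)%E ->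
  (\int[mu]_(t in D) (w t)%:E <= (a * b)%:E)%E.
Proof.
move=> mD mw mF mG w0 F0 G0 wFG a0 b0 Fa Gb.
apply/lee_addgt0Pr => e e0.
pose d := e / (a + b + e + 1).
have abe : 0 < a + b + e + 1 by lra.
have d0 : 0 < d by exact: divr_gt0.
have d1 : d * (a + b + e + 1) = e by rewrite /d divfK// gt_eqF.
have ad : 0 < a + d by lra.
have bd : 0 < b + d by lra.
have dE : (a + d) * (b + d) <= a * b + e.
  have : d <= 1 by rewrite /d ler_pdivrMr// mul1r; lra.
  nra.
(* The optimal weight is b / a; d keeps it meaningful when a or b vanishes. *)
pose k := (b + d) / (a + d).
have k0 : 0 < k by exact: divr_gt0.
have step : (2%:E * \int[mu]_(t in D) (w t)%:E <=
    k%:E * \int[mu]_(t in D) (F t)%:E + k^-1%:E * \int[mu]_(t in D) (G t)%:E)%E.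
  have mE (u : R -> R) : measurable_fun D u -> measurable_fun D (EFin \o u).
    by move=> mu'; exact/measurable_EFinP.
  have mZ (c : R) (u : R -> R) : measurable_fun D u ->
      measurable_fun D (fun t => (c%:E * (u t)%:E)%E).
    by move=> mu'; apply: emeasurable_funM => //; exact: mE.
  have V0 : 0 <= k^-1 by rewrite invr_ge0 ltW.
  rewrite -!ge0_integralZl_EFin//; try exact: mE; try exact: ltW.
  rewrite -ge0_integralD//; try exact: mZ.
  + apply: ge0_le_integral => //; try exact: mZ.
    * by move=> t Dt; rewrite mule_ge0// lee_fin w0.
    * by apply: emeasurable_funD; exact: mZ.
    * by move=> t Dt; rewrite -!EFinM -EFinD lee_fin wFG.
  + by move=> t Dt; rewrite mule_ge0// lee_fin ?F0// ltW.
  + by move=> t Dt; rewrite mule_ge0// lee_fin G0.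
have {step} : (2%:E * \int[mu]_(t in D) (w t)%:E <= (2 * (a * b + e))%:E)%E.
  apply: (le_trans step).
  apply: (@le_trans _ _ (k%:E * (a ^+ 2)%:E + k^-1%:E * (b ^+ 2)%:E)%E).
    by apply: leeD; apply: lee_wpmul2l; rewrite // lee_fin ?invr_ge0 ltW.
  rewrite -!EFinM -EFinD lee_fin.
  have ka : k * a ^+ 2 <= (b + d) * (a + d).
    rewrite /k mulrAC ler_pdivrMr// -mulrA -expr2 ler_wpM2l ?(ltW bd)//.
    by rewrite lerXn2r ?nnegrE//; lra.
  have kb : k^-1 * b ^+ 2 <= (a + d) * (b + d).
    rewrite /k invf_div mulrAC ler_pdivrMr// -mulrA -expr2 ler_wpM2l ?(ltW ad)//.
    by rewrite lerXn2r ?nnegrE//; lra.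
  lra.
by rewrite EFinM lee_pmul2l// EFinD.
Qed.

Lemma cauchy_schwarz D (f g : R -> R) (a b : R) :
  measurable D -> measurable_fun D f -> measurable_fun D g ->
  0 <= a -> 0 <= b ->
  (\int[mu]_(t in D) ((f t) ^+ 2)%:E <= (a ^+ 2)%:E)%E ->
  (\int[mu]_(t in D) ((g t) ^+ 2)%:E <= (b ^+ 2)%:E)%E ->
  (\int[mu]_(t in D) `|f t * g t|%:E <= (a * b)%:E)%E.
Proof.
move=> mD mf mg; apply: integral_amgm => //.
- by apply: measurableT_comp => //; exact: measurable_funM.
- exact: measurable_funX.
- exact: measurable_funX.
- by move=> t _; exact: sqr_ge0.
- by move=> t _; exact: sqr_ge0.
move=> k t k0 _; rewrite normrM -(real_normK (num_real (f t))).
rewrite -(real_normK (num_real (g t))).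
have kV : k * k^-1 = 1 by rewrite divff// gt_eqF.
have V0 : 0 < k^-1 by rewrite invr_gt0.
set x := `|f t|; set y := `|g t|; set l := k^-1 in kV V0 *.
have -> : k * x ^+ 2 + l * y ^+ 2 =
  k * (x - l * y) ^+ 2 + 2 * (k * l) * (x * y) + (l - (k * l) * l) * y ^+ 2.
  by ring.
by rewrite kV mulr1 mul1r subrr mul0r addr0 lerDr mulr_ge0 ?sqr_ge0// ltW.
Qed.

Variable n : nat.
Local Notation V := 'cV[R]_n.
Implicit Types (f g : R -> V).

Lemma cauchy_schwarz_dot D f g (a b : R) :
  measurable D -> vmeasurable f -> vmeasurable g -> 0 <= a -> 0 <= b ->
  (energy D f <= (a ^+ 2)%:E)%E -> (energy D g <= (b ^+ 2)%:E)%E ->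
  (\int[mu]_(t in D) `|dot (f t) (g t)|%:E <= (a * b)%:E)%E.
Proof.
move=> mD mf mg; apply: integral_amgm => //.
- apply: measurableT_comp => //; apply: measurable_funTS; exact: measurable_dot.
- by apply: measurable_funTS; exact: measurable_sq.
- by apply: measurable_funTS; exact: measurable_sq.
- by move=> t _; exact: sq_ge0.
- by move=> t _; exact: sq_ge0.
move=> k t k0 _; have V0 : 0 < k^-1 by rewrite invr_gt0.
apply: (@le_trans _ _ (2 * \sum_i `|f t i 0 * g t i 0|)).
  by rewrite ler_pM2l// ler_norm_sum.
rewrite !mulr_sumr -big_split/=; apply: ler_sum => i _.
rewrite normrM -(real_normK (num_real (f t i 0))).
rewrite -(real_normK (num_real (g t i 0))).
have kV : k * k^-1 = 1 by rewrite divff// gt_eqF.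
set x := `|f t i 0|; set y := `|g t i 0|; set l := k^-1 in kV V0 *.
have -> : k * x ^+ 2 + l * y ^+ 2 =
  k * (x - l * y) ^+ 2 + 2 * (k * l) * (x * y) + (l - (k * l) * l) * y ^+ 2.
  by ring.
by rewrite kV mulr1 mul1r subrr mul0r addr0 lerDr mulr_ge0 ?sqr_ge0// ltW.
Qed.

Lemma coord_energy D f i : measurable D -> vmeasurable f ->
  (\int[mu]_(t in D) (f t i 0 ^+ 2)%:E <= energy D f)%E.
Proof.
move=> mD mf; apply: ge0_le_integral => //.
- by move=> t _; rewrite lee_fin sqr_ge0.
- apply/measurable_EFinP; apply: measurable_funTS.
  by apply: measurable_funX; exact: mf.
- exact: measurable_sqE.
- by move=> t _; rewrite lee_fin le_coord_sq.
Qed.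

Lemma integrable_L2_interval (v : R -> V) (a b : R) i : v \in @L2fun R n ->
  mu.-integrable `[a, b] (EFin \o (fun t => v t i 0)).
Proof.
move=> lv; have mv := L2fun_vmeasurable lv.
apply/integrableP; split.
  by apply/measurable_EFinP; apply: measurable_funTS; exact: mv.
have [ab|ba] := leP a b; last first.
  by rewrite set_itv_ge ?integral_set0// bnd_simp -ltNge.
apply: (@le_lt_trans _ _ (\int[mu]_(t in `[a, b]) `|v t i 0 * cst 1 t|%:E)%E).
  rewrite le_eqVlt; apply/orP; left; apply/eqP.
  by apply: eq_integral => t _ /=; rewrite mulr1.
apply: (@le_lt_trans _ _ ((L2norm v * Num.sqrt (b - a))%:E)); last exact: ltry.
apply: cauchy_schwarz => //.
- by apply: measurable_funTS; exact: mv.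
- exact: L2norm_ge0.
- apply: le_trans (coord_energy _ _ mv) _ => //.
  exact: energy_le_L2norm.
- rewrite sqr_sqrtr ?subr_ge0//.
  under eq_integral do rewrite expr1n.
  rewrite integral_cst//= lebesgue_measure_itv/= lte_fin mul1e.
  by case: ltgtP ab => [_ _|//|-> _]; rewrite ?subrr// EFinB.
Qed.

Lemma Rintegral_interval_le (v : R -> V) (a b c : R) i : v \in @L2fun R n ->
  a <= b -> 0 <= c -> (energy `[a, b] v <= (c ^+ 2)%:E)%E ->
  \int[mu]_(t in `[a, b]) `|v t i 0| <= c * Num.sqrt (b - a).
Proof.
move=> lv ab c0 vc; have mv := L2fun_vmeasurable lv.
rewrite -lee_fin fineK; last first.
  by apply: integrable_fin_num => //; apply/integrable_norm/integrable_L2_interval.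
have -> : (\int[mu]_(t in `[a, b]) (`|v t i 0|)%:E =
           \int[mu]_(t in `[a, b]) `|v t i 0 * cst 1 t|%:E)%E.
  by apply: eq_integral => t _ /=; rewrite mulr1.
apply: cauchy_schwarz => //.
- by apply: measurable_funTS; exact: mv.
- by apply: le_trans (coord_energy _ _ mv) vc.
- rewrite sqr_sqrtr ?subr_ge0//.
  under eq_integral do rewrite expr1n.
  rewrite integral_cst//= lebesgue_measure_itv/= lte_fin mul1e.
  by case: ltgtP ab => [_ _|//|-> _]; rewrite ?subrr// EFinB.
Qed.

Lemma energy_setC D f : measurable D -> vmeasurable f ->
  energy setT f = (energy D f + energy (~` D) f)%E.
Proof.
move=> mD mf; rewrite /energy -(setvU D) setUC ge0_integral_setU//.
- exact: measurableC.
- exact: measurable_sqE.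
- by move=> t _; rewrite lee_fin sq_ge0.
- by apply/disj_set2P; rewrite setICr.
Qed.

Lemma cvg_energy f : vmeasurable f ->
  energy `[- k%:R, k%:R] f @[k --> \oo] --> energy setT f.
Proof.
move=> mf.
have -> : [set: R] = \bigcup_k `[- k%:R, k%:R]%classic.
  apply/seteqP; split=> // t _; exists (Num.truncn `|t|).+1 => //=.
  rewrite in_itv/= -ler_norml ltW//; exact: truncnS_gt.
apply: ge0_nondecreasing_set_cvg_integral => //.
- move=> k m km; rewrite subsetEset => t /=; rewrite !in_itv/= -!ler_norml.
  by move=> /le_trans; apply; rewrite ler_nat.
- by move=> k; exact: measurable_sqE.
- by move=> k t _; rewrite lee_fin sq_ge0.
Qed.

Lemma energy_le_local f (c : R) : vmeasurable f ->
  (forall A : R, 0 <= A -> (energy `[(- A)%R, A] f <= c%:E)%E) ->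
  (energy setT f <= c%:E)%E.
Proof.
move=> mf fc; rewrite -(cvg_lim _ (cvg_energy mf))//; apply: lime_le.
  by apply: cvgP; exact: cvg_energy.
by near=> k; exact: fc.
Unshelve. all: by end_near. Qed.

Lemma energy_tail f (e : R) : f \in @L2fun R n -> 0 < e ->
  exists2 A : R, 0 <= A & (energy (~` `[(- A)%R, A]) f <= e%:E)%E.
Proof.
move=> lf e0; have mf := L2fun_vmeasurable lf.
have ffin : energy setT f = (L2norm f ^+ 2)%:E by rewrite L2norm_energy.
have cf := cvg_energy mf; rewrite ffin in cf.
have : \forall k \near \oo, ((L2norm f ^+ 2 - e)%:E < energy `[(- k%:R)%R, k%:R] f)%E.
  apply: (cf [set y | ((L2norm f ^+ 2 - e)%:E < y)%E]) => /=.
  by apply: open_nbhs_nbhs; split; [exact: open_ereal_gt_ereal|rewrite /= lte_fin; lra].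
move=> [k _ /(_ k (leqnn k))] /= fk; exists k%:R; first exact: ler0n.
have := energy_setC (D := `[- k%:R, k%:R]) _ mf => /(_ (measurable_itv _)).
rewrite ffin => fE.
have fin1 : energy `[- k%:R, k%:R] f \is a fin_num.
  rewrite ge0_fin_numE ?energy_ge0// (le_lt_trans (energy_le_L2norm _ lf))//.
  exact: ltry.
have fin2 : energy (~` `[- k%:R, k%:R]) f \is a fin_num.
  rewrite ge0_fin_numE ?energy_ge0// (le_lt_trans (energy_le_L2norm _ lf))//.
    exact: measurableC.
  exact: ltry.
move: fk fE; rewrite -(fineK fin1) -(fineK fin2) lte_fin lee_fin -EFinD => + [].
lra.
Qed.

End cauchy_schwarz.

(** * Inner product and completeness of L^2 *)

Section inner_product.
Variables (R : realType) (n : nat).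
Local Notation V := 'cV[R]_n.
Local Notation mu := (@lebesgue_measure R).
Implicit Types (f g h : R -> V) (D : set R).

Definition ip f g : R := \int[mu]_t dot (f t) (g t).

Lemma integrable_dot f g : f \in @L2fun R n -> g \in @L2fun R n ->
  mu.-integrable setT (EFin \o (fun t => dot (f t) (g t))).
Proof.
move=> lf lg; have mf := L2fun_vmeasurable lf; have mg := L2fun_vmeasurable lg.
apply/integrableP; split; first by apply/measurable_EFinP; exact: measurable_dot.
apply: (@le_lt_trans _ _ ((L2norm f * L2norm g)%:E)); last exact: ltry.
apply: cauchy_schwarz_dot => //; try exact: L2norm_ge0.
- by rewrite L2norm_energy.
- by rewrite L2norm_energy.
Qed.

Lemma ipC f g : ip f g = ip g f.
Proof. by apply: eq_Rintegral => t _; exact: dotC. Qed.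

Lemma ip_self f : f \in @L2fun R n -> ip f f = L2norm f ^+ 2.
Proof.
move=> lf; apply/EFin_inj; rewrite L2norm_energy// /ip.
under eq_Rintegral do rewrite dotaa.
rewrite fineK// ge0_fin_numE; last exact: energy_ge0.
by have /L2funP[] := lf.
Qed.

Lemma ip_linear f g h k : f \in @L2fun R n -> g \in @L2fun R n ->
  h \in @L2fun R n -> ip f (k *: g + h) = k * ip f g + ip f h.
Proof.
move=> lf lg lh; rewrite /ip -RintegralZl//; last exact: integrable_dot.
rewrite -RintegralD//; last exact: integrable_dot.
  by apply: eq_Rintegral => t _; rewrite dotDr dotZr.
have := integrableZl measurableT k (integrable_dot lf lg).
by apply: eq_integrable.
Qed.

Lemma ip_ae f g g' : f \in @L2fun R n -> g \in @L2fun R n ->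
  g' \in @L2fun R n -> g = g' %[ae mu] -> ip f g = ip f g'.
Proof.
move=> lf lg lg' gg'; congr fine.
have F : Filter (nbhs (almost_everywhere mu)) := ae_filter_ringOfSetsType mu.
apply: ae_eq_integral => //.
- by have /integrableP[] := integrable_dot lf lg.
- by have /integrableP[] := integrable_dot lf lg'.
- by move: gg'; apply: filterS => t /[apply] ->.
Qed.

(** Splitting the line into a bounded part and a tail is how a product of a
    locally small and a globally small function is shown to be small. *)
Lemma ip_le_split D f g (a b c d : R) : measurable D ->
  f \in @L2fun R n -> g \in @L2fun R n ->
  0 <= a -> 0 <= b -> 0 <= c -> 0 <= d ->
  (energy D f <= (a ^+ 2)%:E)%E -> (energy D g <= (b ^+ 2)%:E)%E ->
  (energy (~` D) f <= (c ^+ 2)%:E)%E -> (energy (~` D) g <= (d ^+ 2)%:E)%E ->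
  `|ip f g| <= a * b + c * d.
Proof.
move=> mD lf lg a0 b0 c0 d0 fa gb fc gd.
have mf := L2fun_vmeasurable lf; have mg := L2fun_vmeasurable lg.
have mfg : measurable_fun setT (fun t => `|dot (f t) (g t)|).
  by apply: measurableT_comp => //; exact: measurable_dot.
rewrite -lee_fin EFin_normr_Rintegral//; last exact: integrable_dot.
apply: le_trans (le_abse_integral _ _ _) _ => //.
  by apply/measurable_EFinP; exact: measurable_dot.
rewrite EFinD -(setvU D) setUC ge0_integral_setU//.
- by apply: leeD; apply: cauchy_schwarz_dot => //; exact: measurableC.
- exact: measurableC.
- by apply/measurable_EFinP; exact: measurable_funTS.
- by apply/disj_set2P; rewrite setICr.
Qed.

Lemma ip_le f g : f \in @L2fun R n -> g \in @L2fun R n ->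
  `|ip f g| <= L2norm f * L2norm g.
Proof.
move=> lf lg; rewrite -[leRHS]addr0 -[X in _ + X](mulr0 0).
apply: (@ip_le_split setT) => //; try exact: L2norm_ge0;
  rewrite ?L2norm_energy// setCT /energy integral_set0 expr0n//.
Qed.

End inner_product.

Section completeness.
Variables (R : realType) (n : nat).
Local Notation V := 'cV[R]_n.
Local Notation mu := (@lebesgue_measure R).
Implicit Types (f g h : R -> V) (D : set R).

Lemma cvg_sq (f_ : nat -> V) (f : V) :
  (forall i, f_ k i 0 @[k --> \oo] --> f i 0) ->
  sq (f_ k) @[k --> \oo] --> sq f.
Proof.
move=> ff; apply: (@cvg_big R 'I_n +%R 0 xpredT _ nat \oo _
  (fun i k => f_ k i 0 ^+ 2) (fun i => f i 0 ^+ 2)).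
  by move=> [a b]; exact: add_continuous.
move=> i _; under eq_fun do rewrite expr2.
by rewrite expr2; apply: cvgM; exact: ff.
Qed.

(** Fatou: a bound on the energies survives pointwise convergence. *)
Lemma energy_fatou D (f_ : nat -> R -> V) f (c : R) : measurable D ->
  (forall k, vmeasurable (f_ k)) ->
  (forall t i, D t -> f_ k t i 0 @[k --> \oo] --> f t i 0) ->
  (forall k, (energy D (f_ k) <= c%:E)%E) -> (energy D f <= c%:E)%E.
Proof.
move=> mD mf ff fc.
have : (energy D f <= limn_einf (fun k => energy D (f_ k)))%E.
  have := @fatou _ _ R mu D mD (fun k t => (sq (f_ k t))%:E).
  move=> /(_ (fun k => measurable_sqE (mf k))) /(_ _)/wrap[].
    by move=> k t _; rewrite lee_fin sq_ge0.
  apply: le_trans; rewrite le_eqVlt; apply/orP; left; apply/eqP.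
  apply: eq_integral => t; rewrite inE => Dt.
  have : (sq (f_ k t))%:E @[k --> \oo] --> (sq (f t))%:E.
    by apply: cvg_EFin; [near=> k|apply: cvg_sq => i; exact: ff].
  by move=> /cvg_limn_einf_sup[->].
move=> /le_trans; apply; rewrite limn_einf_lim.
apply: lime_le; first exact: is_cvg_einfs.
near=> k; apply: le_trans (fc k); apply: ereal_inf_lbound; exists k => //=.
Unshelve. all: by end_near. Qed.

Lemma L2B_ae (u v : L2 R n) : ((u - v : L2 R n) : R -> V) = u \- v %[ae mu].
Proof.
have F : Filter (nbhs (almost_everywhere mu)) := ae_filter_ringOfSetsType mu.
have := L2Z_ae (-1) v; have := L2D_ae u (- v).
rewrite -scaleN1r; apply: filterS2 => t D Z It.
by rewrite D//= Z//= scaleN1r.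
Qed.

Lemma L2funB f g : f \in @L2fun R n -> g \in @L2fun R n -> f \- g \in @L2fun R n.
Proof. exact: rpredB. Qed.

Lemma L2normB (u v : L2 R n) : L2norm (u \- v) = `|u - v|.
Proof.
rewrite normL2E; apply/esym/eq_L2norm; [exact: L2_mem| |exact: L2B_ae].
by apply: L2funB; exact: L2_mem.
Qed.

(** A sequence whose steps decay geometrically converges, coordinate by
    coordinate. *)
Lemma cvg_geometric_steps (u : R ^nat) (M : R) :
  (forall k, `|u k.+1 - u k| <= M / 2 ^+ k) -> cvgn u.
Proof.
move=> uM; have M0 : 0 <= M.
  by have := le_trans (normr_ge0 _) (uM 0%N); rewrite expr0 divr1.
have : cvgn (series (telescope u)).
  apply: normed_cvg; apply: (@series_le_cvg _ _ (geometric M 2^-1)).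
  - by move=> k; exact: normr_ge0.
  - by move=> k; rewrite /geometric /= mulr_ge0// exprn_ge0.
  - by move=> k; rewrite /geometric /= exprVn; exact: uM.
  - by apply: is_cvg_geometric_series; rewrite ger0_norm// invf_lt1// ltr1n.
move=> ct; have -> : u = (fun k => u 0%N + series (telescope u) k).
  by apply/funext => k; exact: eq_sum_telescope.
by apply: is_cvgD => //; exact: is_cvg_cst.
Qed.

(** Riesz-Fischer along a rapidly Cauchy sequence: the weighted sum of the
    squared steps is integrable, hence finite almost everywhere, and where it is
    finite the steps decay geometrically. *)
Lemma L2_rapid_cvg (u : nat -> L2 R n) :
  (forall k, `|u k.+1 - u k| <= (4 ^+ k)^-1 / 2) ->
  exists f : R -> V, vmeasurable f /\
    {ae mu, forall t, forall i, u k t i 0 @[k --> \oo] --> f t i 0}.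
Proof.
move=> uu.
pose w k t := u k.+1 t - u k t.
have mu_ k : vmeasurable (u k) := L2_vmeasurable (u k).
have mw k : vmeasurable (w k) by exact: vmeasurableB.
have lw k : w k \in @L2fun R n.
  by have := rpredB (L2_mem (u k.+1)) (L2_mem (u k)).
have Ew k : (energy setT (w k) <= (((4 ^+ k)^-1 / 2) ^+ 2)%:E)%E.
  have c0 : 0 <= (4 ^+ k)^-1 / 2 :> R by rewrite divr_ge0// invr_ge0 exprn_ge0.
  rewrite -L2norm_le//.
  by rewrite [L2norm _]L2normB; exact: uu.
pose G (t : R) := (\sum_(k <oo) (4 ^+ k * sq (w k t))%:E)%E.
have mG_ k : measurable_fun setT (fun t => (4 ^+ k * sq (w k t))%:E).
  apply/measurable_EFinP; apply: measurable_funM => //; exact: measurable_sq.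
have G_0 k t : (0 <= (4 ^+ k * sq (w k t))%:E)%E.
  by rewrite lee_fin mulr_ge0// ?exprn_ge0// sq_ge0.
have mG : measurable_fun setT G by exact: ge0_emeasurable_sum.
have G0 t : (0 <= G t)%E by exact: nneseries_ge0.
have iG : mu.-integrable setT G.
  apply/integrableP; split=> //.
  under eq_integral do rewrite gee0_abs//.
  rewrite integral_nneseries//.
  apply: (@le_lt_trans _ _ (\sum_(k <oo) (1 / (2 ^ k.+1)%:R)%:E)%E); last first.
    by apply: le_lt_trans (epsilon_trick0 xpredT ler01) _; exact: ltry.
  apply: lee_nneseries => [k _ _|k _].
    by apply: integral_ge0 => t _.
  under eq_integral do rewrite EFinM.
  rewrite ge0_integralZl_EFin//; last 2 first.
  - by move=> t _; rewrite lee_fin sq_ge0.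
  - exact: measurable_sqE.
  apply: (@le_trans _ _ ((4 ^+ k)%:E * (((4 ^+ k)^-1 / 2) ^+ 2)%:E)%E).
    by apply: lee_wpmul2l; rewrite ?lee_fin ?exprn_ge0//; exact: Ew.
  rewrite -EFinM lee_fin natrX (exprS 2 k).
  have e0 : 0 < (2 : R) ^+ k by rewrite exprn_gt0.
  have -> : (4 : R) ^+ k = 2 ^+ k * 2 ^+ k by rewrite -exprMn; congr (_ ^+ _); ring.
  have e1 : 1 <= (2 : R) ^+ k by rewrite exprn_ege1// ler1n.
  set e := 2 ^+ k in e0 e1 *.
  have -> : e * e * ((e * e)^-1 / 2) ^+ 2 = (e * e * 4)^-1.
    by field; rewrite gt_eqF.
  have ee : e <= e * e by rewrite ler_peMl// ltW.
  by rewrite div1r lef_pV2 ?posrE; lra.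
have /= aeG := integrable_ae measurableT iG.
pose E := [set t | G t \is a fin_num].
have mE : measurable E.
  rewrite (_ : E = setT `&` [set t | G t \is a fin_num]); last by rewrite setTI.
  exact: emeasurable_fin_num.
have cE t i : E t -> cvgn (fun k => u k t i 0).
  move=> Et; have Gf : G t = (fine (G t))%:E by rewrite fineK.
  have G0' : 0 <= fine (G t) by rewrite fine_ge0.
  apply: (@cvg_geometric_steps _ (Num.sqrt (fine (G t)))) => k.
  have wk : 4 ^+ k * sq (w k t) <= fine (G t).
    rewrite -lee_fin -Gf.
    apply: (@le_trans _ _ (\sum_(0 <= j < k.+1) (4 ^+ j * sq (w j t))%:E)%E).
      by rewrite big_nat_recr//= leeDr// sume_ge0.
    by apply: nneseries_lim_ge.
  rewrite /=; have -> : u k.+1 t i 0 - u k t i 0 = w k t i 0 by rewrite /w !mxE.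
  rewrite ler_pdivlMr ?exprn_gt0// -(@ler_pXn2r _ 2)// ?nnegrE ?sqrtr_ge0 ?mulr_ge0 ?exprn_ge0//.
  rewrite sqr_sqrtr// exprMn real_normK ?num_real// mulrC -exprM mulnC exprM.
  apply: le_trans wk; have -> : 2 ^+ 2 = 4 :> R by ring.
  by rewrite ler_wpM2l ?exprn_ge0// le_coord_sq.
pose f t : V := \col_i lim ((\1_E t * u k t i 0) @[k --> \oo]).
have cf t i : (\1_E t * u k t i 0) @[k --> \oo] --> f t i 0.
  rewrite mxE; have [Et|Et] := pselect (E t).
    rewrite indicE mem_set//; under eq_fun do rewrite mul1r.
    exact: cE.
  rewrite indicE memNset//; under eq_fun do rewrite mul0r.
  exact: is_cvg_cst.
exists f; split.
  move=> i; apply: (measurable_fun_cvg (h := fun k t => \1_E t * u k t i 0)).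
    by move=> k; apply: measurable_funM; [exact: measurable_indic|exact: mu_].
  by move=> t _; exact: cf.
have F : Filter (nbhs (almost_everywhere mu)) := ae_filter_ringOfSetsType mu.
apply: filterS aeG => t Et i; have {}Et : E t by exact: Et.
by have := cf t i; rewrite indicE mem_set//; under eq_fun do rewrite mul1r.
Qed.

(** A Cauchy filter contains a ball of radius 4^-k / 4 around some u k for each k;
    these u k converge almost everywhere, and Fatou turns the distances between
    them into distances to the limit. *)
Lemma L2_complete (F : set_system (L2 R n)) :
  ProperFilter F -> cauchy F -> cvg F.
Proof.
move=> FF cF.
pose e k : R := (4 ^+ k)^-1 / 4.
have e0 k : 0 < e k by rewrite divr_gt0// invr_gt0 exprn_gt0.
have Fe k : exists v : L2 R n, F (ball v (e k)).
  by have /cauchyP/(_ (e k) (e0 k))[v Fv] := cF; exists v.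
have [u Fu] := choice Fe.
have uB k m : `|u k - u m| < e k + e m.
  have [v [/= vk vm]] := filter_ex (filterI (Fu k) (Fu m)).
  rewrite -(subrK v (u k)) -addrA. apply: le_lt_trans (ler_normD _ _) _.
  move: vk vm; rewrite -!ball_normE /ball_/= => vk vm.
  by apply: ltrD; [exact: vk|rewrite distrC].
have ele k m : (k <= m)%N -> e m <= e k.
  move=> km; rewrite /e ler_wpM2r// lef_pV2 ?posrE ?exprn_gt0//.
  by rewrite ler_weXn2l// ler1n.
have [f [mf uf]] : exists f : R -> V, vmeasurable f /\
    {ae mu, forall t, forall i, u k t i 0 @[k --> \oo] --> f t i 0}.
  apply: L2_rapid_cvg => k; apply: le_trans (ltW (uB _ _)) _.
  have := ele _ _ (leqnSn k); rewrite /e; lra.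
have mu_ k : vmeasurable (u k) := L2_vmeasurable (u k).
have Ef k : (energy setT (f \- u k)%R <= ((2 * e k) ^+ 2)%:E)%E.
  case: uf => N [mN N0 sN].
  have mfu : vmeasurable (f \- u k) by exact: vmeasurableB.
  rewrite /energy (ge0_negligible_integral mN)//; last 2 first.
  - exact: measurable_sqE.
  - by move=> t _; rewrite lee_fin sq_ge0.
  apply: (@energy_fatou _ (fun m => u (m + k)%N \- u k)).
  - exact: measurableD.
  - by move=> m; exact: vmeasurableB.
  - move=> t i [_ Nt]; rewrite !mxE; under eq_fun do rewrite !mxE.
    have ut : u m t i 0 @[m --> \oo] --> f t i 0.
      by have := contra_not (sN t) Nt; move=> /contrapT; exact.
    by apply: cvgB; [rewrite (cvg_shiftn k (fun m => u m t i 0)); exact: ut|exact: cvg_cst].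
  - move=> m; apply: le_trans (energyS _ _ _ (@subsetT _ _)) _ => //.
    + exact: measurableD.
    + exact: vmeasurableB.
    rewrite -L2norm_le; [|by rewrite mulr_ge0// ltW|by apply: L2funB; exact: L2_mem].
    rewrite L2normB; apply: le_trans (ltW (uB _ _)) _.
    by have := ele _ _ (leq_addl m k); lra.
have lf : f \in @L2fun R n.
  have l0 : f \- u 0%N \in @L2fun R n.
    apply/L2funP; split; first exact: vmeasurableB.
    by apply: le_lt_trans (Ef 0%N) _; exact: ltry.
  rewrite (_ : f = (f \- u 0%N) + u 0%N); last first.
    by apply/funext => t; rewrite fctE/= subrK.
  by apply: rpredD => //; exact: L2_mem.
have Uu k : `|L2class f - u k| <= 2 * e k.
  rewrite -L2normB (@eq_L2norm _ _ _ (f \- u k)).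
  - by rewrite L2norm_le//; [rewrite mulr_ge0// ltW|apply: L2funB => //; exact: L2_mem].
  - by apply: L2funB; exact: L2_mem.
  - by apply: L2funB => //; exact: L2_mem.
  have F' : Filter (nbhs (almost_everywhere mu)) := ae_filter_ringOfSetsType mu.
  by have := L2classE lf; apply: filterS => t /[apply] /= ->.
apply: (cvgP (L2class f)); apply/cvg_ballP => d d0.
have [k kd] : exists k, 3 * e k < d.
  have : (1 / 4) ^+ k @[k --> \oo] --> (0 : R).
    by apply: cvg_expr; rewrite ger0_norm//; lra.
  move=> /cvgrPdist_lt/(_ _ d0)[k _ /(_ k (leqnn k))] /=.
  rewrite sub0r normrN ger0_norm ?exprn_ge0// expr_div_n expr1n div1r => kd.
  exists k; rewrite /e; set q := _ ^-1 in kd *.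
  have : 0 < q by rewrite invr_gt0 exprn_gt0.
  lra.
apply: filterS (Fu k) => v; rewrite -!ball_normE /ball_/= => uv.
rewrite -(subrK (u k) (L2class f)) -addrA; apply: le_lt_trans (ler_normD _ _) _.
have := Uu k; lra.
Qed.

End completeness.

HB.instance Definition _ (R : realType) (n : nat) :=
  Uniform_isComplete.Build (L2 R n) (@L2_complete R n).

(** * Smooth steps and approximate identities *)

Section smoothstep.
Variable R : realType.
Local Notation mu := (@lebesgue_measure R).
Implicit Types (t s e : R).

(** A first-order expansion with quadratic remainder determines the derivative; it
    applies to the square of the ramp at every point, the kink included. *)
Lemma is_derive_quadratic (f : R -> R) t (d C : R) :
  (forall h, `|f (t + h) - f t - d * h| <= C * h ^+ 2) -> is_derive t 1 f d.
Proof.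
move=> fC; have C0 : 0 <= C.
  by have := le_trans (normr_ge0 _) (fC 1); rewrite expr1n mulr1.
have H : h^-1 *: (f (h *: (1 : R) + t) - f t) @[h --> 0^'] --> d.
  apply/cvgrPdist_le => e e0; near=> h.
  have h0 : h != 0 by near: h; exact: nbhs_dnbhs_neq.
  have he : `|h| <= e / (C + 1).
    by near: h; apply: dnbhs0_le; rewrite divr_gt0//; lra.
  rewrite distrC /GRing.scale/= mulr1 (addrC h).
  have -> : h^-1 * (f (t + h) - f t) - d = h^-1 * (f (t + h) - f t - d * h).
    by field.
  rewrite normrM normfV ler_pdivrMl ?normr_gt0//.
  apply: le_trans (fC h) _; rewrite -real_normK ?num_real// expr2.
  rewrite [leRHS]mulrC mulrA ler_wpM2r//.
  by move: he; rewrite ler_pdivlMr; [have := normr_ge0 h; nra|lra].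
split; first by apply/cvg_ex; exists d.
by apply: cvg_lim.
Unshelve. all: by end_near. Qed.

Definition ramp t : R := Num.max t 0.

Lemma is_derive_ramp2 t : is_derive t 1 (fun r => ramp r ^+ 2) (2 * ramp t).
Proof.
apply: (@is_derive_quadratic _ _ _ 1) => h; rewrite /ramp mul1r.
by case: (leP t 0) => ?; case: (leP (t + h) 0) => ?; rewrite ler_norml; nra.
Qed.

(** The quadratic spline that rises from 0 to 1 on the unit interval, and the
    tent which is its derivative. *)
Definition smoothstep t : R :=
  2 * ramp t ^+ 2 - 4 * ramp (t - 2^-1) ^+ 2 + 2 * ramp (t - 1) ^+ 2.

Definition tent t : R := 4 * ramp t - 8 * ramp (t - 2^-1) + 4 * ramp (t - 1).

Lemma is_derive_comp_affine (f f' : R -> R) (c b t : R) :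
  (forall r : R, is_derive r 1 f (f' r)) ->
  is_derive t 1 (fun r => f (c * r + b)) (c * f' (c * t + b)).
Proof.
move=> df.
have dg : is_derive t 1 (fun r => c * r + b) c.
  have -> : (fun r => c * r + b) = c \*: (@id R) + cst b by apply/funext.
  by apply: is_derive_eq; rewrite addr0 /GRing.scale /= mulr1.
by have := @is_derive1_comp R f _ t _ _ (df _) dg; rewrite mulrC.
Qed.

Lemma is_derive_smoothstep t : is_derive t 1 smoothstep (tent t).
Proof.
have D b : is_derive t 1 (fun r => ramp (r - b) ^+ 2) (2 * ramp (t - b)).
  have := is_derive_comp_affine 1 (- b) t is_derive_ramp2; rewrite !mul1r.
  by under eq_fun do rewrite mul1r.
have := D 0; rewrite subr0; under eq_fun do rewrite subr0; move=> D0.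
have -> : smoothstep = 2 \*: (fun r => ramp r ^+ 2)
  - 4 \*: (fun r => ramp (r - 2^-1) ^+ 2) + 2 \*: (fun r => ramp (r - 1) ^+ 2).
  by apply/funext.
apply: is_derive_eq; rewrite /tent /GRing.scale/=; ring.
Qed.

Lemma continuous_ramp b : continuous (fun t => ramp (t - b)).
Proof.
move=> t; apply: (@continuous_max R R (fun t => t - b) (cst 0) t); last exact: cst_continuous.
by apply: cvgB; [exact: cvg_id|exact: cvg_cst].
Qed.

Lemma continuous_tent : continuous tent.
Proof.
move=> t; have := @continuous_ramp 0; under eq_fun do rewrite subr0; move=> c0.
apply: cvgD; first apply: cvgB.
- by apply: cvgMr; exact: c0.
- by apply: cvgMr; exact: continuous_ramp.
- by apply: cvgMr; exact: continuous_ramp.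
Qed.

Lemma smoothstep_le0 t : t <= 0 -> smoothstep t = 0.
Proof.
move=> t0; rewrite /smoothstep /ramp !max_r; [by rewrite expr0n/=; ring|lra..].
Qed.

Lemma smoothstep_ge1 t : 1 <= t -> smoothstep t = 1.
Proof.
move=> t0; rewrite /smoothstep /ramp !max_l; [by field|lra..].
Qed.

Lemma smoothstep01 t : 0 <= smoothstep t <= 1.
Proof.
rewrite /smoothstep /ramp.
by case: (leP t 0) => ?; case: (leP (t - 2^-1) 0) => ?; case: (leP (t - 1) 0) => ?;
  apply/andP; split; nra.
Qed.

Lemma tent_ge0 t : 0 <= tent t.
Proof.
rewrite /tent /ramp.
by case: (leP t 0) => ?; case: (leP (t - 2^-1) 0) => ?; case: (leP (t - 1) 0) => ?;
  lra.
Qed.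

Lemma tent_le0 t : t <= 0 -> tent t = 0.
Proof.
move=> t0; rewrite /tent /ramp !max_r; [by ring|lra..].
Qed.

Lemma tent_ge1 t : 1 <= t -> tent t = 0.
Proof.
move=> t0; rewrite /tent /ramp !max_l; [by field|lra..].
Qed.

(** A nonnegative kernel of mass one carried by [s, s + e]: an approximate
    identity as e tends to 0. *)
Definition kern s e t : R := e^-1 * tent ((t - s) / e).
Definition step s e t : R := smoothstep ((t - s) / e).

Lemma is_derive_step s e t : is_derive t 1 (step s e) (kern s e t).
Proof.
have := is_derive_comp_affine e^-1 (- (s / e)) t is_derive_smoothstep.
have E r : e^-1 * r - s / e = (r - s) / e by rewrite mulrBl mulrC.
by rewrite E /step /kern; under eq_fun do rewrite E.
Qed.

Lemma continuous_kern s e : continuous (kern s e).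
Proof.
move=> t; apply: cvgMr.
apply: (@continuous_comp _ _ _ (fun t => (t - s) / e) tent t); last exact: continuous_tent.
by apply: cvgMl; apply: cvgB; [exact: cvg_id|exact: cvg_cst].
Qed.

Lemma kern_ge0 s e t : 0 < e -> 0 <= kern s e t.
Proof. by move=> e0; rewrite mulr_ge0 ?tent_ge0// invr_ge0 ltW. Qed.

Lemma kern_out s e t : 0 < e -> ~ (s <= t <= s + e) -> kern s e t = 0.
Proof.
move=> e0 /negP; rewrite negb_and -!ltNge /kern => /orP[h|h].
  by rewrite tent_le0 ?mulr0// pmulr_lle0 ?invr_gt0// subr_le0 ltW.
by rewrite tent_ge1 ?mulr0// ler_pdivlMr// mul1r lerBrDl ltW.
Qed.

Lemma step_le s e t : 0 < e -> t <= s -> step s e t = 0.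
Proof.
by move=> e0 h; rewrite /step smoothstep_le0// pmulr_lle0 ?invr_gt0// subr_le0.
Qed.

Lemma step_ge s e t : 0 < e -> s + e <= t -> step s e t = 1.
Proof.
by move=> e0 h; rewrite /step smoothstep_ge1// ler_pdivlMr// mul1r lerBrDl.
Qed.

Lemma continuous_is_derive (f f' : R -> R) :
  (forall t : R, is_derive t 1 f (f' t)) -> continuous f.
Proof.
move=> df t; apply: differentiable_continuous.
by apply/derivable1_diffP; have [] := df t.
Qed.

Lemma integral_kern s e : 0 < e ->
  \int[mu]_(t in `[s, s + e]) kern s e t = 1.
Proof.
move=> e0; rewrite /Rintegral.
rewrite (@continuous_FTC2 _ (kern s e) (step s e) s (s + e)).
- by rewrite -EFinB/= step_ge// step_le// subr0.
- by rewrite ltrDl.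
- by apply: continuous_subspaceT; exact: continuous_kern.
- have cs := continuous_is_derive (is_derive_step s e).
  split.
  + by move=> t _; have [] := is_derive_step s e t.
  + by apply: cvg_at_right_filter; exact: cs.
  + by apply: cvg_at_left_filter; exact: cs.
- by move=> t _; rewrite derive1E; have [_ ->] := is_derive_step s e t.
Qed.

Lemma integrable_continuous_itv (f : R -> R) (a b : R) : continuous f ->
  mu.-integrable `[a, b] (EFin \o f).
Proof.
move=> cf; apply: continuous_compact_integrable; first exact: segment_compact.
exact: continuous_subspaceT.
Qed.

Lemma integral_mul_kern (x : R -> R) s e (eta : R) : 0 < e -> continuous x ->
  (forall t, s <= t <= s + e -> `|x t - x s| <= eta) ->
  `|\int[mu]_t (x t * kern s e t) - x s| <= eta.
Proof.
move=> e0 cx xs; have ck := @continuous_kern s e.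
have cxk : continuous (fun t => x t * kern s e t).
  by move=> t; apply: cvgM; [exact: cx|exact: ck].
have -> : \int[mu]_t (x t * kern s e t) =
    \int[mu]_(t in `[s, s + e]) (x t * kern s e t).
  rewrite [RHS]Rintegral_mkcond; apply: eq_Rintegral => t _.
  rewrite patchE; case: ifPn => // /negP; rewrite inE/= in_itv/= => tse.
  by rewrite kern_out ?mulr0.
have -> : x s = \int[mu]_(t in `[s, s + e]) (x s * kern s e t).
  by rewrite RintegralZl ?integral_kern ?mulr1//; exact: integrable_continuous_itv.
have ik c : mu.-integrable `[s, s + e] (EFin \o (fun t => c * kern s e t)).
  by apply: integrable_continuous_itv => t; apply: cvgMr; exact: ck.
rewrite -RintegralB//; last exact: integrable_continuous_itv.
have -> : eta = \int[mu]_(t in `[s, s + e]) (eta * kern s e t).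
  by rewrite RintegralZl ?integral_kern ?mulr1//; exact: integrable_continuous_itv.
have id : mu.-integrable `[s, s + e]
    (EFin \o (fun t => x t * kern s e t - x s * kern s e t)).
  apply: integrable_continuous_itv => t; apply: cvgB; first exact: cxk.
  by apply: cvgMr; exact: ck.
apply: le_trans (le_normr_Rintegral _ _) _ => //.
apply: le_Rintegral => //; first exact: integrable_norm.
move=> t /=; rewrite in_itv/= => tse; rewrite -mulrBl normrM.
by rewrite (ger0_norm (kern_ge0 _ _ e0)) ler_wpM2r ?kern_ge0// xs.
Qed.

Lemma test_function_steps s t e : 0 < e ->
  test_function (fun r => step s e r - step t e r).
Proof.
move=> e0; have D (r : R) : is_derive r 1 (fun r => step s e r - step t e r)
    (kern s e r - kern t e r).
  have -> : (fun r => step s e r - step t e r) = step s e - step t e by [].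
  by apply: is_deriveB; exact: is_derive_step.
split.
- by move=> r; have [] := D r.
- have -> : derive1 (fun r => step s e r - step t e r) =
      (fun r => kern s e r - kern t e r).
    by apply/funext => r; rewrite derive1E; have [_ ->] := D r.
  by move=> r; apply: cvgB; exact: continuous_kern.
- exists (`|s| + `|t| + e) => r.
  have := ler_norm s; have := ler_norm (- s); rewrite normrN => ? ?.
  have := ler_norm t; have := ler_norm (- t); rewrite normrN => ? ?.
  have [r0|r0] := ltP 0 r.
    by rewrite (gtr0_norm r0) => h; rewrite !step_ge ?subrr//; lra.
  by rewrite (ler0_norm r0) => h; rewrite !step_le ?subrr//; lra.
Qed.

End smoothstep.

(** * Increments and weak derivatives *)

Section weak_ftc.
Variables (R : realType) (n : nat).
Local Notation V := 'cV[R]_n.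
Local Notation mu := (@lebesgue_measure R).
Local Notation coord := Defs.coord.
Implicit Types (x v : R -> V) (s t : R).

Lemma L2fun_coord v i : v \in @L2fun R n -> (fun t => v t i 0) \in Lfun mu 2%:E.
Proof. by move=> /forallP/(_ i). Qed.

Lemma kern_Lfun2 s (e : R) : 0 < e -> kern s e \in Lfun mu 2%:E.
Proof.
move=> e0; apply: (@Lfun2_compact_support _ _ (`|s| + e)).
  exact: continuous_kern.
move=> t h; apply: kern_out => // /andP[st ts]; move: h.
have := ler_norm s; have := ler_norm (- s); rewrite normrN => ? ? ?.
suff : `|t| <= `|s| + e by lra.
by rewrite ler_norml; apply/andP; split; lra.
Qed.

Lemma near_continuous_right (f : R -> R) s (eta : R) : continuous f -> 0 < eta ->
  \forall e \near 0^'+, forall t, s <= t <= s + e -> `|f t - f s| <= eta.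
Proof.
move=> cf eta0; have /cvgrPdist_le/(_ _ eta0) := cf s.
move=> /nbhs_ballP[d /= d0 dP]; near=> e => t /andP[st te].
rewrite distrC; apply: dP; rewrite /ball/= ler0_norm ?subr_le0//.
have : e < d by near: e; exact: nbhs_right_lt.
lra.
Unshelve. all: by end_near. Qed.

(** The test function differs from the indicator of [s, t] only where one of its
    two flanks is. *)
Lemma step_indic s t (e r : R) : 0 < e -> s <= t ->
  `|step s e r - step t e r - \1_(`[s, t]) r| <=
  \1_(`[s, s + e]) r + \1_(`[t, t + e]) r.
Proof.
move=> e0 st; rewrite !indicE !mem_setE !in_itv/=.
have /andP[s0 s1] : 0 <= step s e r <= 1 := smoothstep01 _.
have /andP[t0 t1] : 0 <= step t e r <= 1 := smoothstep01 _.
have H1 : r <= s -> step s e r = 0 by exact: step_le.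
have H2 : s + e <= r -> step s e r = 1 by exact: step_ge.
have H3 : r <= t -> step t e r = 0 by exact: step_le.
have H4 : t + e <= r -> step t e r = 1 by exact: step_ge.
case: (leP s r) => h1; case: (leP r t) => h2; case: (leP r (s + e)) => h3;
  case: (leP t r) => h4; case: (leP r (t + e)) => h5 /=; rewrite ler_norml;
  apply/andP; split; lra.
Qed.

(** The test function rises from 0 to 1 just after s and falls back just after t:
    its derivative is a difference of two approximate identities, so that the
    definition of the weak derivative tends to the formula for the increment. *)
Lemma weak_ftc x v i s t : continuous x -> x \in @L2fun R n ->
  v \in @L2fun R n -> weak_derivative x v -> s <= t ->
  x t i 0 - x s i 0 = \int[mu]_(r in `[s, t]) v r i 0.
Proof.
move=> cx lx lv xv st.
pose xi r := x r i 0; pose vi r := v r i 0.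
have cxi : continuous xi.
  by move=> r; exact: (continuous_comp (cx r) (@coord_continuous _ _ _ i 0 _)).
have lxi : xi \in Lfun mu 2%:E by exact: L2fun_coord.
have lvi : vi \in Lfun mu 2%:E by exact: L2fun_coord.
have ivi a b : mu.-integrable `[a, b] (EFin \o vi) by exact: integrable_L2_interval.
apply/eqP; rewrite -subr_eq0 -normr_le0; apply/ler_addgt0Pl => eta eta0.
rewrite addr0.
have e3 : 0 < eta / 3 by lra.
have c0 : 0 < 2 * L2norm v + 1 by have := L2norm_ge0 v; lra.
near (0 : R)^'+ => e.
have e0 : 0 < e by near: e; exact: nbhs_right_gt.
have xs : forall r, s <= r <= s + e -> `|xi r - xi s| <= eta / 3.
  by near: e; exact: near_continuous_right.
have xt : forall r, t <= r <= t + e -> `|xi r - xi t| <= eta / 3.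
  by near: e; exact: near_continuous_right.
have ve : 2 * L2norm v * Num.sqrt e <= eta / 3.
  have : e <= (eta / 3 / (2 * L2norm v + 1)) ^+ 2.
    by near: e; apply: nbhs_right_le; apply: exprn_gt0; apply: divr_gt0.
  move=> /ler_wsqrtr; rewrite sqrtr_sqr ger0_norm; last first.
    by apply: divr_ge0; apply: ltW.
  rewrite ler_pdivlMr//; have := sqrtr_ge0 e; nra.
have tphi := test_function_steps s t e0.
have [lphi _] := test_function_L2 tphi.
have := xv i _ tphi.
have -> : derive1 (fun r => step s e r - step t e r) =
    (fun r => kern s e r - kern t e r).
  apply/funext => r; rewrite derive1E.
  have -> : (fun r => step s e r - step t e r) = step s e - step t e by [].
  by have [_ ->] := is_deriveB (is_derive_step s e r) (is_derive_step t e r).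
rewrite -[X in X = _]/(\int[mu]_r (xi r * (kern s e r - kern t e r))).
rewrite -[X in _ = - X]/(\int[mu]_r (vi r * (step s e r - step t e r))).
under eq_Rintegral do rewrite mulrBr.
rewrite RintegralB//; try by apply: integrable_L2_mul => //; exact: kern_Lfun2.
have := integral_mul_kern e0 cxi xs; have := integral_mul_kern e0 cxi xt.
set A := \int[mu]_r (xi r * kern s e r); set B := \int[mu]_r (xi r * kern t e r).
set C := \int[mu]_r _ => hB hA ABC.
suff hC : `|C - \int[mu]_(r in `[s, t]) vi r| <= eta / 3.
  rewrite -/(xi t) -/(xi s).
  set I := \int[mu]_(r in _) vi r in hC *.
  move: hA hB hC; rewrite !ler_norml => /andP[? ?] /andP[? ?] /andP[? ?].
  by apply/andP; split; lra.
apply: le_trans ve.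
have ivphi : mu.-integrable setT (EFin \o (fun r => vi r * (step s e r - step t e r))).
  exact: integrable_L2_mul.
have ivD a b : mu.-integrable setT (EFin \o (vi \_ `[a, b])).
  rewrite -restrict_EFin; apply: (integrable_mkcond _ _).1; last exact: ivi.
  exact: measurable_itv.
have ivDn a b : mu.-integrable setT (EFin \o (fun r => `|(vi \_ `[a, b]) r|)).
  exact: integrable_norm.
rewrite Rintegral_mkcond /C -RintegralB//.
apply: le_trans (le_normr_Rintegral _ _) _ => //.
  by have := integrableB measurableT ivphi (ivD s t); apply: eq_integrable.
apply: (@le_trans _ _ (\int[mu]_r (`|(vi \_ `[s, (s + e)]) r| + `|(vi \_ `[t, (t + e)]) r|))).
  apply: le_Rintegral => //.
  - apply: integrable_norm.
    by have := integrableB measurableT ivphi (ivD s t); apply: eq_integrable.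
  - by have := integrableD measurableT (ivDn s (s + e)) (ivDn t (t + e)); apply: eq_integrable.
  - move=> r _.
    have E a b : (vi \_ `[a, b]) r = vi r * \1_(`[a, b]) r.
      by rewrite patchE indicE; case: ifP => _; rewrite ?mulr1 ?mulr0.
    rewrite !E -mulrBr !normrM -mulrDr ler_wpM2l//.
    apply: le_trans (step_indic _ e0 st) _.
    by apply: lerD; rewrite ler_norm.
rewrite RintegralD//.
have vB a : \int[mu]_r `|(vi \_ `[a, (a + e)]) r| <= L2norm v * Num.sqrt e.
  have := @Rintegral_interval_le R n v a (a + e) (L2norm v) i lv.
  rewrite lerDl (ltW e0) L2norm_ge0 => /(_ isT isT).
  rewrite energy_le_L2norm// => /(_ isT).
  have -> : a + e - a = e by ring.
  apply: le_trans; rewrite [leRHS]Rintegral_mkcond le_eqVlt; apply/orP; left.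
  by apply/eqP; apply: eq_Rintegral => r _; rewrite !patchE; case: ifP; rewrite ?normr0.
have := vB s; have := vB t; lra.
Unshelve. all: by end_near. Qed.

End weak_ftc.

(** * Bounds, decay and integration by parts in H^1 *)

Section primitives.
Variables (R : realType) (n : nat).
Local Notation V := 'cV[R]_n.
Local Notation mu := (@lebesgue_measure R).
Implicit Types (s t c : R).

Lemma H1_ftc (x : H1 R n) i s t : s <= t ->
  x t i 0 - x s i 0 = \int[mu]_(r in `[s, t]) H1deriv x r i 0.
Proof.
apply: weak_ftc; [exact: H1_continuous|exact: H1_L2|exact: L2_mem|].
exact: H1_weak_derivative.
Qed.

Lemma H1_diff_le (x : H1 R n) s t c : s <= t -> 0 <= c ->
  (energy `[s, t] (H1deriv x) <= (c ^+ 2)%:E)%E ->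
  `|x t - x s| <= c * Num.sqrt (t - s).
Proof.
move=> st c0 xc; apply: norm_le_coord => [|i]; first by rewrite mulr_ge0// sqrtr_ge0.
have lv := L2_mem (H1deriv x).
rewrite !mxE H1_ftc//; apply: le_trans (le_normr_Rintegral _ _) _ => //.
  exact: integrable_L2_interval.
exact: Rintegral_interval_le.
Qed.

Lemma L2norm_le_H1norm (x : H1 R n) : L2norm x <= `|x|.
Proof.
rewrite normH1E /H1norm -[leLHS]ger0_norm ?L2norm_ge0// -sqrtr_sqr ler_wsqrtr//.
by rewrite lerDl sqr_ge0.
Qed.

Lemma H1deriv_le_H1norm (x : H1 R n) : L2norm (H1deriv x) <= `|x|.
Proof.
rewrite -normL2E normH1E /H1norm -[leLHS]ger0_norm// -sqrtr_sqr ler_wsqrtr//.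
by rewrite lerDr sqr_ge0.
Qed.

Lemma H1_hoelder (x : H1 R n) s t : s <= t ->
  `|x t - x s| <= `|x| * Num.sqrt (t - s).
Proof.
move=> st; apply: H1_diff_le => //.
have lv := L2_mem (H1deriv x).
apply: le_trans (energy_le_L2norm _ lv) _ => //.
by rewrite lee_fin lerXn2r ?nnegrE// ?L2norm_ge0// H1deriv_le_H1norm.
Qed.

(** A value at t larger than twice the local norm would, since the function
    varies by at most c over a unit interval, make the local norm exceed c. *)
Lemma H1_point_le (x : H1 R n) t c : 0 <= c ->
  (energy `[t, (t + 1)%R] x <= (c ^+ 2)%:E)%E ->
  (energy `[t, (t + 1)%R] (H1deriv x) <= (c ^+ 2)%:E)%E ->
  `|x t| <= 2 * c.
Proof.
move=> c0 xc vc; rewrite leNgt; apply/negP => xt.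
pose d := `|x t| - c; have cd : c < d by rewrite /d; lra.
have xd r : t <= r <= t + 1 -> d ^+ 2 <= sq (x r).
  move=> /andP[tr rt]; apply: le_trans (norm_sq _).
  rewrite lerXn2r ?nnegrE//; first by lra.
  have : `|x r - x t| <= c * Num.sqrt (r - t).
    apply: H1_diff_le => //; apply: le_trans vc; apply: energyS => //.
      exact: L2_vmeasurable.
    by move=> u /=; rewrite !in_itv/= => /andP[-> h]; exact: le_trans rt.
  have sr1 : Num.sqrt (r - t) <= 1.
    by rewrite -[leRHS]sqrtr1 ler_wsqrtr//; lra.
  have := ler_distD (x r) (x t) 0; rewrite !subr0 distrC /d.
  have : c * Num.sqrt (r - t) <= c by rewrite ler_piMr.
  lra.
have : ((d ^+ 2)%:E <= energy `[t, (t + 1)%R] x)%E.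
  have -> : ((d ^+ 2)%:E = \int[mu]_(r in `[t, (t + 1)%R]) (cst (d ^+ 2)%:E r))%E.
    rewrite integral_cst//= lebesgue_measure_itv/= lte_fin ltrDl ltr01.
    by rewrite -EFinB -EFinM; congr EFin; ring.
  apply: ge0_le_integral => //.
  - by move=> r _; rewrite lee_fin sqr_ge0.
  - by apply: measurable_sqE; apply: L2fun_vmeasurable; exact: H1_L2.
move=> /le_trans/(_ xc); rewrite lee_fin.
by rewrite ler_pXn2r ?nnegrE//; lra.
Qed.

Lemma H1_sup_le (x : H1 R n) t : `|x t| <= 2 * `|x|.
Proof.
apply: H1_point_le => //.
- apply: le_trans (energy_le_L2norm _ (H1_L2 x)) _ => //.
  by rewrite lee_fin lerXn2r ?nnegrE// ?L2norm_ge0// L2norm_le_H1norm.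
- apply: le_trans (energy_le_L2norm _ (L2_mem (H1deriv x))) _ => //.
  by rewrite lee_fin lerXn2r ?nnegrE// ?L2norm_ge0// H1deriv_le_H1norm.
Qed.

(** By H1_point_le the value at t is controlled by the norm over the unit interval
    after t, which is part of a tail. *)
Lemma H1_decay (x : H1 R n) (e : R) : 0 < e ->
  exists2 A : R, 0 <= A & forall t, A < `|t| -> `|x t| <= e.
Proof.
move=> e0; have e2 : 0 < (e / 2) ^+ 2 by apply: exprn_gt0; lra.
have [A A0 xA] := energy_tail (H1_L2 x) e2.
have [B B0 vB] := energy_tail (L2_mem (H1deriv x)) e2.
exists (A + B + 1) => [|t]; first lra.
have -> : e = 2 * (e / 2) by field.
have sub C : 0 <= C -> C <= A + B -> A + B + 1 < `|t| ->
    `[t, t + 1]%classic `<=` ~` `[- C, C].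
  move=> C0 CAB tC r /=; rewrite !in_itv/= => /andP[tr rt] /andP[Cr rC].
  by move: tC; case: (ltP 0 t) => ?; [rewrite gtr0_norm//|rewrite ler0_norm//]; lra.
move=> tAB; apply: H1_point_le; first by lra.
- apply: le_trans xA; apply: energyS => //.
  + exact: measurableC.
  + by apply: L2fun_vmeasurable; exact: H1_L2.
  + by apply: sub => //; lra.
- apply: le_trans vB; apply: energyS => //.
  + exact: measurableC.
  + exact: L2_vmeasurable.
  + by apply: sub => //; lra.
Qed.

End primitives.

Section integration_by_parts.
Variable R : realType.
Local Notation mu := (@lebesgue_measure R).
Implicit Types (f g h : R -> R) (s t m : R).

Lemma integrable_funD D f g : measurable D -> mu.-integrable D (EFin \o f) ->
  mu.-integrable D (EFin \o g) ->
  mu.-integrable D (EFin \o (fun r => f r + g r)).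
Proof. by move=> mD fi gi; have := integrableD mD fi gi; apply: eq_integrable. Qed.

Lemma integrable_funZ D f (k : R) : measurable D -> mu.-integrable D (EFin \o f) ->
  mu.-integrable D (EFin \o (fun r => k * f r)).
Proof. by move=> mD fi; have := integrableZl mD k fi; apply: eq_integrable. Qed.

Lemma Rintegral_itv_cat f s m t : s <= m -> m <= t ->
  mu.-integrable `[s, t] (EFin \o f) ->
  \int[mu]_(r in `[s, t]) f r =
  \int[mu]_(r in `[s, m]) f r + \int[mu]_(r in `[m, t]) f r.
Proof.
move=> sm mt intf.
have := @Rintegral_itvB R f (BLeft s) (BRight t) m intf.
rewrite !bnd_simp => /(_ sm mt) E.
have -> : \int[mu]_(r in `[m, t]) f r = \int[mu]_(r in `]m, t]) f r.
  apply/esym; apply: Rintegral_itv_obnd_cbnd.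
  by apply: integrableS intf => //; apply: subset_itv; rewrite bnd_simp.
by rewrite -E; ring.
Qed.

(** An additive interval function bounded by the length of the interval times
    an additive one vanishes: each bisection gains a factor 2. *)
Lemma additive_bisection (D K : R -> R -> R) :
  (forall s m t, s <= m -> m <= t -> D s t = D s m + D m t) ->
  (forall s m t, s <= m -> m <= t -> K s t = K s m + K m t) ->
  (forall s t, s <= t -> `|D s t| <= (t - s) * K s t) ->
  forall s t, s <= t -> D s t = 0.
Proof.
move=> Dadd Kadd DK s t st.
have H k : forall s t, s <= t -> `|D s t| <= (t - s) / 2 ^+ k * K s t.
  elim: k => [|k IH] {s t st} s t st; first by rewrite expr0 divr1 DK.
  pose m := (s + t) / 2.
  have sm : s <= m by rewrite /m; lra.
  have mt : m <= t by rewrite /m; lra.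
  rewrite (Dadd _ _ _ sm mt) (Kadd _ _ _ sm mt); apply: le_trans (ler_normD _ _) _.
  apply: le_trans (lerD (IH _ _ sm) (IH _ _ mt)) _.
  have -> : m - s = (t - s) / 2 by rewrite /m; field.
  have -> : t - m = (t - s) / 2 by rewrite /m; field.
  by rewrite -mulrDr exprS invfM mulrA.
have K0 : 0 <= (t - s) * K s t by apply: le_trans (DK _ _ st).
apply/eqP; rewrite -normr_le0; apply/ler_addgt0Pl => e e0; rewrite addr0.
have : (t - s) * K s t * (2^-1) ^+ k @[k --> \oo] --> (t - s) * K s t * 0.
  by apply: cvgMr; apply: cvg_expr; rewrite ger0_norm//; lra.
rewrite mulr0 => /cvgrPdist_le/(_ _ e0)[k _ /(_ k (leqnn k))] /=.
rewrite sub0r normrN => /(le_trans _); apply; apply: le_trans (H k _ _ st) _.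
by rewrite exprVn mulrAC ler_norm.
Qed.

Definition primitive f h := forall s t, s <= t ->
  f t - f s = \int[mu]_(r in `[s, t]) h r.

Lemma integrable_Lfun2_itv h s t : h \in Lfun mu 2%:E ->
  mu.-integrable `[s, t] (EFin \o h).
Proof.
move=> lh.
have lv : (fun r => const_mx (h r) : 'cV[R]_1) \in @L2fun R 1.
  apply/forallP => i; rewrite (_ : Defs.coord _ i = h)//.
  by apply/funext => r; rewrite /Defs.coord mxE.
have -> : h = (fun r => (const_mx (h r) : 'cV[R]_1) 0 0).
  by apply/funext => r; rewrite mxE.
exact: integrable_L2_interval.
Qed.

Lemma integrable_Lfun2_sqr_itv h s t : h \in Lfun mu 2%:E ->
  mu.-integrable `[s, t] (EFin \o (fun r => h r ^+ 2)).
Proof. by move=> lh; apply: integrableS (Lfun2_integrable_sqr lh). Qed.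

Lemma L1_le_L2_itv h s t : s <= t -> h \in Lfun mu 2%:E ->
  \int[mu]_(r in `[s, t]) `|h r| <=
  Num.sqrt (\int[mu]_(r in `[s, t]) (h r ^+ 2)) * Num.sqrt (t - s).
Proof.
move=> st lh; have ih := integrable_Lfun2_itv s t lh.
have mh : measurable_fun setT h by have /Lfun2P[] := lh.
rewrite -lee_fin fineK; last by apply: integrable_fin_num => //; exact: integrable_norm.
apply: (@le_trans _ _ (\int[mu]_(r in `[s, t]) `|h r * cst 1 r|%:E)%E).
  rewrite le_eqVlt; apply/orP; left; apply/eqP.
  by apply: eq_integral => r _ /=; rewrite mulr1.
apply: cauchy_schwarz => //; try exact: sqrtr_ge0.
- exact: measurable_funTS.
- rewrite sqr_sqrtr; last by apply: Rintegral_ge0 => r _; exact: sqr_ge0.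
  rewrite fineK//; apply: integrable_fin_num => //.
  exact: integrable_Lfun2_sqr_itv.
- rewrite sqr_sqrtr ?subr_ge0//.
  under eq_integral do rewrite expr1n.
  rewrite integral_cst//= lebesgue_measure_itv/= lte_fin mul1e.
  by case: ltgtP st => [_ _|//|-> _]; rewrite ?subrr// EFinB.
Qed.

Lemma integrable_continuous_Lfun2 f h s t : continuous f -> h \in Lfun mu 2%:E ->
  mu.-integrable `[s, t] (EFin \o (fun r => f r * h r)).
Proof.
move=> cf lh; have ih := integrable_Lfun2_itv s t lh.
have -> : EFin \o (fun r => f r * h r) = ((EFin \o f) \* (EFin \o h))%E.
  by apply/funext => r; rewrite /= EFinM.
apply: integrableMr => //.
- by apply: measurable_funTS; exact: continuous_measurable_fun.
- have : compact (f @` `[s, t]).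
    apply: continuous_compact; last exact: segment_compact.
    exact: continuous_subspaceT.
  move=> /compact_bounded[M [Mr fM]]; exists M; split => // N MN r rst.
  by apply: fM MN _ _; exists r.
Qed.

(** The difference of the two sides is additive in the interval; on [a, b] it is at
    most twice the product of the L^1 norms of the derivatives, hence at most b - a
    times their energy, and additive_bisection applies. *)
Lemma ibp f f' g g' s t : continuous f -> continuous g ->
  f' \in Lfun mu 2%:E -> g' \in Lfun mu 2%:E ->
  primitive f f' -> primitive g g' -> s <= t ->
  f t * g t - f s * g s = \int[mu]_(r in `[s, t]) (g r * f' r + f r * g' r).
Proof.
move=> cf cg lf lg pf pg st.
have iI a b : mu.-integrable `[a, b] (EFin \o (fun r => g r * f' r + f r * g' r)).
  by apply: integrable_funD => //; exact: integrable_continuous_Lfun2.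
have iK a b : mu.-integrable `[a, b] (EFin \o (fun r => f' r ^+ 2 + g' r ^+ 2)).
  by apply: integrable_funD => //; exact: integrable_Lfun2_sqr_itv.
pose D a b := f b * g b - f a * g a -
  \int[mu]_(r in `[a, b]) (g r * f' r + f r * g' r).
pose K a b := \int[mu]_(r in `[a, b]) (f' r ^+ 2 + g' r ^+ 2).
suff : D s t = 0 by move=> /eqP; rewrite subr_eq0 => /eqP.
apply: (additive_bisection (K := K)) st => [a m b am mb|a m b am mb|a b ab].
- by rewrite /D (Rintegral_itv_cat am mb)//; ring.
- by rewrite /K (Rintegral_itv_cat am mb).
have if' := integrable_Lfun2_itv a b lf; have ig' := integrable_Lfun2_itv a b lg.
have icf (c : R) h : h \in Lfun mu 2%:E ->
    mu.-integrable `[a, b] (EFin \o (fun r => c * h r)).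
  by move=> lh; apply: integrable_continuous_Lfun2 => // r; exact: cvg_cst.
have i1 : mu.-integrable `[a, b] (EFin \o (fun r => (g b - g r) * f' r)).
  by apply: integrable_continuous_Lfun2 => // r; apply: cvgB; [exact: cvg_cst|exact: cg].
have i2 : mu.-integrable `[a, b] (EFin \o (fun r => (f a - f r) * g' r)).
  by apply: integrable_continuous_Lfun2 => // r; apply: cvgB; [exact: cvg_cst|exact: cf].
have -> : D a b = \int[mu]_(r in `[a, b]) ((g b - g r) * f' r) +
                  \int[mu]_(r in `[a, b]) ((f a - f r) * g' r).
  under eq_Rintegral do rewrite mulrBl.
  under [X in _ = _ + X]eq_Rintegral do rewrite mulrBl.
  rewrite /D RintegralD//; [|exact: integrable_continuous_Lfun2..].
  rewrite !RintegralB//; try exact: integrable_continuous_Lfun2; try exact: icf.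
  rewrite !RintegralZl// -pf// -pg//; ring.
pose A := \int[mu]_(r in `[a, b]) `|f' r|.
pose B := \int[mu]_(r in `[a, b]) `|g' r|.
have nf : mu.-integrable `[a, b] (EFin \o (fun r => `|f' r|)) by exact: integrable_norm.
have ng : mu.-integrable `[a, b] (EFin \o (fun r => `|g' r|)) by exact: integrable_norm.
have sub h c d : h \in Lfun mu 2%:E -> a <= c -> c <= d -> d <= b ->
    \int[mu]_(r in `[c, d]) `|h r| <= \int[mu]_(r in `[a, b]) `|h r|.
  move=> lh ac cd db.
  have nh u w : mu.-integrable `[u, w] (EFin \o (fun r => `|h r|)).
    by apply: integrable_norm; exact: integrable_Lfun2_itv.
  have p u w : 0 <= \int[mu]_(r in `[u, w]) `|h r| by exact: Rintegral_ge0.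
  rewrite (Rintegral_itv_cat ac (le_trans cd db))// (Rintegral_itv_cat cd db)//.
  by rewrite addrCA lerDl addr_ge0.
have pdiff h h' c d : primitive h h' -> h' \in Lfun mu 2%:E -> a <= c -> c <= d -> d <= b ->
    `|h d - h c| <= \int[mu]_(r in `[a, b]) `|h' r|.
  move=> ph lh ac cd db; rewrite ph//; apply: le_trans (sub _ _ _ lh ac cd db).
  by apply: le_normr_Rintegral => //; exact: integrable_Lfun2_itv.
have A0 : 0 <= A by exact: Rintegral_ge0.
have B0 : 0 <= B by exact: Rintegral_ge0.
have h1 : `|\int[mu]_(r in `[a, b]) ((g b - g r) * f' r)| <= B * A.
  apply: le_trans (le_normr_Rintegral _ _) _ => //.
  rewrite -RintegralZl//; apply: le_Rintegral => //.
  - exact: integrable_norm.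
  - exact: integrable_funZ.
  - move=> r /=; rewrite in_itv/= => /andP[ar rb]; rewrite normrM ler_wpM2r//.
    exact: pdiff.
have h2 : `|\int[mu]_(r in `[a, b]) ((f a - f r) * g' r)| <= A * B.
  apply: le_trans (le_normr_Rintegral _ _) _ => //.
  rewrite -RintegralZl//; apply: le_Rintegral => //.
  - exact: integrable_norm.
  - exact: integrable_funZ.
  - move=> r /=; rewrite in_itv/= => /andP[ar rb]; rewrite normrM ler_wpM2r//.
    by rewrite distrC; exact: pdiff.
apply: le_trans (ler_normD _ _) _.
have := L1_le_L2_itv ab lf; have := L1_le_L2_itv ab lg; rewrite -/A -/B.
rewrite /K RintegralD//; [|exact: integrable_Lfun2_sqr_itv..].
set P := \int[mu]_(r in _) (f' r ^+ 2); set Q := \int[mu]_(r in _) (g' r ^+ 2).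
have P0 : 0 <= P by apply: Rintegral_ge0 => r _; exact: sqr_ge0.
have Q0 : 0 <= Q by apply: Rintegral_ge0 => r _; exact: sqr_ge0.
have ab0 : 0 <= b - a by lra.
rewrite -{3}(sqr_sqrtr ab0) -{2}(sqr_sqrtr P0) -{2}(sqr_sqrtr Q0).
have := sqrtr_ge0 P; have := sqrtr_ge0 Q; have := sqrtr_ge0 (b - a).
set p := Num.sqrt P; set q := Num.sqrt Q; set l := Num.sqrt (b - a).
move=> l0 q0 p0 Bq Ap.
have : A * B <= (p * l) * (q * l) by apply: ler_pM.
have : 0 <= l ^+ 2 * (p - q) ^+ 2 by rewrite mulr_ge0 ?sqr_ge0.
have : l ^+ 2 * (p - q) ^+ 2 = l ^+ 2 * (p ^+ 2 + q ^+ 2) - 2 * ((p * l) * (q * l)) by ring.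
move: h1 h2; rewrite (mulrC B); lra.
Qed.

End integration_by_parts.

(** * Translations and limits of weak derivatives *)

Section translation.
Variable R : realType.
Local Notation mu := (@lebesgue_measure R).
Variable c : R.

Let shiftc : measurableTypeR R -> measurableTypeR R := fun t => t + c.

Let measurable_shiftc : measurable_fun setT shiftc.
Proof. by apply: measurable_funD. Qed.

(** Uniqueness of the measure that gives intervals their length. *)
Lemma lebesgue_measure_shift (A : set R) : measurable A ->
  pushforward mu shiftc A = mu A.
Proof.
move=> mA; apply/esym/lebesgue_measure_unique => //= _ [[a b]] _ <-.
rewrite /pushforward (_ : shiftc @^-1` _ = `]a - c, b - c]%classic).
  rewrite !lebesgue_measure_itv/= !lte_fin ltrD2r; case: ifP => // _.
  by rewrite -!EFinB; congr EFin; ring.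
by apply/seteqP; split=> t /=; rewrite !in_itv/= /shiftc ltrBlDr lerBrDr.
Qed.

Lemma ge0_integral_shift (D : set R) (f : R -> \bar R) : measurable D ->
  measurable_fun setT f -> (forall t, 0 <= f t)%E ->
  (\int[mu]_(t in [set t : R | D (t + c)%R]) f (t + c)%R = \int[mu]_(t in D) f t)%E.
Proof.
move=> mD mf f0.
rewrite (_ : [set t | _] = shiftc @^-1` D)//.
transitivity (\int[mu]_(t in shiftc @^-1` D) (f \o shiftc) t)%E; first by [].
rewrite -ge0_integral_pushforward//=; last exact: measurable_funTS.
by apply: eq_measure_integral => A mA _; exact: lebesgue_measure_shift.
Qed.

Lemma integral_shift (f : R -> \bar R) : measurable_fun setT f ->
  (\int[mu]_t f (t + c)%R = \int[mu]_t f t)%E.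
Proof.
move=> mf; rewrite integralE [RHS]integralE; congr (_ - _)%E.
- rewrite -[RHS](ge0_integral_shift measurableT (measurable_funepos mf))//.
  by apply: eq_integral => t _; rewrite !funeposE.
- rewrite -[RHS](ge0_integral_shift measurableT (measurable_funeneg mf))//.
  by apply: eq_integral => t _; rewrite !funenegE.
Qed.

Lemma Rintegral_shift (f : R -> R) : measurable_fun setT f ->
  \int[mu]_t f (t + c) = \int[mu]_t f t.
Proof.
by move=> mf; rewrite /Rintegral -(@integral_shift (EFin \o f))//; exact/measurable_EFinP.
Qed.

End translation.

Section H1_shift.
Variables (R : realType) (n : nat) (c : R).
Local Notation V := 'cV[R]_n.
Local Notation mu := (@lebesgue_measure R).
Implicit Types (f : R -> V).

Definition vshift f : R -> V := fun t => f (t + c).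

Lemma vmeasurable_shift f : vmeasurable f -> vmeasurable (vshift f).
Proof.
move=> mf i; apply: (measurableT_comp (mf i)) => //.
by apply: measurable_funD.
Qed.

Lemma energy_shift D f : measurable D -> vmeasurable f ->
  energy [set t | D (t + c)] (vshift f) = energy D f.
Proof.
move=> mD mf; apply: (@ge0_integral_shift R c D (fun t => (sq (f t))%:E)) => //.
- exact: measurable_sqE.
- by move=> t; rewrite lee_fin sq_ge0.
Qed.

Lemma energyT_shift f : vmeasurable f -> energy setT (vshift f) = energy setT f.
Proof. by move=> mf; rewrite -(energy_shift measurableT mf). Qed.

Lemma L2fun_shift f : f \in @L2fun R n -> vshift f \in @L2fun R n.
Proof.
move=> /L2funP[mf fy]; apply/L2funP; split; first exact: vmeasurable_shift.
by rewrite energyT_shift.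
Qed.

Lemma L2norm_shift f : f \in @L2fun R n -> L2norm (vshift f) = L2norm f.
Proof.
move=> lf; apply/eqP; rewrite -(@eqrXn2 _ 2)// ?L2norm_ge0//; apply/eqP/EFin_inj.
rewrite !L2norm_energy//; last exact: L2fun_shift.
by rewrite energyT_shift//; exact: L2fun_vmeasurable.
Qed.

Lemma weak_derivative_shift (x v : R -> V) : x \in @L2fun R n -> v \in @L2fun R n ->
  weak_derivative x v -> weak_derivative (vshift x) (vshift v).
Proof.
move=> lx lv xv i phi tphi.
have [dphi cphi [A phiA]] := tphi.
have D (t : R) : is_derive t 1 (fun r => phi (r - c)) (derive1 phi (t - c)).
  have D' (r : R) : is_derive r 1 phi (derive1 phi r).
    by rewrite derive1E; exact: derivableP.
  have := is_derive_comp_affine 1 (- c) t D'; rewrite !mul1r.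
  by under eq_fun do rewrite mul1r.
have dpsi t : derive1 (fun t => phi (t - c)) t = derive1 phi (t - c).
  by rewrite derive1E; have [_ ->] := D t.
have tpsi : test_function (fun t => phi (t - c)).
  split; first by move=> t; have [] := D t.
  - rewrite (_ : derive1 _ = fun t => derive1 phi (t - c)); last first.
      by apply/funext => t; exact: dpsi.
    move=> t; apply: (@continuous_comp _ _ _ (fun t => t - c) (derive1 phi) t).
      by apply: cvgB; [exact: cvg_id|exact: cvg_cst].
    exact: cphi.
  - exists (A + `|c|) => t At; apply: phiA.
    by have := ler_distD t 0 c; have := lerB_dist t c; lra.
have mmul (f g : R -> R) : f \in Lfun mu 2%:E -> g \in Lfun mu 2%:E ->
    measurable_fun setT (fun t => f t * g t).
  move=> /Lfun2P[mf _] /Lfun2P[mg _]; exact: measurable_funM.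
have [lpsi ldpsi] := test_function_L2 tpsi.
have := xv i _ tpsi.
rewrite -(Rintegral_shift c); last by apply: mmul => //; exact: L2fun_coord.
rewrite -(@Rintegral_shift R c (fun t => v t i 0 * _)); last first.
  by apply: mmul => //; exact: L2fun_coord.
under eq_Rintegral do rewrite dpsi addrK.
by under [X in _ = - X -> _]eq_Rintegral do rewrite addrK.
Qed.

Lemma ae_shift (P : R -> Prop) : {ae mu, forall t, P t} -> {ae mu, forall t, P (t + c)}.
Proof.
move=> [N [mN N0 PN]]; exists [set t | N (t + c)]; split.
- have : measurable_fun setT (fun t : R => t + c) by apply: measurable_funD.
  by move=> /(_ measurableT _ mN); rewrite setTI.
- by rewrite -N0 -(lebesgue_measure_shift c mN).
- by move=> t /= Pt; apply: PN.
Qed.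

Lemma H1_shift_subproof (x : H1 R n) :
  (vshift x, L2class (vshift (H1deriv x))) \in @H1pred R n.
Proof.
have lv := L2_mem (H1deriv x).
apply/asboolP; split => /=.
- move=> t; apply: (@continuous_comp _ _ _ (fun t => t + c) x t).
    by apply: cvgD; [exact: cvg_id|exact: cvg_cst].
  exact: H1_continuous.
- by apply: L2fun_shift; exact: H1_L2.
- apply: (weak_derivative_ae (v := vshift (H1deriv x))).
  + exact: L2fun_shift.
  + exact: L2_mem.
  + have F : Filter (nbhs (almost_everywhere mu)) := ae_filter_ringOfSetsType mu.
    by apply: filterS (L2classE (L2fun_shift lv)) => t /[apply] ->.
  + apply: weak_derivative_shift => //; first exact: H1_L2.
    exact: H1_weak_derivative.
Qed.

Definition H1_shift (x : H1 R n) : H1 R n := MkH1 (H1_shift_subproof x).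

Lemma H1_shiftE (x : H1 R n) t : H1_shift x t = x (t + c).
Proof. by []. Qed.

Lemma H1deriv_shift (x : H1 R n) :
  {ae mu, forall t, H1deriv (H1_shift x) t = H1deriv x (t + c)}.
Proof.
have F : Filter (nbhs (almost_everywhere mu)) := ae_filter_ringOfSetsType mu.
have lv := L2fun_shift (L2_mem (H1deriv x)).
by apply: filterS (L2classE lv) => t ->.
Qed.

Lemma H1_shift_norm (x : H1 R n) : `|H1_shift x| = `|x|.
Proof.
rewrite !normH1E /H1norm; congr (Num.sqrt (_ ^+ 2 + _ ^+ 2)).
  by rewrite [LHS](L2norm_shift (H1_L2 x)).
rewrite !normL2E -(L2norm_shift (L2_mem (H1deriv x))).
apply: eq_L2norm; [exact: L2_mem|exact: L2fun_shift (L2_mem _)|].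
have F : Filter (nbhs (almost_everywhere mu)) := ae_filter_ringOfSetsType mu.
by apply: filterS (H1deriv_shift x) => t -> _.
Qed.

End H1_shift.

Section weak_closure.
Variables (R : realType) (n : nat).
Local Notation V := 'cV[R]_n.
Local Notation mu := (@lebesgue_measure R).

(** A test function only sees a bounded interval, so weak derivatives pass to
    limits in L^2 of bounded intervals. *)
Lemma weak_derivative_closed (x v : R -> V) :
  x \in @L2fun R n -> v \in @L2fun R n ->
  (forall A e : R, 0 <= A -> 0 < e -> exists x' v' : R -> V,
    [/\ x' \in @L2fun R n, v' \in @L2fun R n, weak_derivative x' v',
        (energy `[(- A)%R, A] (x' \- x)%R <= (e ^+ 2)%:E)%E &
        (energy `[(- A)%R, A] (v' \- v)%R <= (e ^+ 2)%:E)%E]) ->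
  weak_derivative x v.
Proof.
move=> lx lv H i phi tphi.
have [lphi ldphi] := test_function_L2 tphi.
have [dphi cphi [A0 phiA0]] := tphi.
pose A := `|A0| + 1; have A0' : 0 <= A by rewrite /A; have := normr_ge0 A0; lra.
have phiA t : A < `|t| -> phi t = 0.
  by move=> At; apply: phiA0; have := ler_norm A0; rewrite /A in At; lra.
have dphiA t : A < `|t| -> derive1 phi t = 0.
  move=> At; rewrite derive1E (near_eq_derive (g := cst 0)) ?derive_cst//.
  have : nbhs t [set s | A < `|s|].
    by have := @norm_continuous _ R t; move/cvgr_gt; exact.
  by apply: filterS => s /phiA.
pose N (psi : R -> R) := fine ('N[mu]_2%:E[EFin \o psi]).
have N0 psi : 0 <= N psi by rewrite fine_ge0// Lnorm_ge0.
have K (f g : R -> V) (psi : R -> R) e : f \in @L2fun R n -> g \in @L2fun R n ->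
    psi \in Lfun mu 2%:E -> (forall t, A < `|t| -> psi t = 0) -> 0 <= e ->
    (energy `[(- A)%R, A] (f \- g)%R <= (e ^+ 2)%:E)%E ->
    `|\int[mu]_t (f t i 0 * psi t) - \int[mu]_t (g t i 0 * psi t)| <= e * N psi.
  move=> lf lg lpsi psiA e0 fge.
  have lfi := L2fun_coord i lf; have lgi := L2fun_coord i lg.
  have mfg := vmeasurableB (L2fun_vmeasurable lf) (L2fun_vmeasurable lg).
  have mpsi : measurable_fun setT psi by have /Lfun2P[] := lpsi.
  rewrite -RintegralB//; [|exact: integrable_L2_mul lfi lpsi|exact: integrable_L2_mul lgi lpsi].
  have -> : \int[mu]_t (f t i 0 * psi t - g t i 0 * psi t) =
      \int[mu]_(t in `[- A, A]) ((f \- g) t i 0 * psi t).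
    rewrite [RHS]Rintegral_mkcond; apply: eq_Rintegral => t _.
    rewrite patchE; case: ifPn => [_|]; first by rewrite /= !mxE mulrBl.
    rewrite mem_setE in_itv/= -ler_norml -ltNge => /psiA ->; rewrite !mulr0 subrr//.
  have li : (fun t => (f \- g) t i 0) \in Lfun mu 2%:E.
    by apply: L2fun_coord; exact: L2funB.
  have ifg : mu.-integrable `[- A, A] (EFin \o (fun t => (f \- g) t i 0 * psi t)).
    by apply: integrableS (integrable_L2_mul li lpsi).
  apply: le_trans (le_normr_Rintegral _ _) _ => //.
  rewrite -lee_fin fineK; last first.
    by apply: integrable_fin_num => //; exact: integrable_norm.
  apply: cauchy_schwarz => //.
  - by apply: measurable_funTS; exact: mfg.
  - exact: measurable_funTS.
  - by apply: le_trans (coord_energy _ _ mfg) fge.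
  - rewrite sqr_fine_Lnorm2//; apply: ge0_subset_integral => //.
    + by apply/measurable_EFinP; exact: measurable_funX.
    + by move=> t _; rewrite lee_fin sqr_ge0.
apply/eqP; rewrite -subr_eq0 opprK -normr_le0; apply/ler_addgt0Pl => e e0.
rewrite addr0; pose M := N (derive1 phi) + N phi + 1.
have M0 : 0 < M by have := N0 phi; have := N0 (derive1 phi); rewrite /M; lra.
have [x' [v' [lx' lv' xv' xe ve]]] := H A (e / M) A0' (divr_gt0 e0 M0).
have h1 := K _ _ _ _ lx' lx ldphi dphiA (ltW (divr_gt0 e0 M0)) xe.
have h2 := K _ _ _ _ lv' lv lphi phiA (ltW (divr_gt0 e0 M0)) ve.
have h3 := xv' i phi tphi.
have h4 : e / M * N (derive1 phi) + e / M * N phi <= e.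
  rewrite -mulrDr mulrAC ler_pdivrMr// ler_pM2l// /M; lra.
have arith (p q p' q' a b : R) : `|p' - p| <= a -> `|q' - q| <= b ->
    p' = - q' -> a + b <= e -> `|p + q| <= e.
  by clear; rewrite !ler_norml => /andP[? ?] /andP[? ?] ? ?; apply/andP; split; lra.
exact: arith h1 h2 h3 h4.
Qed.

End weak_closure.

(** * Symmetry of J d/dt *)

Section symmetry.
Variables (R : realType) (n : nat).
Local Notation V := 'cV[R]_n.
Local Notation mu := (@lebesgue_measure R).

Lemma integrable_Rintegral_sum (I : Type) (s : seq I) (D : set R) (f : I -> R -> R) :
  measurable D -> (forall i, mu.-integrable D (EFin \o f i)) ->
  mu.-integrable D (EFin \o (fun t => \sum_(i <- s) f i t)) /\
  \int[mu]_(t in D) (\sum_(i <- s) f i t) = \sum_(i <- s) \int[mu]_(t in D) f i t.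
Proof.
move=> mD fi; elim: s => [|i s [IH1 IH2]].
  have -> : (fun t => \sum_(i <- [::]) f i t) = cst 0.
    by apply/funext => t; rewrite big_nil.
  by rewrite big_nil Rintegral_cst// mul0r; split=> //; exact: integrable0.
have -> : (fun t => \sum_(j <- i :: s) f j t) = (fun t => f i t + \sum_(j <- s) f j t).
  by apply/funext => t; rewrite big_cons.
by rewrite big_cons -IH2 -RintegralD//; split=> //; exact: integrable_funD.
Qed.

Lemma Rintegral_sum (I : Type) (s : seq I) (D : set R) (f : I -> R -> R) :
  measurable D -> (forall i, mu.-integrable D (EFin \o f i)) ->
  \int[mu]_(t in D) (\sum_(i <- s) f i t) = \sum_(i <- s) \int[mu]_(t in D) f i t.
Proof. by move=> mD fi; have [] := integrable_Rintegral_sum s mD fi. Qed.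

Lemma Rintegral_tail (h : R -> R) (e : R) : mu.-integrable setT (EFin \o h) -> 0 < e ->
  exists2 C : R, 0 <= C & forall D : R, C <= D ->
   `|\int[mu]_t h t - \int[mu]_(t in `[- D, D]) h t| <= e.
Proof.
move=> ih e0.
have ihn : mu.-integrable setT (EFin \o (fun t => `|h t|)) by exact: integrable_norm.
have mhn : measurable_fun setT (fun t => (`|h t|)%:E) by have /integrableP[] := ihn.
have iS (g : R -> R) (D : set R) : measurable D -> mu.-integrable setT (EFin \o g) ->
    mu.-integrable D (EFin \o g) by move=> mD; exact: integrableS.
have split (g : R -> R) (D : R) : mu.-integrable setT (EFin \o g) ->
    \int[mu]_t g t = \int[mu]_(t in `[- D, D]) g t + \int[mu]_(t in ~` `[- D, D]) g t.
  move=> ig; rewrite -Rintegral_setU//; first by rewrite setUv.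
  - exact: measurableC.
  - by rewrite setUv.
  - by apply/disj_set2P; rewrite setICr.
have [C C0 hC] : exists2 C : R, 0 <= C &
    \int[mu]_t `|h t| - \int[mu]_(t in `[- C, C]) `|h t| <= e.
  have cv : (\int[mu]_(t in `[(- k%:R)%R, k%:R]) (`|h t|)%:E)%E @[k --> \oo] -->
            (\int[mu]_t (`|h t|)%:E)%E.
    rewrite (_ : [set: _] = \bigcup_k `[- k%:R, k%:R]%classic).
      apply: ge0_nondecreasing_set_cvg_integral => //.
      + move=> k m km; rewrite subsetEset => t /=; rewrite !in_itv/= -!ler_norml.
        by move=> /le_trans; apply; rewrite ler_nat.
      + by move=> k; exact: measurable_funTS.
    apply/seteqP; split=> // t _; exists (Num.truncn `|t|).+1 => //=.
    by rewrite in_itv/= -ler_norml ltW//; exact: truncnS_gt.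
  have fI : (\int[mu]_t (`|h t|)%:E)%E = (\int[mu]_t `|h t|)%:E.
    by rewrite fineK//; exact: integrable_fin_num.
  rewrite fI in cv.
  have : \forall k \near \oo, ((\int[mu]_t `|h t| - e)%:E <
      (\int[mu]_(t in `[(- k%:R)%R, k%:R]) (`|h t|)%:E))%E.
    apply: (cv [set y | ((\int[mu]_t `|h t| - e)%:E < y)%E]) => /=.
    apply: open_nbhs_nbhs; split; first exact: open_ereal_gt_ereal.
    by rewrite /= lte_fin gtrBl.
  move=> [k _ /(_ k (leqnn k))] /= hk; exists k%:R; first exact: ler0n.
  move: hk; rewrite -(@fineK _ (\int[mu]_(t in `[_, _]) _)%E); last first.
    by apply: integrable_fin_num => //; exact: iS.
  by rewrite lte_fin => /ltW; rewrite lerBlDr addrC -lerBlDr.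
exists C => // D CD; rewrite (split h D ih) addrC addKr.
have mc : measurable (~` `[- D, D]%classic) by exact: measurableC.
apply: le_trans (le_normr_Rintegral _ _) _ => //; first exact: iS.
apply: le_trans hC; rewrite (split _ D ihn).
rewrite lerBrDl lerD2r /Rintegral fine_le//.
- by apply: integrable_fin_num => //; exact: iS.
- by apply: integrable_fin_num => //; exact: iS.
- apply: ge0_subset_integral => //; first exact: measurable_funTS.
  move=> t /=; rewrite !in_itv/= -!ler_norml => /le_trans; exact.
Qed.

Lemma H1_coord_continuous (x : H1 R n) i : continuous (fun t => x t i 0).
Proof.
move=> t.
exact: (continuous_comp (@H1_continuous _ _ x t) (@coord_continuous _ _ _ i 0 _)).
Qed.

Lemma H1_ibp (x y : H1 R n) i k s t : s <= t ->
  x t i 0 * y t k 0 - x s i 0 * y s k 0 =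
  \int[mu]_(r in `[s, t]) (y r k 0 * H1deriv x r i 0 + x r i 0 * H1deriv y r k 0).
Proof.
move=> st; apply: (@ibp R (fun t => x t i 0) (fun t => H1deriv x t i 0)
  (fun t => y t k 0) (fun t => H1deriv y t k 0)) => //.
- exact: H1_coord_continuous.
- exact: H1_coord_continuous.
- by apply: L2fun_coord; exact: L2_mem.
- by apply: L2fun_coord; exact: L2_mem.
- by move=> a b ab; exact: H1_ftc.
- by move=> a b ab; exact: H1_ftc.
Qed.

Variable J : 'M[R]_n.
Hypothesis JT : J^T = - J.

Lemma L2fun_mulmx (A : 'M[R]_n) (f : R -> V) : f \in @L2fun R n ->
  (fun t => A *m f t) \in @L2fun R n.
Proof.
move=> lf; apply/forallP => i.
have le12 : (1 <= 2%:E :> \bar R)%E by rewrite lee_fin ler1n.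
rewrite (_ : Defs.coord _ i = \sum_j A i j *: Defs.coord f j); last first.
  apply/funext => t; rewrite /Defs.coord mxE fct_sumE.
  by apply: eq_bigr.
have [h0 hD] := Lfun_submod_closed mu le12.
elim/big_rec : _ => // j g _ lg; apply: hD => //.
by move: lf => /forallP.
Qed.

Lemma dot_antisym (a b c d : V) :
  dot (J *m a) d - dot b (J *m c) =
  \sum_i \sum_k J i k * (d i 0 * a k 0 + b k 0 * c i 0).
Proof.
rewrite {2}/dot; under [X in _ - X = _]eq_bigr do rewrite mxE mulr_sumr.
rewrite exchange_big/= -sumrN /dot -big_split/=; apply: eq_bigr => i _.
rewrite mxE mulr_suml -sumrN -big_split/=; apply: eq_bigr => k _.
have : J k i = - J i k by have := congr1 (fun A : 'M[R]_n => A i k) JT; rewrite !mxE.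
by move=> ->; ring.
Qed.

(** The operator J d/dt is symmetric: integrating by parts, the boundary terms
    vanish at infinity. *)
Lemma ip_J_sym (x y : H1 R n) :
  ip (fun t => J *m H1deriv x t) y = ip x (fun t => J *m H1deriv y t).
Proof.
have lx := H1_L2 x; have ly := H1_L2 y.
have lx' := L2_mem (H1deriv x); have ly' := L2_mem (H1deriv y).
have lJx := L2fun_mulmx J lx'; have lJy := L2fun_mulmx J ly'.
apply/eqP; rewrite -subr_eq0 -normr_le0; apply/ler_addgt0Pl => e e0; rewrite addr0.
pose h t := dot (J *m H1deriv x t) (y t) - dot (x t) (J *m H1deriv y t).
have ih : mu.-integrable setT (EFin \o h).
  have := integrableB measurableT (integrable_dot lJx ly) (integrable_dot lx lJy).
  exact: eq_integrable.
rewrite /ip -RintegralB//; try exact: integrable_dot.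
rewrite -/h.
pose S := \sum_i \sum_k `|J i k| * 2.
have S0 : 0 <= S by apply: sumr_ge0 => i _; apply: sumr_ge0 => k _; rewrite mulr_ge0.
pose d := Num.min 1 (e / (S + 1) / 2).
have d0 : 0 < d by rewrite lt_min ltr01/= divr_gt0// divr_gt0//; lra.
have d1 : d <= 1 by rewrite ge_min lexx.
have [A A0 xA] := H1_decay x d0; have [B B0 yB] := H1_decay y d0.
have ihn : mu.-integrable setT (EFin \o (fun t => `|h t|)) by exact: integrable_norm.
have [C C0 hC] : exists2 C : R, 0 <= C & forall D : R, C <= D ->
   `|\int[mu]_t h t - \int[mu]_(t in `[- D, D]) h t| <= e / 2.
  by apply: Rintegral_tail => //; exact: divr_gt0.
pose D := A + B + C + 1.
have CD : C <= D by rewrite /D; lra.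
have D0 : - D <= D by rewrite /D; lra.
have hD : `|\int[mu]_(t in `[- D, D]) h t| <= S * d ^+ 2.
  under eq_Rintegral do rewrite /h dot_antisym.
  have ii i k : mu.-integrable `[- D, D] (EFin \o (fun r =>
      y r i 0 * H1deriv x r k 0 + x r k 0 * H1deriv y r i 0)).
    apply: integrable_funD => //; apply: integrable_continuous_Lfun2;
      by [exact: H1_coord_continuous|apply: L2fun_coord; exact: L2_mem].
  rewrite Rintegral_sum//; last first.
    by move=> i; apply: (integrable_Rintegral_sum _ _ _).1 => // k; exact: integrable_funZ.
  apply: le_trans (ler_norm_sum _ _ _) _; rewrite /S mulr_suml; apply: ler_sum => i _.
  rewrite Rintegral_sum//; last by move=> k; exact: integrable_funZ.
  apply: le_trans (ler_norm_sum _ _ _) _; rewrite mulr_suml; apply: ler_sum => k _.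
  rewrite RintegralZl//= normrM -mulrA ler_wpM2l//.
  rewrite -H1_ibp//; apply: le_trans (ler_normB _ _) _; rewrite !normrM.
  have xD r : `|r| = D -> `|x r k 0| <= d.
    move=> rD; apply: le_trans (le_coord_norm _ _) _; apply: xA; rewrite rD /D; lra.
  have yD r : `|r| = D -> `|y r i 0| <= d.
    move=> rD; apply: le_trans (le_coord_norm _ _) _; apply: yB; rewrite rD /D; lra.
  have nD : `|D| = D by rewrite ger0_norm// /D; lra.
  have nND : `|- D| = D by rewrite normrN.
  by rewrite (_ : 2 * d ^+ 2 = d * d + d * d); [apply: lerD; apply: ler_pM; auto|ring].
have := hC D CD.
have : S * d ^+ 2 <= e / 2.
  have : d <= e / (S + 1) / 2 by rewrite ge_min lexx orbT.
  rewrite ler_pdivlMr// ler_pdivlMr; last lra.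
  have : d ^+ 2 <= d by rewrite expr2 ler_piMl// ltW.
  by clear -S0 d0; nra.
move: hD; set I1 := \int[mu]_t h t; set I2 := \int[mu]_(t in _) h t.
clear; rewrite !ler_norml => /andP[? ?] ? /andP[? ?]; apply/andP; split; lra.
Qed.

End symmetry.

(** * Mean values and mixed partial derivatives *)

Section partial_derivatives.
Variables (R : realType) (n : nat).
Local Notation V := 'cV[R]_n.
Local Notation e_ j := (delta_mx j 0 : V).
Implicit Types (f : V -> R) (a b v : V).

Lemma is_derive_line f a v (s : R) : (forall z, derivable f z v) ->
  is_derive s 1 (fun r => f (a + r *: v)) ('D_v f (a + s *: v)).
Proof.
move=> df.
have E : (fun h : R => h^-1 *: (((fun r => f (a + r *: v)) \o shift s) (h *: (1 : R))
       - f (a + s *: v))) =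
    (fun h : R => h^-1 *: ((f \o shift (a + s *: v)) (h *: v) - f (a + s *: v))).
  apply/funext => h; congr (_ *: (f _ - _)) => /=.
  rewrite /shift/= (_ : h *: (1 : R) = h); last exact: mulr1.
  by rewrite scalerDl addrCA.
by split; [have := df (a + s *: v)|]; rewrite /derivable /derive E.
Qed.

Lemma line_mean_value f a v (d : R) : (forall z, derivable f z v) ->
  exists2 s : R, `|s| <= `|d| & f (a + d *: v) - f a = 'D_v f (a + s *: v) * d.
Proof.
move=> df; have D s := is_derive_line a s df.
have cf := continuous_is_derive (fun s => D s).
have [d0|d0] := leP 0 d.
  have [s] := MVT_segment d0 (fun x _ => D x) (continuous_subspaceT cf).
  rewrite in_itv/= => /andP[s0 sd]; rewrite scale0r addr0 subr0 => E.
  by exists s => //; rewrite !ger0_norm.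
have [s] := MVT_segment (ltW d0) (fun x _ => D x) (continuous_subspaceT cf).
rewrite in_itv/= => /andP[s0 sd]; rewrite scale0r addr0 sub0r => E.
exists s; first by rewrite !ler0_norm ?lerN2// ltW.
by rewrite -opprB E mulrN opprK.
Qed.

(** Walking from a to b one coordinate at a time only uses partial derivatives
    and stays in the cube around a through b. *)
Lemma partial_mean_value f a b (M : R) :
  (forall z j, derivable f z (e_ j)) ->
  (forall z j, `|z - a| <= `|b - a| -> `|'D_(e_ j) f z| <= M) ->
  `|f b - f a| <= M * \sum_j `|b j 0 - a j 0|.
Proof.
move=> df dM.
pose p k : V := \col_j (if (j < k)%N then b j 0 else a j 0).
have p0 : p 0%N = a by apply/colP => j; rewrite mxE.
have pn : p n = b by apply/colP => j; rewrite mxE ltn_ord.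
rewrite -pn -p0 -(telescope_sumr (fun k => f (p k)) (leq0n n)) big_mkord.
apply: le_trans (ler_norm_sum _ _ _) _; rewrite mulr_sumr; apply: ler_sum => k _.
rewrite pn p0.
have pS : p k.+1 = p k + (b k 0 - a k 0) *: e_ k.
  apply/colP => j; rewrite !mxE; have [->|jk] := eqVneq j k.
    by rewrite ltnS leqnn ltnn mulr1 addrC subrK.
  by rewrite ltnS leq_eqVlt val_eqE (negbTE jk) /= mulr0 addr0.
have [s sd E] := line_mean_value (p k) (b k 0 - a k 0) (fun z => df z k).
rewrite /= pS E normrM ler_wpM2r//; apply: dM.
apply: norm_le_coord => [|j]; first exact: normr_ge0.
rewrite !mxE; have ba i : `|b i 0 - a i 0| <= `|b - a|.
  by have := le_coord_norm (b - a) i; rewrite !mxE.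
have [->|jk] := eqVneq j k; rewrite /= ?mulr1 ?mulr0 ?addr0.
  by rewrite ltnn addrC addKr (le_trans sd).
by case: ifP => _; rewrite ?subrr ?normr0.
Qed.

(** One mean value theorem in each of the two directions. *)
Lemma second_difference f a (i j : 'I_n) (s : R) : 0 < s ->
  (forall z, derivable f z (e_ i)) ->
  (forall z, derivable (fun y => 'D_(e_ i) f y) z (e_ j)) ->
  exists2 z, `|z - a| <= 2 * s &
    f (a + s *: e_ i + s *: e_ j) - f (a + s *: e_ i) - f (a + s *: e_ j) + f a =
    'D_(e_ j) (fun y => 'D_(e_ i) f y) z * s ^+ 2.
Proof.
move=> s0 df ddf.
pose g z := f (z + s *: e_ j) - f z.
have dg z : is_derive z (e_ i) g ('D_(e_ i) f (z + s *: e_ j) - 'D_(e_ i) f z).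
  have D1 : is_derive z (e_ i) (fun z => f (z + s *: e_ j)) ('D_(e_ i) f (z + s *: e_ j)).
    have E : (fun h : R => h^-1 *: (((fun z => f (z + s *: e_ j)) \o shift z) (h *: e_ i)
        - f (z + s *: e_ j))) =
        (fun h : R => h^-1 *: ((f \o shift (z + s *: e_ j)) (h *: e_ i) - f (z + s *: e_ j))).
      by apply/funext => h; congr (_ *: (f _ - _)); rewrite /= /shift/= addrA.
    by split; [have := df (z + s *: e_ j)|]; rewrite /derivable /derive E.
  have D2 : is_derive z (e_ i) f ('D_(e_ i) f z) by split.
  exact: is_deriveB.
have [r rs Er] := line_mean_value a s (fun z => @ex_derive _ _ _ _ _ _ _ (dg z)).
have [r' rs' Er'] := line_mean_value (a + r *: e_ i) s ddf.
exists (a + r *: e_ i + r' *: e_ j).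
  have -> : a + r *: e_ i + r' *: e_ j - a = r *: e_ i + r' *: e_ j.
    by rewrite -(addrA a) [LHS]addrC addKr.
  apply: le_trans (ler_normD _ _) _.
  have e1 k : `|e_ k| <= 1.
    by apply: norm_le_coord => // l; rewrite mxE; case: eqP; rewrite ?normr1 ?normr0.
  rewrite !normrZ (_ : 2 * s = s * 1 + s * 1); last by ring.
  by rewrite (gtr0_norm s0) in rs rs'; apply: lerD; apply: ler_pM.
have -> : f (a + s *: e_ i + s *: e_ j) - f (a + s *: e_ i) - f (a + s *: e_ j) + f a =
    g (a + s *: e_ i) - g a by rewrite /g; ring.
rewrite Er; have [_ ->] := dg (a + r *: e_ i).
by rewrite Er'; ring.
Qed.

Lemma eq_of_near_values (A B : V -> R) a :
  {for a, continuous A} -> {for a, continuous B} ->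
  (forall s : R, 0 < s -> exists z1 z2 : V,
     [/\ `|z1 - a| <= s, `|z2 - a| <= s & A z1 = B z2]) -> A a = B a.
Proof.
move=> cA cB H.
apply/eqP; rewrite -subr_eq0 -normr_le0; apply/ler_addgt0Pl => e e0; rewrite addr0.
have e2 : 0 < e / 2 by exact: divr_gt0.
have /nbhs_ballP[d1 /= d10 D1] : \forall z \near a, `|A a - A z| < e / 2.
  by move/cvgrPdist_lt : cA; apply.
have /nbhs_ballP[d2 /= d20 D2] : \forall z \near a, `|B a - B z| < e / 2.
  by move/cvgrPdist_lt : cB; apply.
have m0 : 0 < Num.min d1 d2 by rewrite lt_min d10.
have sm : Num.min d1 d2 / 2 < Num.min d1 d2 by lra.
have [z1 [z2 [z1s z2s AB]]] := H _ (divr_gt0 m0 (ltr0n _ 2)).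
have h1 : `|A a - A z1| < e / 2.
  apply: (D1 z1); rewrite -ball_normE /ball_/= distrC (le_lt_trans z1s)//.
  by rewrite (lt_le_trans sm)// ge_min lexx.
have h2 : `|B a - B z2| < e / 2.
  apply: (D2 z2); rewrite -ball_normE /ball_/= distrC (le_lt_trans z2s)//.
  by rewrite (lt_le_trans sm)// ge_min lexx orbT.
move: h1 h2; rewrite AB; clear; rewrite !ltr_norml ler_norml => /andP[? ?] /andP[? ?].
by apply/andP; split; lra.
Qed.

(** Schwarz: both iterated derivatives are approached by the same second
    difference quotient. *)
Lemma schwarz f (i j : 'I_n) a :
  (forall z k, derivable f z (e_ k)) ->
  (forall z k l, derivable (fun y => 'D_(e_ k) f y) z (e_ l)) ->
  {for a, continuous (fun z => 'D_(e_ j) (fun y => 'D_(e_ i) f y) z)} ->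
  {for a, continuous (fun z => 'D_(e_ i) (fun y => 'D_(e_ j) f y) z)} ->
  'D_(e_ j) (fun y => 'D_(e_ i) f y) a = 'D_(e_ i) (fun y => 'D_(e_ j) f y) a.
Proof.
move=> df ddf cij cji; apply: (eq_of_near_values cij cji) => s s0.
have s20 : 0 < s / 2 by exact: divr_gt0.
have [z1 z1s E1] := second_difference a s20 (df^~ i) (fun z => ddf z i j).
have [z2 z2s E2] := second_difference a s20 (df^~ j) (fun z => ddf z j i).
have s2 : (s / 2) ^+ 2 != 0 by rewrite expf_neq0// gt_eqF.
have ss : 2 * (s / 2) = s by field.
exists z1, z2; split; [by rewrite -ss|by rewrite -ss|].
move: E1 E2; rewrite (addrAC a ((s / 2) *: e_ i)) => E1 E2.
apply: (mulIf s2); rewrite -E1 -E2.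
move: (f (a + _ + _)) (f (a + (s / 2) *: e_ i)) (f (a + _)) (f a); clear => p q r t; ring.
Qed.

End partial_derivatives.

(** * Fields with equicontinuous derivatives *)

Section fields.
Variables (R : realType) (n : nat).
Local Notation V := 'cV[R]_n.
Local Notation e_ j := (delta_mx j 0 : V).
Implicit Types (h g : R -> V -> V).

Lemma closed_ball_compact (r : R) : compact [set x : V | `|x| <= r].
Proof.
have -> : [set x : V | `|x| <= r] = trmx @` [set x : 'rV[R]_n | `|x| <= r].
  have nT m k (A : 'M[R]_(m, k)) : `|A^T| <= `|A|.
    rewrite [leLHS]/Num.norm/= mx_normrE bigmax_le// => -[i j] _ /=.
    rewrite mxE [leRHS]/Num.norm/= mx_normrE.
    by apply/bigmax_geP; right; exists (j, i).
  apply/seteqP; split=> [x /= xr|_ [x /= xr <-]].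
    by exists x^T; rewrite ?trmxK//=; exact: le_trans (nT _ _ _) xr.
  exact: le_trans (nT _ _ _) xr.
apply: continuous_compact.
  have cT : continuous (fun A : 'rV[R]_n => A^T : 'cV[R]_n).
    move=> A; have FA : Filter (nbhs A) by exact: nbhs_filter.
    apply/(@cvgrPdist_le _ _ _ (nbhs A)) => e e0.
    apply/nbhs_ballP; exists e => //= B; rewrite -ball_normE /ball_/= => AB.
    rewrite -linearB/=; apply: le_trans (ltW AB).
    rewrite [leLHS]/Num.norm/= mx_normrE bigmax_le// => -[i j] _ /=.
    rewrite mxE [leRHS]/Num.norm/= mx_normrE.
    by apply/bigmax_geP; right; exists (j, i).
  exact: continuous_subspaceT.
apply: bounded_closed_compact.
  by exists r; split=> [|M rM x /= /le_trans]; [exact: num_real|apply; exact: ltW].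
have -> : [set x : 'rV[R]_n | `|x| <= r] = Num.norm @^-1` [set y : R | y <= r] by [].
by apply: closed_comp; [move=> x _; exact: norm_continuous|exact: closed_le].
Qed.

Lemma continuous_bounded (phi : R * V -> R) (a b r : R) : continuous phi ->
  exists M : R, forall t x, a <= t <= b -> `|x| <= r -> `|phi (t, x)| <= M.
Proof.
move=> cphi.
have : compact (phi @` (`[a, b]%classic `*` [set x : V | `|x| <= r])).
  apply: continuous_compact; first exact: continuous_subspaceT.
  by apply: compact_setX; [exact: segment_compact|exact: closed_ball_compact].
move=> /compact_bounded[M [Mr HM]]; exists (M + 1) => t x tab xr.
by apply: (HM (M + 1)); [rewrite ltrDl|exists (t, x); split=> //=; rewrite in_itv].
Qed.

(** With a derivative bounded on balls uniformly in time, x |-> h(t, x(t)) maps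
    H^1 to L^2, since elements of H^1 are bounded. *)
Definition regular_field h :=
  [/\ forall i, bundle 1 (fun t xi => h t xi i 0), forall t, h t 0 = 0 &
      forall r : R, exists M : R, forall t xi i j, `|xi| <= r ->
        `|jac (h t) xi i j| <= M].

Definition C1_field h := forall i, bundle 1 (fun t xi => h t xi i 0).

Lemma C1_field_derivable h t xi i j : C1_field h ->
  derivable (fun eta => h t eta i 0) xi (e_ j).
Proof. by move=> /(_ i)[_ /(_ j)[+ _]]; exact. Qed.

Lemma continuous_jac h i j : C1_field h ->
  continuous (fun p : R * V => jac (h p.1) p.2 i j).
Proof.
move=> /(_ i)[_ /(_ j)[_ [[c _] _]]].
by under eq_fun do rewrite mxE.
Qed.

Lemma continuous_field h : C1_field h -> continuous (fun p : R * V => h p.1 p.2).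
Proof.
move=> Ch p; apply/cvgrPdist_le => e e0.
have : \forall q \near p, forall i, `|h p.1 p.2 i 0 - h q.1 q.2 i 0| <= e.
  apply: (@filter_forall _ _ _ (nbhs p)) => i; have [[c _] _] := Ch i.
  by move: e e0; apply/cvgrPdist_le; exact: c.
apply: filterS => q hq; apply: norm_le_coord; first exact: ltW.
by move=> i; rewrite !mxE.
Qed.

Lemma continuous_superposition h (x : R -> V) : C1_field h -> continuous x ->
  continuous (fun t => h t (x t)).
Proof.
move=> Ch cx t.
apply: (@continuous_comp _ _ _ (fun t => (t, x t)) (fun p => h p.1 p.2) t).
  exact: (cvg_pair (@cvg_id _ (nbhs t)) (cx t)).
exact: continuous_field.
Qed.

Lemma continuous_jac_comp h (x : R -> V) i j : C1_field h -> continuous x ->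
  continuous (fun t => jac (h t) (x t) i j).
Proof.
move=> Ch cx t.
apply: (@continuous_comp _ _ _ (fun t => (t, x t)) (fun p => jac (h p.1) p.2 i j) t).
  exact: (cvg_pair (@cvg_id _ (nbhs t)) (cx t)).
exact: continuous_jac.
Qed.

(** The comparison matrix B is free: B = 0 gives a Lipschitz bound, the derivative
    at a base point gives a first-order expansion. *)
Lemma field_mean_value h t xi eta (B : 'M[R]_n) (M : R) : C1_field h ->
  (forall z, `|z - xi| <= `|eta - xi| ->
     forall i j, `|jac (h t) z i j - B i j| <= M) ->
  sq (h t eta - h t xi - B *m (eta - xi)) <= n%:R * (M * n%:R) ^+ 2 * sq (eta - xi).
Proof.
move=> Ch hM; set w := h t eta - _ - _.
have wi i : w i 0 ^+ 2 <= (M * n%:R) ^+ 2 * sq (eta - xi).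
  pose f z := h t z i 0 - (B *m z) i 0.
  have D z j : is_derive z (e_ j) f (jac (h t) z i j - B i j).
    have D1 : is_derive z (e_ j) (fun eta => h t eta i 0) (jac (h t) z i j).
      by split; [exact: C1_field_derivable|rewrite mxE].
    have D2 : is_derive z (e_ j) (fun z => (B *m z) i 0) (B i j).
      have H : h^-1 *: (((fun z => (B *m z) i 0) \o shift z) (h *: e_ j) - (B *m z) i 0)
          @[h --> (0:R)^'] --> B i j.
        apply: cvg_near_cst; near=> k.
        have k0 : k != 0 by near: k; exact: nbhs_dnbhs_neq.
        rewrite /= /shift/= mulmxDr [X in X - _]mxE addrK -scalemxAr mxE.
        rewrite -colE mxE; rewrite /GRing.scale/= mulKf//.
      by split; [apply/cvg_ex; exists (B i j)|exact: cvg_lim].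
    exact: is_deriveB.
  have := @partial_mean_value _ _ f xi eta M (fun z j => @ex_derive _ _ _ _ _ _ _ (D z j)).
  move=> /(_ _)/wrap[].
    by move=> z j zM; have [_ ->] := D z j; exact: hM.
  have -> : f eta - f xi = w i 0 by rewrite /f /w mulmxBr !mxE; ring.
  set S := \sum_j _ => wS.
  have S0 : 0 <= S by apply: sumr_ge0.
  have SS : S <= n%:R * `|eta - xi|.
    apply: le_trans (sum_coord_norm (eta - xi)).
    by apply: ler_sum => j _; rewrite !mxE.
  rewrite -real_normK ?num_real//; apply: (@le_trans _ _ ((M * S) ^+ 2)).
    by rewrite lerXn2r ?nnegrE//; exact: le_trans wS.
  rewrite [leRHS](_ : _ = M ^+ 2 * (n%:R ^+ 2 * sq (eta - xi))); last by ring.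
  rewrite exprMn ler_wpM2l ?sqr_ge0//.
  apply: (@le_trans _ _ ((n%:R * `|eta - xi|) ^+ 2)).
    by rewrite lerXn2r ?nnegrE// mulr_ge0.
  by rewrite exprMn ler_wpM2l ?sqr_ge0// norm_sq.
apply: (@le_trans _ _ (\sum_(i < n) (M * n%:R) ^+ 2 * sq (eta - xi))).
  by apply: ler_sum => i _; exact: wi.
by rewrite sumr_const card_ord -[leLHS]mulr_natl [leLHS]mulrA.
Unshelve. all: by end_near. Qed.

Lemma regular_lipschitz h : regular_field h -> forall r : R, exists2 L : R, 0 <= L &
  forall t xi eta, `|xi| <= r -> `|eta| <= r ->
    sq (h t eta - h t xi) <= L * sq (eta - xi).
Proof.
move=> [Ch h0 hM] r; have [M HM] := hM (3 * r).
exists (n%:R * (M * n%:R) ^+ 2); first by rewrite mulr_ge0// sqr_ge0.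
move=> t xi eta xir etar.
have := @field_mean_value h t xi eta 0 M Ch; rewrite mul0mx subr0; apply.
move=> z zxi i j; rewrite [X in _ - X]mxE subr0; apply: HM.
have := ler_normB eta xi; have := ler_normD (z - xi) xi; rewrite subrK; lra.
Qed.

(** Equicontinuity at each point becomes uniform on balls by compactness. *)
Lemma uniformly_equicontinuous_jac h (r e : R) : C1_field h -> 0 < e ->
  exists2 d : R, 0 < d & forall t xi eta, `|xi| <= r -> `|eta - xi| <= d ->
    forall i j, `|jac (h t) eta i j - jac (h t) xi i j| <= e.
Proof.
move=> Ch e0.
have e2 : 0 < e / 2 by exact: divr_gt0.
have K := (compact_near_coveringP _).1 (@closed_ball_compact r).
pose P (d : R) (xi : V) := forall eta, `|eta - xi| <= d -> forall t i j,
  `|jac (h t) eta i j - jac (h t) xi i j| <= e.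
have Knear : \forall d \near (0 : R)^'+, [set x : V | `|x| <= r] `<=` P d.
  apply: (K R (0 : R)^'+ P).
  move=> xi _.
  have : \forall eta \near xi, forall i j t, `|jac (h t) xi i j - jac (h t) eta i j| < e / 2.
    apply: (@filter_forall _ _ _ (nbhs xi)) => i; apply: (@filter_forall _ _ _ (nbhs xi)) => j.
    have [_ /(_ j)[_ [[_ eq] _]]] := Ch i.
    have := eq xi _ (entourage_ball R (PosNum e2)).
    apply: filterS => eta H t; have := H t I.
    by rewrite !mxE -ball_normE.
  move=> /nbhs_ballP[d /= d0 dP]; near=> z k => eta zk t i j.
  have zd : `|xi - z| < d / 2 by near: z; apply: cvgr_dist_lt; [exact: cvg_id|exact: divr_gt0].
  have kd : k < d / 2 by near: k; apply: nbhs_right_lt; exact: divr_gt0.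
  have h1 := dP z; have h2 := dP eta.
  have {}h1 : `|jac (h t) xi i j - jac (h t) z i j| < e / 2.
    by apply: h1; rewrite -ball_normE /ball_/=; lra.
  have {}h2 : `|jac (h t) xi i j - jac (h t) eta i j| < e / 2.
    apply: h2; rewrite -ball_normE /ball_/=.
    apply: le_lt_trans (ler_distD z _ _) _; rewrite (splitr d) (distrC z).
    by apply: ltrD; [exact: zd|exact: le_lt_trans zk kd].
  move: h1 h2; clear; rewrite !ltr_norml ler_norml => /andP[? ?] /andP[? ?].
  by apply/andP; split; lra.
near (0 : R)^'+ => d.
exists d; first by near: d; exact: nbhs_right_gt.
move=> t xi eta xir etad i j.
have H : [set x : V | `|x| <= r] `<=` P d by near: d.
exact: H.
Unshelve. all: by end_near. Qed.

Lemma L2fun_superposition h (x : H1 R n) : regular_field h ->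
  (fun t => h t (x t)) \in @L2fun R n.
Proof.
move=> rh; have [Ch h0 _] := rh; have [L L0 HL] := regular_lipschitz rh (2 * `|x|).
apply: (L2fun_leZ L0 _ (H1_L2 x)).
  by apply: vmeasurable_continuous; apply: continuous_superposition => //; exact: H1_continuous.
move=> t; have := HL t 0 (x t); rewrite h0 !subr0; apply.
  by rewrite normr0 mulr_ge0.
exact: H1_sup_le.
Qed.

End fields.

(** * Asymptotically periodic Hamiltonian fields *)

Section hamiltonian_field.
Variables (R : realType) (n : nat).
Local Notation V := 'cV[R]_n.
Local Notation e_ j := (delta_mx j 0 : V).
Variables (H : R -> V -> R -> R) (lam : R).

Local Notation h := (fun t xi => D_xi H t xi lam).

Lemma le_entry_norm m k (A : 'M[R]_(m, k)) i j : `|A i j| <= `|A|.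
Proof.
rewrite [leRHS]/Num.norm/= mx_normrE.
by apply/bigmax_geP; right; exists (i, j).
Qed.

Lemma asymptotic_jac (g : R -> V -> R -> V) (infty : set_system R) (r e : R) :
  Filter infty -> asymptotic H g lam infty -> 0 < e ->
  \forall s \near infty, forall xi, `|xi| <= r -> forall i j,
    `|jac (h s) xi i j - jac (fun eta => g s eta lam) xi i j| <= e.
Proof.
move=> FF [_ _ unif _] e0.
have bB : bounded_set [set xi : V | `|xi| <= r].
  by exists r; split=> [|M rM x /= /le_trans]; [exact: num_real|apply; exact: ltW].
have /= U := unif _ bB.
pose A := [set k : V -> 'M[R]_n | forall xi, `|xi| <= r -> ball (0 : 'M[R]_n) e (k xi)].
have : nbhs ((fun=> 0) : {uniform` [set xi : V | `|xi| <= r] -> 'M[R]_n}) A.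
  apply/uniform_nbhs; exists [set p | ball p.1 e p.2]; split=> //.
  exact: (entourage_ball _ (PosNum e0)).
move=> /U UA; apply: (@filterS _ infty FF _ _ _ UA) => s As xi xir i j.
have := As xi xir; rewrite -ball_normE /ball_/= sub0r normrN => /ltW/(le_trans _); apply.
have := le_entry_norm (D2_xi H s xi lam - jac (fun eta => g s eta lam) xi) i j.
by rewrite [X in `|X| <= _]mxE [X in `|_ + X| <= _]mxE.
Qed.

Hypothesis Ch : C1_field h.
Hypothesis h0 : forall t, D_xi H t 0 lam = 0.

(** Both fields vanish at 0, so closeness of their derivatives on a ball makes the
    fields themselves close there. *)
Lemma asymptotic_field (g : R -> V -> R -> V) (infty : set_system R) (r e : R) :
  Filter infty -> asymptotic H g lam infty -> 0 < e ->
  \forall s \near infty, forall xi, `|xi| <= r -> sq (h s xi - g s xi lam) <= e.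
Proof.
move=> FF asy e0; have [Cg g0 _ _] := asy.
pose c := Num.sqrt (e / (n%:R * (n%:R * `|r|) ^+ 2 + 1)).
have K0 : 0 <= n%:R * (n%:R * `|r|) ^+ 2 :> R by rewrite mulr_ge0 ?sqr_ge0.
have c0 : 0 < c by rewrite sqrtr_gt0 divr_gt0//; lra.
have := asymptotic_jac r FF asy c0; apply: filterS => s Hs xi xir.
have W i : (h s xi - g s xi lam) i 0 ^+ 2 <= c ^+ 2 * (n%:R * `|r|) ^+ 2.
  pose f z := h s z i 0 - g s z lam i 0.
  have D z j : is_derive z (e_ j) f
      (jac (h s) z i j - jac (fun eta => g s eta lam) z i j).
    have D1 : is_derive z (e_ j) (fun eta => h s eta i 0) (jac (h s) z i j).
      by split; [exact: (C1_field_derivable (h := h))|rewrite mxE].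
    have D2 : is_derive z (e_ j) (fun eta => g s eta lam i 0)
        (jac (fun eta => g s eta lam) z i j).
      split; last by rewrite mxE.
      exact: (@C1_field_derivable _ _ (fun t eta => g t eta lam)).
    exact: is_deriveB.
  have := @partial_mean_value _ _ f 0 xi c (fun z j => @ex_derive _ _ _ _ _ _ _ (D z j)).
  move=> /(_ _)/wrap[].
    move=> z j; rewrite !subr0 => zxi; have [_ ->] := D z j; apply: Hs.
    exact: le_trans xir.
  have -> : f 0 = 0 by rewrite /f h0 g0 subrr.
  rewrite subr0 => fxi.
  have -> : (h s xi - g s xi lam) i 0 = f xi by rewrite [LHS]mxE [X in _ + X]mxE.
  have S : \sum_j `|xi j 0 - (0 : V) j 0| <= n%:R * `|r|.
    apply: (@le_trans _ _ (n%:R * `|xi|)).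
      apply: le_trans (sum_coord_norm xi).
      by apply: ler_sum => j _; rewrite mxE subr0.
    by rewrite ler_wpM2l// (le_trans xir)// ler_norm.
  rewrite -exprMn -[leLHS]real_normK ?num_real// lerXn2r ?nnegrE//.
    by rewrite mulr_ge0// ?sqrtr_ge0// mulr_ge0.
  by apply: le_trans fxi _; rewrite ler_wpM2l ?sqrtr_ge0//.
apply: (@le_trans _ _ (\sum_(i < n) c ^+ 2 * (n%:R * `|r|) ^+ 2)).
  by apply: ler_sum => i _; exact: W.
rewrite sumr_const card_ord -[leLHS]mulr_natl mulrCA /c sqr_sqrtr.
  by rewrite mulrAC ler_pdivrMr; [rewrite ler_pM2l//; lra|lra].
by rewrite divr_ge0// ?ltW//; lra.
Qed.

Lemma periodic_int (g : R -> V -> R -> V) (T : R) (m : int) t xi :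
  (forall t xi, g (t + T) xi lam = g t xi lam) ->
  g (t + m%:~R * T) xi lam = g t xi lam.
Proof.
move=> gT; have N (k : nat) s : g (s + k%:R * T) xi lam = g s xi lam.
  elim: k => [|k IH]; first by rewrite mul0r addr0.
  by rewrite -natr1 mulrDl mul1r addrA gT IH.
case: m => k; first exact: N.
by rewrite -[LHS](N k.+1) NegzE mulrNz mulNr subrK.
Qed.

Lemma period_reduction (T t : R) : 0 < T ->
  exists m : int, 0 <= t - m%:~R * T <= T.
Proof.
move=> T0; exists (Num.floor (t / T)).
have /andP[f1 f2] := floor_itv (t / T).
rewrite subr_ge0 -ler_pdivlMr// f1 /= lerBlDr addrC -[X in _ <= _ + X]mul1r -mulrDl.
by rewrite -ler_pdivrMr// -[1]/(1%:~R) -intrD ltW.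
Qed.

Lemma asymptotic_regular (g : R -> V -> R -> V) (infty : set_system R) :
  asymptotic H g lam infty -> regular_field (fun t xi => g t xi lam).
Proof.
move=> [Cg g0 _ [T T0 gT]]; split=> // r.
have B i j := continuous_bounded 0 T r (@continuous_jac _ _ (fun t xi => g t xi lam) i j Cg).
have /choice[M HM] (p : 'I_n * 'I_n) : exists M : R, forall t xi, 0 <= t <= T ->
   `|xi| <= r -> `|jac (fun eta => g t eta lam) xi p.1 p.2| <= M.
  by have [M HM] := B p.1 p.2; exists M.
exists (\sum_p `|M p|) => t xi i j xir.
have [m tm] := period_reduction t T0.
have -> : (fun eta => g t eta lam) = (fun eta => g (t - m%:~R * T) eta lam).
  by apply/funext => eta; rewrite -(periodic_int m (t - _) eta gT) subrK.
apply: le_trans (HM (i, j) _ _ tm xir) _; apply: le_trans (ler_norm _) _.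
by rewrite (bigD1 (i, j))//= lerDl sumr_ge0.
Qed.

(** The derivative is bounded on balls: near plus and minus infinity because it is
    close to a periodic one, on the remaining bounded interval by compactness. *)
Lemma hamiltonian_regular (gp gm : R -> V -> R -> V) :
  asymptotic H gp lam (pinfty_nbhs R) -> asymptotic H gm lam (ninfty_nbhs R) ->
  regular_field h.
Proof.
move=> ap am; split=> // r.
have [Mp HMp] := (let: And3 _ _ b := asymptotic_regular ap in b) r.
have [Mm HMm] := (let: And3 _ _ b := asymptotic_regular am in b) r.
have [A [_ HA]] := asymptotic_jac r _ ap ltr01.
have [A' [_ HA']] := asymptotic_jac r _ am ltr01.
have B i j := continuous_bounded A' A r (@continuous_jac _ _ h i j Ch).
have /choice[M HM] (p : 'I_n * 'I_n) : exists M : R, forall t xi, A' <= t <= A ->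
   `|xi| <= r -> `|jac (h t) xi p.1 p.2| <= M.
  by have [M HM] := B p.1 p.2; exists M.
exists (`|Mp| + `|Mm| + 1 + \sum_p `|M p|) => t xi i j xir.
have S0 : 0 <= \sum_p `|M p| by rewrite sumr_ge0.
have p0 := normr_ge0 Mp; have m0 := normr_ge0 Mm.
have [tA|At] := leP t A; last first.
  have h1 := HA t At xi xir i j; have h2 := HMp t xi i j xir.
  have h3 := ler_norm Mp.
  have h4 := ler_distD (jac (fun eta => gp t eta lam) xi i j) (jac (h t) xi i j) 0.
  by rewrite !subr0 in h4; lra.
have [A't|tA'] := leP A' t; last first.
  have h1 := HA' t tA' xi xir i j; have h2 := HMm t xi i j xir.
  have h3 := ler_norm Mm.
  have h4 := ler_distD (jac (fun eta => gm t eta lam) xi i j) (jac (h t) xi i j) 0.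
  by rewrite !subr0 in h4; lra.
have tAA : A' <= t <= A by rewrite A't.
apply: le_trans (HM (i, j) _ _ tAA xir) _; apply: le_trans (ler_norm _) _.
apply: (@le_trans _ _ (\sum_p `|M p|)); last lra.
by rewrite (bigD1 (i, j))//= lerDl sumr_ge0.
Qed.

Lemma D2_xi_sym t xi : C2 (fun eta => H t eta lam) ->
  (D2_xi H t xi lam)^T = D2_xi H t xi lam.
Proof.
move=> [df _ cj]; apply/matrixP => i j.
pose f eta := H t eta lam.
have E k : (fun eta => D_xi H t eta lam k 0) = (fun y => 'D_(e_ k) f y).
  by apply/funext => eta; rewrite mxE.
have cjac k l : {for xi, continuous (fun z => 'D_(e_ l) (fun y => 'D_(e_ k) f y) z)}.
  have -> : (fun z => 'D_(e_ l) (fun y => 'D_(e_ k) f y) z) =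
      (fun A : 'M[R]_n => A k l) \o jac (grad f).
    apply/funext => z; rewrite /= [RHS]mxE; congr ('D_ _ _ _).
    by apply/funext => y; rewrite [RHS]mxE.
  by apply: continuous_comp; [exact: cj|exact: coord_continuous].
have D2E k l : D2_xi H t xi lam k l = 'D_(e_ l) (fun y => 'D_(e_ k) f y) xi.
  by rewrite /D2_xi [LHS]mxE E.
rewrite [LHS]mxE (D2E j i) (D2E i j).
have df' z k : derivable f z (e_ k) by exact: diff_derivable.
have ddf' z k l : derivable (fun y => 'D_(e_ k) f y) z (e_ l).
  by rewrite -E; exact: (C1_field_derivable (h := h)).
exact: (schwarz df' ddf' (cjac j i) (cjac i j)).
Qed.

End hamiltonian_field.

(** * Limits along ultrafilters *)

Section ultralimit.
Variables (R : realType) (n : nat).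
Local Notation V := 'cV[R]_n.
Local Notation mu := (@lebesgue_measure R).
Variables (I : Type) (U : set_system I).
Hypothesis UU : UltraFilter U.

Let UP : ProperFilter U := ultra_proper.
#[local] Existing Instance UP.

Lemma ultra_dichotomy (P : I -> Prop) : ~ (\forall i \near U, P i) ->
  \forall i \near U, ~ P i.
Proof. by move=> nP; have [//|] := in_ultra_setVsetC [set i | P i] UU. Qed.

Lemma ultra_compact_cvg (Y : normedModType R) (f : I -> Y) (K : set Y) : compact K ->
  (\forall i \near U, K (f i)) ->
  exists2 y, K y & forall e : R, 0 < e -> \forall i \near U, `|f i - y| <= e.
Proof.
move=> cK fK; have UfP : ProperFilter (f @ U) by exact: fmap_proper_filter.
have [y [Ky fy]] := cK (f @ U) UfP fK.
exists y => // e e0; apply: contrapT => /ultra_dichotomy ne.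
have := fy [set z | ~ (`|z - y| <= e)] (ball y e) ne (nbhsx_ballx _ _ e0).
move=> [z [/= nz]]; rewrite -ball_normE /ball_/= distrC => /ltW; exact: nz.
Qed.

Lemma ultra_bounded_cvg (u : I -> R) (C : R) : (\forall i \near U, `|u i| <= C) ->
  exists l : R, forall e : R, 0 < e -> \forall i \near U, `|u i - l| <= e.
Proof.
move=> uC; have [|l _ ul] := @ultra_compact_cvg _ u _ (@segment_compact R (- C) C).
  by apply: filterS uC => i; rewrite /= in_itv/= ler_norml.
by exists l.
Qed.

Variables (z : I -> H1 R n) (C : R).
Hypothesis zC : \forall i \near U, `|z i| <= C.

Lemma H1_ultra_pointwise : exists x : R -> V, forall t (e : R), 0 < e ->
  \forall i \near U, `|z i t - x t| <= e.
Proof.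
have L t k : exists l : R, forall e : R, 0 < e ->
    \forall i \near U, `|z i t k 0 - l| <= e.
  apply: (@ultra_bounded_cvg _ (2 * C)); apply: filterS zC => i zi.
  apply: le_trans (le_coord_norm _ _) _; apply: le_trans (H1_sup_le _ _) _.
  by rewrite ler_pM2l.
have /choice[l Hl] (p : R * 'I_n) : exists l : R, forall e : R, 0 < e ->
    \forall i \near U, `|z i p.1 p.2 0 - l| <= e by exact: L.
exists (fun t => \col_k l (t, k)) => t e e0.
have : \forall i \near U, forall k, `|z i t k 0 - l (t, k)| <= e.
  by apply: (@filter_forall _ _ _ U) => k; exact: (Hl (t, k)).
apply: filterS => i H; apply: norm_le_coord; first exact: ltW.
by move=> k; rewrite !mxE.
Qed.

(** Functions bounded in H^1 are equi-Hoelder of exponent 1/2, which improves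
    pointwise convergence to locally uniform convergence. *)
Lemma H1_ultra_limit : exists x : R -> V,
  [/\ continuous x, x \in @L2fun R n, (forall t, `|x t| <= 2 * C + 1) &
      forall A e : R, 0 < e -> \forall i \near U, forall t, `|t| <= A ->
        `|z i t - x t| <= e].
Proof.
have [x zx] := H1_ultra_pointwise.
have C0 : 0 <= C.
  by have [i zi] := filter_ex zC; exact: le_trans zi.
have holder s t : s <= t -> `|x t - x s| <= C * Num.sqrt (t - s).
  move=> st; apply/ler_addgt0Pl => e e0.
  have e2 : 0 < e / 2 by exact: divr_gt0.
  have [i [[zi zs] zt]] := filter_ex (filterI (filterI zC (zx s _ e2)) (zx t _ e2)).
  have h1 := H1_hoelder (z i) st.
  have h2 : `|z i| * Num.sqrt (t - s) <= C * Num.sqrt (t - s).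
    by rewrite ler_wpM2r// sqrtr_ge0.
  have h3 : `|x t - x s| <= `|z i t - x t| + (`|z i t - z i s| + `|z i s - x s|).
    apply: le_trans (ler_distD (z i t) _ _) _; rewrite (distrC (x t)).
    by rewrite lerD2l; exact: ler_distD.
  lra.
have holder' s t : `|x t - x s| <= C * Num.sqrt `|t - s|.
  have [st|ts] := leP s t; first by rewrite ger0_norm ?subr_ge0//; exact: holder.
  have -> : `|t - s| = s - t by rewrite distrC ger0_norm// subr_ge0 ltW.
  by rewrite distrC; apply: holder; exact: ltW.
have zholder i s t : `|z i| <= C -> `|z i t - z i s| <= C * Num.sqrt `|t - s|.
  move=> zi; apply: (@le_trans _ _ (`|z i| * Num.sqrt `|t - s|)); last first.
    by rewrite ler_wpM2r// sqrtr_ge0.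
  have [st|ts] := leP s t; first by rewrite ger0_norm ?subr_ge0//; exact: H1_hoelder.
  have -> : `|t - s| = s - t by rewrite distrC ger0_norm// subr_ge0 ltW.
  by rewrite distrC; apply: H1_hoelder; exact: ltW.
have small (s e : R) : 0 < e -> \forall t \near s, C * Num.sqrt `|t - s| <= e.
  move=> e0; have d0 : 0 < (e / (C + 1)) ^+ 2 by apply: exprn_gt0; apply: divr_gt0 => //; lra.
  apply/nbhs_ballP; exists ((e / (C + 1)) ^+ 2) => //= t.
  rewrite -ball_normE /ball_/= distrC => /ltW/ler_wsqrtr.
  rewrite sqrtr_sqr (ger0_norm (_ : 0 <= e / (C + 1))); last by rewrite divr_ge0//; lra.
  rewrite ler_pdivlMr; last lra.
  have := sqrtr_ge0 `|t - s|; nra.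
have cx : continuous x.
  move=> s; apply/cvgrPdist_le => e e0.
  by have := small s e e0; apply: filterS => t; rewrite distrC; exact: le_trans.
have loc A e : 0 < e -> \forall i \near U, forall t, `|t| <= A -> `|z i t - x t| <= e.
  move=> e0; have K := (compact_near_coveringP _).1 (@segment_compact R (- A) A).
  have e3 : 0 < e / 3 by exact: divr_gt0.
  have : \forall i \near U, `[- A, A]%classic `<=` (fun t => `|z i t - x t| <= e).
    apply: (K I U (fun i t => `|z i t - x t| <= e)) => s _.
    exists ([set t | C * Num.sqrt `|t - s| <= e / 3],
            [set i | `|z i| <= C /\ `|z i s - x s| <= e / 3]).
      split; first exact: small.
      by apply: filterI => //; exact: zx.
    move=> [t i] /= [ts [zi zs]].
    have h1 := zholder i s t zi; have h2 := holder' s t.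
    have h3 : `|z i t - x t| <= `|z i t - z i s| + (`|z i s - x s| + `|x s - x t|).
      by apply: le_trans (ler_distD (z i s) _ _) _; rewrite lerD2l; exact: ler_distD.
    by rewrite (distrC (x s)) in h3; lra.
  by apply: filterS => i H t tA; apply: H; rewrite /= in_itv/= -ler_norml.
have mx : vmeasurable x by exact: vmeasurable_continuous.
exists x; split => //.
- apply/L2funP; split => //.
  apply: (@le_lt_trans _ _ (2 * C ^+ 2 + 1)%:E); last exact: ltry.
  apply: energy_le_local => // A A0.
  pose d := Num.sqrt (1 / (2 * n%:R * (2 * A) + 1)).
  have N0 : 0 <= 2 * n%:R * (2 * A) by rewrite !mulr_ge0.
  have d0 : 0 < d by rewrite sqrtr_gt0 divr_gt0//; lra.
  have [i [zi Hi]] := filter_ex (filterI zC (loc A d d0)).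
  have lz := H1_L2 (z i); have mz := L2fun_vmeasurable lz.
  have mzx := vmeasurableB mz mx.
  apply: (@le_trans _ _ (2%:E * energy `[(- A)%R, A] (z i) +
      2%:E * energy `[(- A)%R, A] (z i \- x)%R)%E).
    apply: energy_le_comb => // t _.
    rewrite -[x t](subKr (z i t)) -[_ - x t]/((z i \- x) t); exact: sqB.
  rewrite [leRHS]EFinD; apply: leeD.
    rewrite [leRHS]EFinM; apply: lee_wpmul2l => //; apply: le_trans (energy_le_L2norm _ lz) _ => //.
    rewrite lee_fin lerXn2r ?nnegrE ?L2norm_ge0//; apply: le_trans zi.
    exact: L2norm_le_H1norm.
  apply: (@le_trans _ _ (2 * (n%:R * d ^+ 2 * (A - - A)))%:E); last first.
    rewrite lee_fin /d sqr_sqrtr ?divr_ge0//; last lra.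
    rewrite div1r [leLHS](_ : _ = (2 * n%:R * (2 * A)) / (2 * n%:R * (2 * A) + 1)).
      by rewrite ler_pdivrMr; lra.
    by ring.
  rewrite [leRHS]EFinM; apply: lee_wpmul2l => //; apply: energy_le_cst => //; first lra.
  by move=> t tA; apply: sq_le_norm; apply: Hi; rewrite ler_norml.
- move=> t; have [i [zi zt]] := filter_ex (filterI zC (zx t _ ltr01)).
  have := H1_sup_le (z i) t; have := ler_distD (z i t) (x t) 0.
  by rewrite !subr0 (distrC (x t)); lra.
Qed.

Variable J : 'M[R]_n.
Hypothesis JJ : J *m J = - 1%:M.
Hypothesis JTJ : J^T *m J = 1%:M.

Variables (p : I -> R -> V) (y : R -> V) (h : I -> R -> V -> V) (hoo : R -> V -> V).
Hypothesis lp : forall i, p i \in @L2fun R n.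
Hypothesis ly : y \in @L2fun R n.
Hypothesis rh : regular_field hoo.
Hypothesis ch : forall i, continuous (fun t => h i t (z i t)).
Hypothesis zE : forall i, {ae mu, forall t, J *m H1deriv (z i) t = p i t + h i t (z i t)}.
Hypothesis py : forall A e : R, 0 < e ->
  \forall i \near U, (energy `[(- A)%R, A] (p i \- y)%R <= e%:E)%E.
Hypothesis hh : forall A r e : R, 0 < e ->
  \forall i \near U, forall t xi, `|t| <= A -> `|xi| <= r ->
    sq (h i t xi - hoo t xi) <= e.

(** Compactness without extracting subsequences: along an ultrafilter bounded
    families in H^1 converge locally uniformly; the equation then makes the
    derivatives converge in L^2 of bounded intervals. *)
Lemma H1_ultra_equation : exists x : H1 R n,
  {ae mu, forall t, J *m H1deriv x t = y t + hoo t (x t)} /\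
  forall A e : R, 0 < e -> \forall i \near U, forall t, `|t| <= A ->
    `|z i t - x t| <= e.
Proof.
have [x [cx lx xC loc]] := H1_ultra_limit.
have [Ch h0 _] := rh.
have [L L0 HL] := regular_lipschitz rh (2 * C + 1).
have F : Filter (nbhs (almost_everywhere mu)) := ae_filter_ringOfSetsType mu.
have chx := continuous_superposition Ch cx.
have C0 : 0 <= 2 * C + 1 by apply: le_trans (xC 0).
have lhx : (fun t => hoo t (x t)) \in @L2fun R n.
  apply: (L2fun_leZ L0 _ lx); first exact: vmeasurable_continuous.
  by move=> t; have := HL t 0 (x t); rewrite h0 !subr0; apply => //; rewrite normr0.
have lJ (f : R -> V) : f \in @L2fun R n -> (fun t => - (J *m f t)) \in @L2fun R n.
  by move=> lf; have := L2fun_mulmx (- J) lf; under eq_fun do rewrite mulNmx.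
pose w t := y t + hoo t (x t).
have lw : w \in @L2fun R n by exact: rpredD.
pose v t := - (J *m w t).
have lv : v \in @L2fun R n by exact: lJ.
have wd : weak_derivative x v.
  apply: weak_derivative_closed => // A e A0 e0.
  have e20 : 0 < e ^+ 2 by exact: exprn_gt0.
  (* P dominates the length of [-A, A] and its n-fold; q makes the contributions
     of h i - hoo and of z i - x add up to at most e ^ 2. *)
  pose P := (n%:R + 1) * (2 * A + 1).
  have n0 : 0 <= n%:R :> R by [].
  have nP : n%:R * (2 * A) <= P.
    by rewrite /P; nra.
  have P0 : 0 < P by rewrite /P mulr_gt0//; lra.
  have AP : 2 * A <= P by rewrite /P; nra.
  pose q := e ^+ 2 / (16 * (L + 1) * P).
  have K0 : 0 < 16 * (L + 1) * P by rewrite !mulr_gt0//; lra.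
  have q0 : 0 < q by exact: divr_gt0.
  have qE : q * (16 * (L + 1) * P) = e ^+ 2 by rewrite /q divfK// gt_eqF.
  have qP : 0 <= q * P by rewrite mulr_ge0// ltW.
  have LqP : 0 <= L * (q * P) by rewrite mulr_ge0.
  have qn : q * (n%:R * (2 * A)) <= q * P by rewrite ler_pM2l.
  have Lqn : L * (q * (n%:R * (2 * A))) <= L * (q * P) by rewrite ler_wpM2l.
  have qA : q * (2 * A) <= q * P by rewrite ler_pM2l.
  have d0 : 0 < Num.sqrt q by rewrite sqrtr_gt0.
  have e8 : 0 < e ^+ 2 / 8 by exact: divr_gt0.
  have [i [[[zi Hz] Hp] Hh]] := filter_ex (filterI (filterI (filterI zC (loc A _ d0))
    (py A e8)) (hh A (2 * C + 1) q0)).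
  have lz := H1_L2 (z i); have lz' := L2_mem (H1deriv (z i)).
  have AA : - A <= A by lra.
  exists (z i), (H1deriv (z i)); split => //; first exact: H1_weak_derivative.
    apply: (@le_trans _ _ (n%:R * q * (A - - A))%:E).
      apply: energy_le_cst => //; first by apply: vmeasurableB; exact: L2fun_vmeasurable.
      move=> t tA; rewrite -(sqr_sqrtr (ltW q0)); apply: sq_le_norm.
      by apply: Hz; rewrite ler_norml.
    by rewrite lee_fin; lra.
  pose hz t := h i t (z i t) - hoo t (x t).
  have mhz : vmeasurable hz.
    by apply: vmeasurableB; apply: vmeasurable_continuous.
  have mpy : vmeasurable (p i \- y) by apply: vmeasurableB; exact: L2fun_vmeasurable.
  have mJ (f : R -> V) : vmeasurable f -> vmeasurable (fun t => - (J *m f t)).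
    move=> mf; have := @vmeasurable_mulmx _ _ (cst (- J)) f _ mf.
    under eq_fun do rewrite mulNmx; apply => k l; exact: measurable_cst.
  have -> : energy `[(- A)%R, A] (H1deriv (z i) \- v)%R =
            energy `[(- A)%R, A] (fun t => - (J *m ((p i t - y t) + hz t))).
    apply: energy_ae => //.
    - by apply: vmeasurableB; exact: L2fun_vmeasurable.
    - by apply: mJ; exact: vmeasurableD.
    apply: filterS (zE i) => t Et _; rewrite /=.
    have -> : H1deriv (z i) t = - (J *m (J *m H1deriv (z i) t)).
      by rewrite mulmxA JJ mulNmx mul1mx opprK.
    rewrite Et /v opprK.
    have -> : p i t - y t + hz t = (p i t + h i t (z i t)) - w t.
      by rewrite /hz /w addrACA -opprD.
    by rewrite mulmxBr opprB addrC.
  apply: (@le_trans _ _ (2%:E * energy `[(- A)%R, A] (p i \- y)%R +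
                         2%:E * energy `[(- A)%R, A] hz)%E).
    apply: energy_le_comb => //; first by apply: mJ; exact: vmeasurableD.
    by move=> t _; rewrite sqN sq_orthogonal//; exact: sqD.
  have E1 : (energy `[(- A)%R, A] hz <= ((2 * q + 2 * (L * (n%:R * q))) * (A - - A))%:E)%E.
    apply: energy_le_cst => // t tA.
    have {}tA : `|t| <= A by rewrite ler_norml.
    have -> : hz t = (h i t (z i t) - hoo t (z i t)) + (hoo t (z i t) - hoo t (x t)).
      by rewrite addrA subrK.
    apply: le_trans (sqD _ _) _; apply: lerD; rewrite ler_pM2l//.
      apply: Hh => //; apply: le_trans (H1_sup_le _ _) _.
      by apply: (@le_trans _ _ (2 * C)); [rewrite ler_pM2l|lra].
    apply: (@le_trans _ _ (L * sq (z i t - x t))).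
      apply: HL => //; apply: le_trans (H1_sup_le _ _) _.
      by apply: (@le_trans _ _ (2 * C)); [rewrite ler_pM2l|lra].
    rewrite ler_wpM2l// -(sqr_sqrtr (ltW q0)); apply: sq_le_norm; exact: Hz.
  apply: le_trans (leeD (lee_wpmul2l _ Hp) (lee_wpmul2l _ E1)) _ => //.
  rewrite -!EFinM -EFinD lee_fin; lra.
have X1 : (x, L2class v) \in @H1pred R n.
  apply/asboolP; split => //=; apply: (weak_derivative_ae (v := v)) => //.
    exact: L2_mem.
  by apply: filterS (L2classE lv) => t /[apply] ->.
exists (MkH1 X1); split; last by move=> A e e0; exact: (loc A e e0).
apply: filterS (L2classE lv) => t Et; rewrite [H1deriv _ t]Et//.
by rewrite /v mulmxN mulmxA JJ mulNmx opprK mul1mx.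
Qed.


End ultralimit.

(** * Symmetric operators of index zero *)

Section L2_embedding.
Variables (R : realType) (n : nat).
Local Notation V := 'cV[R]_n.
Local Notation mu := (@lebesgue_measure R).
Let aeF : Filter (nbhs (almost_everywhere mu)) := ae_filter_ringOfSetsType mu.
#[local] Existing Instance aeF.

Lemma L2class_eq (f g : R -> V) : f \in @L2fun R n -> g \in @L2fun R n ->
  f = g %[ae mu] -> L2class f = L2class g.
Proof.
move=> lf lg fg; apply: L2_ae_eq.
have := L2classE lf; have := L2classE lg; move: fg.
by apply: filterS3 => t fg gE fE _; rewrite fE// fg// gE.
Qed.

Lemma L2classP (f g : R -> V) a : f \in @L2fun R n -> g \in @L2fun R n ->
  L2class (a *: f + g) = a *: L2class f + L2class g.
Proof.
move=> lf lg; have lfg : a *: f + g \in @L2fun R n by rewrite rpredD// rpredZ.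
apply: L2_ae_eq.
have h1 := L2classE lfg; have h2 := L2classE lf; have h3 := L2classE lg.
have h4 := L2D_ae (a *: L2class f) (L2class g); have h5 := L2Z_ae a (L2class f).
apply: filterS3 (filterI h1 h2) (filterI h3 h4) h5 => t [e1 e2] [e3 e4] e5 It.
by rewrite e1// e4//= e5//= e2// e3.
Qed.

Lemma L2class_norm (f : R -> V) : f \in @L2fun R n -> `|L2class f| = L2norm f.
Proof.
by move=> lf; rewrite normL2E; apply: eq_L2norm (L2classE lf) => //; exact: L2_mem.
Qed.

Lemma L2class_L2fun (v : L2 R n) : L2class v = v.
Proof. by apply: L2_ae_eq; apply: L2classE; exact: L2_mem. Qed.

Lemma ipZr (f g : R -> V) a : f \in @L2fun R n -> g \in @L2fun R n ->
  ip f (a *: g) = a * ip f g.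
Proof.
move=> lf lg; rewrite /ip -RintegralZl//; last exact: integrable_dot.
by apply: eq_Rintegral => t _; rewrite dotZr.
Qed.

Lemma ip_L2class (f g : R -> V) : f \in @L2fun R n -> g \in @L2fun R n ->
  ip f (L2class g) = ip f g.
Proof. by move=> lf lg; apply: ip_ae => //; [exact: L2_mem|exact: L2classE]. Qed.

Lemma ip_L2P (f : R -> V) (v w : L2 R n) a : f \in @L2fun R n ->
  ip f (a *: v + w : L2 R n) = a * ip f v + ip f w.
Proof.
move=> lf; rewrite -ip_linear//; try exact: L2_mem.
apply: ip_ae => //; [exact: L2_mem|by rewrite rpredD ?rpredZ ?L2_mem|].
apply: filterS2 (L2D_ae (a *: v) w) (L2Z_ae a v) => t e1 e2 It.
by rewrite e1//= e2.
Qed.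

Lemma ip_L2_0 (f : R -> V) : f \in @L2fun R n -> ip f (0 : L2 R n) = 0.
Proof.
move=> lf; have := ip_L2P 0 0 1 lf.
by rewrite scale1r addr0 mul1r => /eqP; rewrite -subr_eq0 opprD addNKr oppr_eq0 => /eqP.
Qed.

Lemma ip_L2_sum (f : R -> V) (I : finType) (a : I -> R) (v : I -> L2 R n) (w : L2 R n) :
  f \in @L2fun R n ->
  ip f (\sum_i a i *: v i + w : L2 R n) = \sum_i a i * ip f (v i) + ip f w.
Proof.
move=> lf; elim/big_rec2 : _ => [|i r u _ IH]; first by rewrite !add0r.
by rewrite -addrA ip_L2P// IH addrA.
Qed.

Definition H1class (x : H1 R n) : L2 R n := L2class x.

Lemma H1classP a x y : H1class (a *: x + y) = a *: H1class x + H1class y.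
Proof. exact: L2classP (H1_L2 x) (H1_L2 y). Qed.

Lemma H1class0 : H1class 0 = 0.
Proof. by have := H1classP (-1) 0 0; rewrite scaler0 addr0 scaleN1r addNr. Qed.

Lemma H1class_sum (I : finType) (a : I -> R) (x : I -> H1 R n) :
  H1class (\sum_i a i *: x i) = \sum_i a i *: H1class (x i).
Proof.
elim/big_rec2 : _ => [|i r u _ IH]; first exact: H1class0.
by rewrite H1classP IH.
Qed.

End L2_embedding.

Section linear_operator.
Variables (R : realType) (n : nat).
Local Notation V := 'cV[R]_n.
Local Notation mu := (@lebesgue_measure R).
Let aeF : Filter (nbhs (almost_everywhere mu)) := ae_filter_ringOfSetsType mu.
#[local] Existing Instance aeF.

Lemma sq_mulmx_le (A : 'M[R]_n) (a : V) (M : R) : (forall i j, `|A i j| <= M) ->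
  sq (A *m a) <= n%:R * (M * n%:R) ^+ 2 * sq a.
Proof.
move=> AM; have W i : (A *m a) i 0 ^+ 2 <= (M * n%:R) ^+ 2 * sq a.
  have M0 : 0 <= M by exact: le_trans (AM i i).
  have : `|(A *m a) i 0| <= M * n%:R * `|a|.
    rewrite mxE; apply: le_trans (ler_norm_sum _ _ _) _; rewrite -mulrA.
    apply: (@le_trans _ _ (\sum_j M * `|a j 0|)).
      by apply: ler_sum => j _; rewrite normrM ler_wpM2r.
    by rewrite -mulr_sumr ler_wpM2l// sum_coord_norm.
  move=> Aa; rewrite -real_normK ?num_real//.
  apply: (@le_trans _ _ ((M * n%:R * `|a|) ^+ 2)).
    by rewrite lerXn2r ?nnegrE// mulr_ge0// mulr_ge0.
  by rewrite exprMn ler_wpM2l ?sqr_ge0// norm_sq.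
apply: (@le_trans _ _ (\sum_(i < n) (M * n%:R) ^+ 2 * sq a)).
  by apply: ler_sum => i _; exact: W.
by rewrite sumr_const card_ord -[leLHS]mulr_natl [leLHS]mulrA.
Qed.

Variables (J : 'M[R]_n) (B : R -> 'M[R]_n) (K : R).
Hypothesis JT : J^T = - J.
Hypothesis JTJ : J^T *m J = 1%:M.
Hypothesis mB : forall i j, measurable_fun setT (fun t => B t i j).
Hypothesis K0 : 0 <= K.
Hypothesis BK : forall t a, sq (B t *m a) <= K * sq a.
Hypothesis BT : forall t, (B t)^T = B t.

Definition Tfun (u : H1 R n) : R -> V := fun t => J *m H1deriv u t - B t *m u t.
Definition Top (u : H1 R n) : L2 R n := L2class (Tfun u).

Lemma L2fun_B (u : R -> V) : u \in @L2fun R n -> (fun t => B t *m u t) \in @L2fun R n.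
Proof.
move=> lu; apply: (L2fun_leZ K0 _ lu) => //.
by apply: vmeasurable_mulmx => //; exact: L2fun_vmeasurable.
Qed.

Lemma L2fun_Tfun u : Tfun u \in @L2fun R n.
Proof.
apply: L2funB; first exact: L2fun_mulmx (L2_mem _).
by apply: L2fun_B; exact: H1_L2.
Qed.

Lemma Top_linear : linear Top.
Proof.
move=> a u w; rewrite /Top -L2classP ?L2fun_Tfun//.
apply: L2class_eq; [exact: L2fun_Tfun|by rewrite rpredD ?rpredZ ?L2fun_Tfun|].
apply: filterS2 (L2D_ae (a *: H1deriv u) (H1deriv w)) (L2Z_ae a (H1deriv u)) => t e1 e2 It.
rewrite /Tfun !fctE.
have -> : H1deriv (a *: u + w) t = a *: H1deriv u t + H1deriv w t.
  by rewrite -[RHS]/((a *: H1deriv u t) + _) [LHS]e1//= e2.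
have -> : (a *: u + w : H1 R n) t = a *: u t + w t by [].
by rewrite !mulmxDr -!scalemxAr scalerBr opprD addrACA.
Qed.

(** Symmetry of T: the matrices B t are symmetric and J d/dt is. *)
Lemma ip_T_sym (u w : H1 R n) : ip (Tfun u) w = ip u (Tfun w).
Proof.
have lu := H1_L2 u; have lw := H1_L2 w.
have lJu := L2fun_mulmx J (L2_mem (H1deriv u)).
have lJw := L2fun_mulmx J (L2_mem (H1deriv w)).
have lBu := L2fun_B lu; have lBw := L2fun_B lw.
have E (x : H1 R n) f : f \in @L2fun R n ->
    ip f (Tfun x) = ip f (fun t => J *m H1deriv x t) - ip f (fun t => B t *m x t).
  move=> lf; have lJx := L2fun_mulmx J (L2_mem (H1deriv x)).
  have lBx := L2fun_B (H1_L2 x).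
  have h := ip_linear (-1) lf lBx lJx; rewrite mulN1r in h.
  rewrite [RHS]addrC -h.
  by apply: eq_Rintegral => t _; rewrite /Tfun !fctE scaleN1r addrC.
rewrite ipC !E// ipC ip_J_sym//; congr (_ - _); rewrite ipC.
by apply: eq_Rintegral => t _; rewrite dot_mulmx BT.
Qed.

(** The equation J u' = T u + B u controls the derivative, J being orthogonal. *)
Lemma energy_deriv_le (u : H1 R n) :
  (energy setT (H1deriv u) <= 2%:E * energy setT (Tfun u) + (2 * K)%:E * energy setT u)%E.
Proof.
apply: energy_le_comb => //; first by rewrite mulr_ge0.
- exact: L2_vmeasurable.
- by apply: L2fun_vmeasurable; exact: L2fun_Tfun.
- by apply: L2fun_vmeasurable; exact: H1_L2.
move=> t _; rewrite -(sq_orthogonal _ JTJ).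
have -> : J *m H1deriv u t = Tfun u t + B t *m u t by rewrite subrK.
by apply: le_trans (sqD _ _) _; rewrite lerD2l -mulrA ler_pM2l.
Qed.

Lemma ker_T_eq0 (p : H1 R n) : Top p = 0 -> L2norm p = 0 -> p = 0.
Proof.
move=> Tp p0; apply/eqP; rewrite -normr_eq0 normH1E /H1norm p0 expr0n add0r sqrtr_sqr.
rewrite normr_id normL2E; apply/eqP.
have := energy_deriv_le p; rewrite -!L2norm_energy ?L2_mem ?H1_L2 ?L2fun_Tfun//.
have -> : L2norm (Tfun p) = 0 by rewrite -L2class_norm ?L2fun_Tfun// -/(Top p) Tp normr0.
rewrite p0 -!EFinM -EFinD lee_fin expr0n/= !mulr0 addr0 => h.
by apply/eqP; rewrite -sqrf_eq0 eq_le h sqr_ge0.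
Qed.

Variable d : nat.
Hypothesis dimK : has_dim [set x | Top x = 0] d.
Hypothesis codimR : has_codim (range Top) d.

Lemma range_T_linear a v w : range Top v -> range Top w -> range Top (a *: v + w).
Proof. by move=> [x _ <-] [y _ <-]; exists (a *: x + y) => //; rewrite Top_linear. Qed.

Lemma Top0 : Top 0 = 0.
Proof. by have := Top_linear (-1) 0 0; rewrite scaler0 addr0 scaleN1r addNr. Qed.

Lemma range_T_sum (I : finType) (a : I -> R) (v : I -> L2 R n) :
  (forall i, range Top (v i)) -> range Top (\sum_i a i *: v i).
Proof.
move=> rv; elim/big_rec : _ => [|i v' _ rv']; first by exists 0; rewrite ?Top0.
exact: range_T_linear.
Qed.

(** By symmetry the kernel meets the range trivially; since the index is zero,
    kernel and range together fill L^2. *)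
Lemma ker_range_decomposition : exists e : 'I_d -> H1 R n,
  forall v : L2 R n, exists (a : 'I_d -> R) (w : H1 R n),
    v = \sum_k a k *: H1class (e k) + Top w.
Proof.
have [e [eK eB]] := dimK; have [f fC] := codimR.
exists e => v.
have /choice[C HC] y : exists c : 'I_d -> R, range Top (y - \sum_i c i *: f i).
  by have [c [rc _]] := fC y; exists c.
have Cuniq y c : range Top (y - \sum_i c i *: f i) -> c = C y.
  by have [c' [_ u]] := fC y => rc; rewrite -(u _ rc) -(u _ (HC y)).
(* M expresses the kernel in the basis f of the quotient by the range. *)
pose M : 'M[R]_d := \matrix_(k, i) C (H1class (e k)) i.
have rM (a : 'rV[R]_d) : range Top (\sum_k a 0 k *: H1class (e k) -
    \sum_i (a *m M) 0 i *: f i).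
  have -> : \sum_i (a *m M) 0 i *: f i = \sum_k a 0 k *: \sum_i C (H1class (e k)) i *: f i.
    under eq_bigr do rewrite mxE scaler_suml.
    rewrite exchange_big/=; apply: eq_bigr => k _; rewrite scaler_sumr.
    by apply: eq_bigr => i _; rewrite scalerA mxE.
  rewrite -sumrB; under eq_bigr do rewrite -scalerBr.
  by apply: range_T_sum => k; exact: HC.
have Munit : M \in unitmx.
  rewrite -row_free_unit -kermx_eq0; apply/rowV0P => a /sub_kermxP aM.
  have [w _ Tw] := rM a; rewrite aM in Tw.
  have {}Tw : Top w = \sum_k a 0 k *: H1class (e k).
    by rewrite Tw [X in _ - X]big1 ?subr0// => i _; rewrite mxE scale0r.
  pose p := \sum_k a 0 k *: e k.
  have Tp : Top p = 0 by exact: eK.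
  have p0 : p = 0.
    apply: ker_T_eq0 => //; apply/eqP; rewrite -sqrf_eq0 -ip_self ?H1_L2//.
    rewrite -ip_L2class ?H1_L2// -/(H1class p) H1class_sum -Tw ip_L2class ?H1_L2 ?L2fun_Tfun//.
    rewrite -ip_T_sym ipC -ip_L2class ?H1_L2 ?L2fun_Tfun// -/(Top p) Tp.
    by rewrite ip_L2_0 ?H1_L2.
  have [c [_ cu]] := eB 0 Top0.
  apply/rowP => k; rewrite mxE.
  have h1 := cu _ (esym p0).
  have h2 : c = fun=> 0 by apply: cu; rewrite big1// => i _; rewrite scale0r.
  by have := congr1 (fun c' => c' k) h1; rewrite h2.
pose c : 'rV[R]_d := \row_i C v i.
pose a := c *m invmx M.
have aM : a *m M = c by rewrite /a mulmxKV.
have [w1 _ Tw1] := HC v; have [w2 _ Tw2] := rM a.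
exists (a 0), (w1 - w2).
have -> : Top (w1 - w2) = Top w1 - Top w2.
  by rewrite -[w1 - w2]addrC -scaleN1r Top_linear scaleN1r addrC.
rewrite Tw1 Tw2 aM.
have -> : \sum_i c 0 i *: f i = \sum_i C v i *: f i.
  by apply: eq_bigr => i _; rewrite mxE.
set S1 := \sum_k _; set S2 := \sum_i _.
by rewrite opprB [v - S2 + _]addrA subrK subrKC.
Qed.

(** The a priori estimate of a symmetric operator of index zero: for each fixed
    v the decomposition bounds the pairing of u with v by the size of T u and
    of the pairings of u with the kernel; uniform boundedness makes the bound
    uniform in v. *)
Lemma a_priori_bound : exists (e : 'I_d -> H1 R n) (M : R), 0 <= M /\
  forall (u : H1 R n) (q : R), 0 < q -> L2norm (Tfun u) <= q ->
    (forall k, `|ip u (e k)| <= q) -> L2norm u <= M * q.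
Proof.
have [e eD] := ker_range_decomposition; exists e.
pose FF : set (L2 R n -> R^o) := [set phi | exists u : H1 R n,
  [/\ L2norm (Tfun u) <= 1, forall k, `|ip u (e k)| <= 1 &
      phi = (fun v : L2 R n => ip u v)]].
have FFlin phi : FF phi -> bounded_fun_norm phi /\ linear phi.
  move=> [u [_ _ ->]]; split.
    move=> r; exists (L2norm u * r) => v vr.
    apply: le_trans (ip_le (H1_L2 u) (L2_mem v)) _.
    by rewrite ler_wpM2l ?L2norm_ge0.
  by move=> a v w; rewrite ip_L2P ?H1_L2.
have FFpt : pointwise_bounded FF.
  move=> v; have [a [w vE]] := eD v.
  exists (\sum_k `|a k| + L2norm w) => _ [u [Tu ue ->]].
  rewrite vE ip_L2_sum ?H1_L2//; apply: le_trans (ler_normD _ _) _; apply: lerD.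
    apply: le_trans (ler_norm_sum _ _ _) _; apply: ler_sum => k _.
    by rewrite normrM ip_L2class ?H1_L2// ler_piMr.
  rewrite ip_L2class ?H1_L2 ?L2fun_Tfun// -ip_T_sym.
  apply: le_trans (ip_le (L2fun_Tfun u) (H1_L2 w)) _.
  by rewrite ler_piMl ?L2norm_ge0.
have [M HM] := Banach_Steinhauss FFlin FFpt 1.
have B1 (u : H1 R n) : L2norm (Tfun u) <= 1 -> (forall k, `|ip u (e k)| <= 1) ->
    L2norm u <= M.
  move=> Tu ue; have [u0|u0] := eqVneq (L2norm u) 0.
    have := HM _ (ex_intro _ u (And3 Tu ue erefl)) 0.
    by rewrite normr0 => /(_ ler01) /(le_trans _); rewrite u0; apply.
  have up : 0 < L2norm u by rewrite lt_neqAle eq_sym u0 L2norm_ge0.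
  have := HM _ (ex_intro _ u (And3 Tu ue erefl)) ((L2norm u)^-1 *: H1class u).
  rewrite normrZ L2class_norm ?H1_L2// ger0_norm ?invr_ge0 ?L2norm_ge0// mulVf//.
  move=> /(_ (lexx _)).
  have -> : ip u ((L2norm u)^-1 *: H1class u : L2 R n) = L2norm u.
    have := ip_L2P (H1class u) 0 (L2norm u)^-1 (H1_L2 u).
    rewrite addr0 ip_L2_0 ?H1_L2// addr0 => ->.
    by rewrite ip_L2class ?H1_L2// ip_self ?H1_L2// expr2 mulKf.
  by rewrite ger0_norm ?L2norm_ge0.
exists (Num.max M 0); split; first by rewrite le_max lexx orbT.
move=> u q q0 Tu ue.
have qV : 0 <= q^-1 by rewrite invr_ge0 ltW.
have Tq : L2norm (Tfun (q^-1 *: u)) <= 1.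
  rewrite -L2class_norm ?L2fun_Tfun// -/(Top _).
  have := Top_linear q^-1 u 0; rewrite Top0 !addr0 => ->.
  rewrite normrZ ger0_norm// L2class_norm ?L2fun_Tfun//.
  by rewrite mulrC ler_pdivrMr// mul1r.
have := B1 (q^-1 *: u) Tq.
have -> : L2norm (q^-1 *: u) = q^-1 * L2norm u.
  by rewrite (L2normZ q^-1 (H1_L2 u)) ger0_norm.
move=> /(_ _)/wrap[].
  move=> k; rewrite ipC.
  rewrite (ipZr q^-1 (H1_L2 (e k)) (H1_L2 u)) normrM ger0_norm// ipC.
  rewrite mulrC ler_pdivrMr// mul1r.
  exact: ue.
rewrite mulrC ler_pdivrMr// => /le_trans; apply.
by rewrite ler_pM2r// le_max lexx.
Qed.

End linear_operator.

(** * The nonlinear operator and its differential *)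

Section nonlinear_operator.
Variables (R : realType) (n : nat).
Local Notation V := 'cV[R]_n.
Local Notation mu := (@lebesgue_measure R).
Let aeF : Filter (nbhs (almost_everywhere mu)) := ae_filter_ringOfSetsType mu.
#[local] Existing Instance aeF.

Lemma L2norm_leZ (f u : R -> V) (k : R) : 0 <= k -> f \in @L2fun R n ->
  u \in @L2fun R n -> (forall t, sq (f t) <= k ^+ 2 * sq (u t)) ->
  L2norm f <= k * L2norm u.
Proof.
move=> k0 lf lu fu; rewrite L2norm_le ?mulr_ge0 ?L2norm_ge0//.
rewrite exprMn EFinM L2norm_energy//.
by apply: energy_leZ => //; [exact: sqr_ge0|exact: L2fun_vmeasurable..].
Qed.

Lemma L2classB (f g : R -> V) : f \in @L2fun R n -> g \in @L2fun R n ->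
  L2class (f \- g) = L2class f - L2class g.
Proof.
move=> lf lg; have h := L2classP (-1) lg lf; rewrite (scaleN1r (L2class g)) in h.
rewrite [RHS]addrC -h.
by congr L2class; apply/funext => t; rewrite !fctE scaleN1r addrC.
Qed.

Lemma H1derivB_ae (x y : H1 R n) :
  {ae mu, forall t, H1deriv (x - y) t = H1deriv x t - H1deriv y t}.
Proof. by apply: filterS (L2B_ae (H1deriv x) (H1deriv y)) => t ->. Qed.

Variables (J : 'M[R]_n) (h : R -> V -> V).
Hypothesis JTJ : J^T *m J = 1%:M.
Hypothesis rh : regular_field h.

Definition Fun (x : H1 R n) : R -> V := fun t => J *m H1deriv x t - h t (x t).
Definition Fop (x : H1 R n) : L2 R n := L2class (Fun x).

Lemma L2fun_Fun x : Fun x \in @L2fun R n.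
Proof.
by apply: L2funB; [exact: L2fun_mulmx (L2_mem _)|exact: L2fun_superposition].
Qed.

Lemma Fop_ae x : {ae mu, forall t, J *m H1deriv x t = Fop x t + h t (x t)}.
Proof.
by apply: filterS (L2classE (L2fun_Fun x)) => t e; rewrite [Fop x t]e// subrK.
Qed.

Lemma Fop_eq x (y : L2 R n) :
  {ae mu, forall t, J *m H1deriv x t = y t + h t (x t)} -> Fop x = y.
Proof.
move=> xy; rewrite -[y]L2class_L2fun.
apply: L2class_eq; [exact: L2fun_Fun|exact: L2_mem|].
by apply: filterS xy => t e _; rewrite /Fun e addrK.
Qed.

Variable x0 : H1 R n.
Definition linearization (t : R) : 'M[R]_n := jac (h t) (x0 t).

Lemma linearization_bound : exists2 K : R, 0 <= K &
  forall t a, sq (linearization t *m a) <= K * sq a.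
Proof.
have [_ _ hM] := rh; have [M HM] := hM (2 * `|x0|).
exists (n%:R * (M * n%:R) ^+ 2); first by rewrite mulr_ge0// sqr_ge0.
by move=> t a; apply: sq_mulmx_le => i j; apply: HM; exact: H1_sup_le.
Qed.

Lemma measurable_linearization i j : measurable_fun setT (fun t => linearization t i j).
Proof.
have [Ch _ _] := rh; apply: continuous_measurable_fun.
by apply: continuous_jac_comp => //; exact: H1_continuous.
Qed.

Local Notation T := (Top J linearization).
Local Notation Tf := (Tfun J linearization).

Lemma L2fun_Tf u : Tf u \in @L2fun R n.
Proof.
have [K K0 BK] := linearization_bound.
exact: (L2fun_Tfun J measurable_linearization K0 BK).
Qed.

Lemma T_linear : linear T.
Proof.
have [K K0 BK] := linearization_bound.
exact: (Top_linear J measurable_linearization K0 BK).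
Qed.

(** Almost everywhere equal to T (x - y) - (F(x) - F(y)), but free of derivatives. *)
Definition remainder (x y : H1 R n) : R -> V :=
  fun t => h t (x t) - h t (y t) - linearization t *m (x t - y t).

Lemma L2fun_remainder x y : remainder x y \in @L2fun R n.
Proof.
have [K K0 BK] := linearization_bound.
apply: L2funB; first by apply: L2funB; exact: L2fun_superposition.
by apply: (L2fun_B measurable_linearization K0 BK (u := x - y)); exact: H1_L2.
Qed.

Lemma Tf_difference x y :
  {ae mu, forall t, Tf (x - y) t = (Fun x t - Fun y t) + remainder x y t}.
Proof.
apply: filterS (H1derivB_ae x y) => t e.
rewrite /Tfun /Fun /remainder e mulmxBr.
have -> : (x - y : H1 R n) t = x t - y t by [].
move: (J *m H1deriv x t) (J *m H1deriv y t) (h t (x t)) (h t (y t))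
  (linearization t *m (x t - y t)) => a b c d w.
by apply/colP => i; rewrite !mxE; ring.
Qed.

(** The values of x0 stay in a ball, on which the derivative of the field is
    equicontinuous uniformly in time. *)
Lemma remainder_small (e : R) : 0 < e -> exists2 d : R, 0 < d &
  forall u : H1 R n, `|u| <= d -> L2norm (remainder (x0 + u) x0) <= e * `|u|.
Proof.
move=> e0; have [Ch _ _] := rh.
pose k := e / (n%:R * n%:R * n%:R + 1).
have N0 : 0 <= n%:R * n%:R * n%:R :> R by rewrite !mulr_ge0.
have k0 : 0 < k by rewrite divr_gt0//; lra.
have [d d0 Hd] := uniformly_equicontinuous_jac (2 * `|x0|) Ch k0.
exists (d / 2); first exact: divr_gt0.
move=> u ud; apply: (@le_trans _ _ (e * L2norm u)); last first.
  by rewrite ler_pM2l// L2norm_le_H1norm.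
apply: L2norm_leZ; [exact: ltW|exact: L2fun_remainder|exact: H1_L2|move=> t].
rewrite /remainder; have -> : (x0 + u : H1 R n) t = x0 t + u t by [].
have ut : `|u t| <= d by have := H1_sup_le u t; lra.
have := @field_mean_value _ _ h t (x0 t) (x0 t + u t) (linearization t) k Ch.
rewrite (addrC (x0 t)) addrK => /(_ _)/wrap[].
  move=> z zu i j; apply: Hd; first exact: H1_sup_le.
  exact: le_trans ut.
move=> /le_trans; apply; rewrite ler_wpM2r ?sq_ge0//.
have kE : k * (n%:R * n%:R * n%:R + 1) = e by rewrite /k divfK// gt_eqF//; lra.
have -> : n%:R * (k * n%:R) ^+ 2 = k * k * (n%:R * n%:R * n%:R) by ring.
have kk : 0 <= k * k by rewrite mulr_ge0// ltW.
by rewrite -kE exprMn !expr2 -!mulrA !mulrA; nra.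
Qed.

(** T is bounded and gives the first-order expansion of F at x0, which determines
    the differential. *)
Lemma diff_Fop : 'd Fop x0 = T :> (H1 R n -> L2 R n).
Proof.
have [K K0 BK] := linearization_bound.
pose TL : {linear H1 R n -> L2 R n} := HB.pack T (GRing.isLinear.Build _ _ _ _ _ T_linear).
have TC u : `|TL u| <= (2 + 2 * K) * `|u|.
  rewrite -[TL u]/(T u) L2class_norm ?L2fun_Tf//.
  rewrite L2norm_le ?L2fun_Tf ?mulr_ge0 ?addr_ge0//; last by rewrite mulr_ge0.
  apply: (@le_trans _ _ (2%:E * energy setT (H1deriv u) + (2 * K)%:E * energy setT u)%E).
    apply: energy_le_comb => //; first by rewrite mulr_ge0.
    - by apply: L2fun_vmeasurable; exact: L2fun_Tf.
    - exact: L2_vmeasurable.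
    - by apply: L2fun_vmeasurable; exact: H1_L2.
    move=> t _; apply: le_trans (sqB _ _) _; rewrite (sq_orthogonal _ JTJ) lerD2l.
    by rewrite -mulrA ler_pM2l.
  rewrite -!L2norm_energy ?L2_mem ?H1_L2// -!EFinM -EFinD lee_fin.
  have a1 : L2norm (H1deriv u) ^+ 2 <= `|u| ^+ 2.
    by rewrite lerXn2r ?nnegrE ?L2norm_ge0// H1deriv_le_H1norm.
  have a2 : L2norm u ^+ 2 <= `|u| ^+ 2.
    by rewrite lerXn2r ?nnegrE ?L2norm_ge0// L2norm_le_H1norm.
  have a3 : 2 * K * L2norm u ^+ 2 <= 2 * K * `|u| ^+ 2 by rewrite ler_wpM2l// mulr_ge0.
  apply: (@le_trans _ _ ((2 + 2 * K) * `|u| ^+ 2)); first by rewrite mulrDl; lra.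
  by rewrite exprMn ler_wpM2r ?sqr_ge0// expr2 ler_peMl; lra.
have -> : T = TL by [].
apply: diff_unique.
  apply: bounded_linear_continuous; apply/linear_boundedP.
  exists (2 + 2 * K); split; first exact: num_real.
  move=> r Kr u; apply: le_trans (TC u) _; rewrite ler_wpM2r//; exact: ltW.
apply/eqaddoP => e e0.
have [d d0 Hd] := remainder_small e0.
apply/nbhs_ballP; exists d => //= u; rewrite -ball_normE /ball_/= sub0r normrN => /ltW/Hd.
apply: le_trans; rewrite !fctE.
rewrite /= (addrC u x0).
have lD := L2funB (L2fun_Fun (x0 + u)) (L2fun_Fun x0).
have lDT := L2funB lD (L2fun_Tf u).
have -> : Fop (x0 + u) - (Fop x0 + TL u) =
    L2class ((Fun (x0 + u) \- Fun x0) \- Tf u).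
  rewrite (L2classB lD (L2fun_Tf u)).
  by rewrite L2classB ?L2fun_Fun// opprD addrA.
rewrite L2class_norm//.
rewrite (@eq_L2norm _ _ _ (-1 *: remainder (x0 + u) x0)).
- by rewrite L2normZ ?L2fun_remainder// normrN1 mul1r.
- exact: lDT.
- by apply: rpredZ; exact: L2fun_remainder.
have xu : x0 + u - x0 = u by rewrite addrC addKr.
have := Tf_difference (x0 + u) x0; rewrite xu; apply: filterS => t e1 _.
rewrite /= !fctE e1 scaleN1r; move: (_ - _) (remainder _ _ t) => a b.
by rewrite opprD addrA subrr sub0r.
Qed.


End nonlinear_operator.

(** * Uniform convergence on the line *)

Section compactness.
Variables (R : realType) (n : nat).
Local Notation V := 'cV[R]_n.
Local Notation mu := (@lebesgue_measure R).
Let aeF : Filter (nbhs (almost_everywhere mu)) := ae_filter_ringOfSetsType mu.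
#[local] Existing Instance aeF.

Variables (J : 'M[R]_n) (H : R -> V -> R -> R) (lam : R).
Local Notation h := (fun t xi => D_xi H t xi lam).
Hypothesis JJ : J *m J = - 1%:M.
Hypothesis JTJ : J^T *m J = 1%:M.
Hypothesis rh : regular_field h.
Local Notation F := (Fop J h).

Variables (U : set_system (H1 R n)) (C : R) (y : L2 R n).
Hypothesis UU : UltraFilter U.
Let UP : ProperFilter U := ultra_proper.
#[local] Existing Instance UP.
Hypothesis UC : \forall x \near U, `|x : H1 R n| <= C.
Hypothesis Uy : forall e : R, 0 < e -> \forall x \near U, `|F x - y| <= e.

Let C0 : 0 <= C.
Proof. by have [x xC] := filter_ex UC; exact: le_trans xC. Qed.

Lemma energy_Fop_le (e : R) : 0 < e ->
  \forall x \near U, (energy setT (F x \- y)%R <= (e ^+ 2)%:E)%E.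
Proof.
move=> e0; apply: filterS (Uy e0) => x xe.
by rewrite -L2norm_le ?L2norm_ge0 ?L2normB// ?ltW// L2funB ?L2_mem.
Qed.

(** The translates of x by multiples c x of the period, escaping to infinity along
    U, solve translated equations; these tend to the asymptotic equation with zero
    right-hand side, whose only solution is zero. *)
Lemma drift_vanishes (g : R -> V -> R -> V) (infty : set_system R) (c : H1 R n -> R) :
  Filter infty -> asymptotic H g lam infty ->
  (forall (x : H1 R n) t xi, g (t + c x) xi lam = g t xi lam) ->
  [set z | Fasym J g lam z = 0] = [set 0] ->
  (forall (A : R) (P : set R), infty P ->
     \forall x \near U, forall t : R, `|t| <= A -> P (t + c x)) ->
  (forall A B : R, \forall x \near U, forall t : R, `|t| <= A -> B < `|t + c x|) ->
  forall A e : R, 0 < e -> \forall x \near U, forall t : R, `|t| <= A ->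
    `|(x : H1 R n) (t + c x)| <= e.
Proof.
move=> Finf asy gc ker ci cb A e e0.
have [Ch h0 _] := rh; have rg := asymptotic_regular asy; have [Cg g0 _] := rg.
have l0 : (fun=> 0 : V) \in @L2fun R n by exact: (rpred0 (@L2fun R n)).
have [||||||||Z [ZE Zloc]] := @H1_ultra_equation R n (H1 R n) U UU
  (fun x => H1_shift (c x) x) C _ J JJ JTJ (fun x => vshift (c x) (F x)) (fun=> 0)
  (fun x t xi => h (t + c x) xi) (fun t xi => g t xi lam).
- by apply: filterS UC => x; rewrite H1_shift_norm.
- by move=> x; apply: L2fun_shift; exact: L2_mem.
- exact: l0.
- exact: rg.
- move=> x t; have := continuous_superposition Ch (@H1_continuous _ _ x).
  move=> /(_ (t + c x)) ct.
  apply: (@continuous_comp _ _ _ (fun t => t + c x) (fun t => h t (x t)) t); last exact: ct.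
  by apply: cvgD; [exact: cvg_id|exact: cvg_cst].
- move=> x; have := ae_shift (c x) (Fop_ae J rh x); apply: filterS2 (H1deriv_shift (c x) x) => t.
  by rewrite /vshift H1_shiftE => ->.
- move=> A' e' e'0.
  pose q := Num.sqrt (e' / 4).
  have q0 : 0 < q by rewrite sqrtr_gt0 divr_gt0.
  have [B B0 yB] := energy_tail (L2_mem y) (divr_gt0 e'0 (ltr0n R 4)).
  apply: filterS2 (energy_Fop_le q0) (cb A' B) => x Fy xB.
  have mF := L2_vmeasurable (F x); have my := L2_vmeasurable y.
  have mFy := vmeasurableB mF my.
  have ms (f : R -> V) : vmeasurable f -> vmeasurable (vshift (c x) f).
    exact: vmeasurable_shift.
  apply: (@le_trans _ _ (2%:E * energy `[(- A')%R, A'] (vshift (c x) (F x \- y)%R) +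
      2%:E * energy `[(- A')%R, A'] (vshift (c x) y))%E).
    apply: energy_le_comb => //; [|exact: ms|exact: ms|].
      by apply: vmeasurableB; [exact: ms|exact: L2fun_vmeasurable].
    move=> t _; have -> : (vshift (c x) (F x) \- (fun=> 0)) t =
        vshift (c x) (F x \- y) t + vshift (c x) y t by rewrite /= subr0 /vshift subrK.
    exact: sqD.
  have h1 : (energy `[(- A')%R, A'] (vshift (c x) (F x \- y)%R) <= (e' / 4)%:E)%E.
    apply: le_trans (energyS _ _ _ (@subsetT _ _)) _ => //; first exact: ms.
    rewrite energyT_shift//; apply: le_trans Fy _.
    by rewrite /q sqr_sqrtr// divr_ge0// ltW.
  have h2 : (energy `[(- A')%R, A'] (vshift (c x) y) <= (e' / 4)%:E)%E.
    apply: le_trans yB; rewrite -(energy_shift (c x) _ my); last exact: measurableC.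
    apply: energyS => //; [|exact: ms|].
      have mt : measurable_fun setT (fun t : R => t + c x) by apply: measurable_funD.
      have mB : measurable (~` `[- B, B]%classic) by exact: measurableC.
      by have := mt measurableT _ mB; rewrite setTI.
    move=> t /=; rewrite !in_itv/= -!ler_norml => /xB tB; apply/negP.
    by rewrite -ltNge.
  apply: le_trans (leeD (lee_wpmul2l _ h1) (lee_wpmul2l _ h2)) _ => //.
  rewrite -!EFinM -EFinD lee_fin; lra.
- move=> A' r e' e'0.
  have := asymptotic_field (H := H) Ch h0 r Finf asy e'0.
  move=> /(ci A'); apply: filterS => x Hx t xi tA xir.
  by rewrite -(gc x t xi); exact: Hx.
have Z0 : Z = 0.
  have : [set z | Fasym J g lam z = 0] Z.
    apply: (Fop_eq rg); apply: filterS2 ZE (L2classE l0) => t -> e1.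
    have -> : (0 : L2 R n) = L2class (fun=> 0).
      apply: L2_ae_eq; apply: filterS2 (L2_reprK (0 : L2rep R n)) (L2classE l0) => s E1 E2 Is.
      by rewrite E2//; exact: E1.
    by rewrite e1.
  by rewrite ker.
apply: filterS (Zloc A e e0) => x Hx t tA.
by have := Hx t tA; rewrite Z0 subr0.
Qed.

Variables (gp gm : R -> V -> R -> V).
Hypothesis ap : asymptotic H gp lam (pinfty_nbhs R).
Hypothesis am : asymptotic H gm lam (ninfty_nbhs R).
Hypothesis kp : [set z | Fasym J gp lam z = 0] = [set 0].
Hypothesis km : [set z | Fasym J gm lam z = 0] = [set 0].

Variable X : H1 R n.
Hypothesis Xloc : forall A e : R, 0 < e -> \forall x \near U, forall t, `|t| <= A ->
  `|(x : H1 R n) t - X t| <= e.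

(** If the convergence were not uniform on the line, bumps of fixed height would
    escape to plus or minus infinity. *)
Lemma uniform_convergence (e : R) : 0 < e ->
  \forall x \near U, forall t : R, `|(x : H1 R n) t - X t| <= e.
Proof.
move=> e0; apply: contrapT => /(ultra_dichotomy UU) nu.
have [tau Htau] : {tau : H1 R n -> R & \forall x \near U, e < `|(x : H1 R n) (tau x) - X (tau x)|}.
  have /choice[tau Ht] (x : H1 R n) : exists t : R,
      ~ (forall t, `|x t - X t| <= e) -> e < `|x t - X t|.
    have [Hx|/existsNP[t /negP]] := pselect (forall t, `|x t - X t| <= e).
      by exists 0.
    by rewrite -ltNge; exists t.
  by exists tau; apply: filterS nu => x; exact: Ht.
have tau_inf A : \forall x \near U, A < `|tau x|.
  apply: filterS2 Htau (Xloc A e0) => x xt Hx; rewrite ltNge; apply/negP => /Hx.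
  by rewrite leNgt xt.
have e3 : 0 < e / 3 by exact: divr_gt0.
have [B B0 XB] := H1_decay X e3.
(* c x is to be the multiple of the period next to tau x. *)
suff [A [c cA cv]] : exists A : R, exists2 c : H1 R n -> R,
    (forall x, `|tau x - c x| <= A) &
    \forall x \near U, forall t : R, `|t| <= A -> `|(x : H1 R n) (t + c x)| <= e / 3.
  have [x [[h1 h2] h3]] := filter_ex (filterI (filterI Htau cv) (tau_inf B)).
  have := h2 _ (cA x); rewrite subrK => h4.
  have := XB _ h3; have := ler_normB (x (tau x)) (X (tau x)); lra.
have red (T : R) : 0 < T -> {m : H1 R n -> int & forall x, 0 <= tau x - (m x)%:~R * T <= T}.
  move=> T0; have H1 x := period_reduction (tau x) T0; have [m Hm] := choice H1.
  by exists m.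
have [pos|neg] := in_ultra_setVsetC [set x | 0 < tau x] UU.
- have [_ _ _ [T T0 gT]] := ap; have [m Hm] := red T T0.
  have cT x : 0 <= tau x - (m x)%:~R * T <= T := Hm x.
  exists T; exists (fun x => (m x)%:~R * T).
    by move=> x; have /andP[a b] := cT x; rewrite ger0_norm.
  have big A D : \forall x \near U, forall t, `|t| <= A -> D < t + (m x)%:~R * T.
    apply: filterS2 pos (tau_inf (A + T + D)) => x /= x0 xA t; rewrite ler_norml => /andP[tA _].
    by have /andP[_ b] := cT x; rewrite gtr0_norm// in xA; lra.
  apply: (drift_vanishes _ ap _ kp) => //.
  + by move=> x t xi; exact: periodic_int.
  + move=> A P [D [_ DP]]; apply: filterS (big A D) => x Hx t tA.
    by apply: DP; exact: Hx.
  + move=> A D; apply: filterS (big A D) => x Hx t tA.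
    by apply: lt_le_trans (Hx t tA) _; exact: ler_norm.
- have [_ _ _ [T T0 gT]] := am; have [m Hm] := red T T0.
  have cT x : 0 <= tau x - (m x)%:~R * T <= T := Hm x.
  exists T; exists (fun x => (m x)%:~R * T).
    by move=> x; have /andP[a b] := cT x; rewrite ger0_norm.
  have big A D : \forall x \near U, forall t, `|t| <= A -> t + (m x)%:~R * T < D.
    apply: filterS2 neg (tau_inf (A - D)) => x /= /negP.
    rewrite -leNgt => x0 xA t; rewrite ler_norml => /andP[_ tA].
    by have /andP[b _] := cT x; rewrite ler0_norm// in xA; lra.
  apply: (drift_vanishes _ am _ km) => //.
  + by move=> x t xi; exact: periodic_int.
  + move=> A P [D [_ DP]]; apply: filterS (big A D) => x Hx t tA.
    by apply: DP; exact: Hx.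
  + move=> A D; apply: filterS (big A (- D)) => x Hx t tA.
    by have := Hx t tA; have := ler_norm (- (t + (m x)%:~R * T)); rewrite normrN; lra.
Qed.

End compactness.

(** * Convergence in H^1 *)

Lemma half_fraction_le (R : realType) (q N : R) : 0 < q -> 0 <= N ->
  q / (2 * (N + 1)) * N <= q / 2.
Proof.
move=> q0 N0; have N1 : 0 < 2 * (N + 1) by lra.
rewrite mulrAC ler_pdivrMr//.
have -> : q / 2 * (2 * (N + 1)) = q * (N + 1) by field.
by rewrite ler_pM2l//; lra.
Qed.

(** The shifts by 1 allow a and D to vanish. *)
Lemma tail_constant_le (R : realType) (a D q k : R) : 0 <= a -> 0 <= D -> 0 < q ->
  k = q / (8 * (a + 1) * (D + 1)) -> a * k ^+ 2 * D ^+ 2 <= q ^+ 2 / 8.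
Proof.
move=> a0 D0 q0 kE.
have K0 : 0 < 8 * (a + 1) * (D + 1) by rewrite !mulr_gt0//; lra.
have qE : q = k * (8 * (a + 1) * (D + 1)) by rewrite kE divfK// gt_eqF.
have -> : q ^+ 2 / 8 = 8 * (k ^+ 2 * ((a + 1) ^+ 2 * (D + 1) ^+ 2)) by rewrite qE; field.
have -> : a * k ^+ 2 * D ^+ 2 = k ^+ 2 * (a * D ^+ 2) by ring.
have h1 : a * D ^+ 2 <= (a + 1) ^+ 2 * (D + 1) ^+ 2.
  by apply: ler_pM; rewrite ?sqr_ge0//; [rewrite expr2; nra|rewrite lerXn2r ?nnegrE//; lra].
have h2 : k ^+ 2 * (a * D ^+ 2) <= k ^+ 2 * ((a + 1) ^+ 2 * (D + 1) ^+ 2).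
  by rewrite ler_wpM2l ?sqr_ge0.
have h3 : 0 <= k ^+ 2 * ((a + 1) ^+ 2 * (D + 1) ^+ 2).
  by rewrite mulr_ge0 ?sqr_ge0// mulr_ge0 ?sqr_ge0.
lra.
Qed.

Lemma fraction_le (R : realType) (p s : R) : 0 <= p -> 0 <= s -> s * (p / (s + 1)) <= p.
Proof.
move=> p0 s0; have s1 : 0 < s + 1 by lra.
by rewrite mulrA ler_pdivrMr// mulrC ler_wpM2l// lerDl.
Qed.

Lemma three_parts_le (R : realType) (p : R) : 0 <= p ->
  2 * (p / 8) + 2 * (p / 8 + p / 8) <= p.
Proof. by move=> p0; lra. Qed.

Lemma graph_norm_le (R : realType) (u2 t2 d2 K M q e : R) : 0 <= K ->
  u2 <= (M * q) ^+ 2 -> t2 <= q ^+ 2 -> d2 <= 2 * t2 + 2 * K * u2 ->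
  q * (M ^+ 2 * (1 + 2 * K) + 2) = e -> u2 + d2 <= e ^+ 2.
Proof.
move=> K0 hu ht hd <-; have K2 : 0 <= 2 * K by rewrite mulr_ge0.
have hK : 2 * K * u2 <= 2 * K * (M * q) ^+ 2 by rewrite ler_wpM2l.
pose s := M ^+ 2 * (1 + 2 * K).
have s0 : 0 <= s by rewrite mulr_ge0 ?sqr_ge0// addr_ge0.
apply: (@le_trans _ _ (q ^+ 2 * (s + 2))).
  have -> : q ^+ 2 * (s + 2) = (M * q) ^+ 2 + (2 * q ^+ 2 + 2 * K * (M * q) ^+ 2).
    by rewrite /s; ring.
  lra.
rewrite exprMn ler_wpM2l ?sqr_ge0// -/s expr2 ler_peMl//; lra.
Qed.

Section local_convergence.
Variables (R : realType) (n : nat).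
Local Notation V := 'cV[R]_n.

Variables (U : set_system (H1 R n)) (C : R) (X : H1 R n).
Hypothesis UP : ProperFilter U.
#[local] Existing Instance UP.
Hypothesis UC : \forall x \near U, `|x : H1 R n| <= C.
Hypothesis Xloc : forall A e : R, 0 < e -> \forall x \near U, forall t, `|t| <= A ->
  `|(x : H1 R n) t - X t| <= e.
Local Notation D := (C + `|X|).

Let C0 : 0 <= C.
Proof. by have [x xC] := filter_ex UC; exact: le_trans xC. Qed.

Lemma difference_bounded : \forall x \near U, L2norm ((x : H1 R n) - X) <= D.
Proof.
apply: filterS UC => x xC; apply: le_trans (L2norm_le_H1norm _) _.
by apply: le_trans (ler_normB _ _) _; rewrite lerD2r.
Qed.

Lemma energy_difference_small (A e : R) : 0 <= A -> 0 < e ->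
  \forall x \near U, (energy `[(- A)%R, A] ((x : H1 R n) - X)%R <= e%:E)%E.
Proof.
move=> A0 e0; pose q := e / (n%:R * (2 * A) + 1).
have n0 : 0 <= n%:R * (2 * A) :> R by rewrite !mulr_ge0.
have q0 : 0 < q by rewrite divr_gt0//; lra.
have qE : q * (n%:R * (2 * A) + 1) = e by rewrite /q divfK// gt_eqF//; lra.
have s0 : 0 < Num.sqrt q by rewrite sqrtr_gt0.
apply: filterS (Xloc A s0) => x Hx.
apply: (@le_trans _ _ ((n%:R * q * (A - - A))%:E)).
  apply: energy_le_cst; first lra.
    by apply: L2fun_vmeasurable; exact: H1_L2.
  move=> t tA; rewrite -(sqr_sqrtr (ltW q0)); apply: sq_le_norm.
  by apply: Hx; rewrite ler_norml.
by rewrite lee_fin; lra.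
Qed.

(** Along U the difference x - X is small on bounded intervals and bounded in L^2:
    it converges weakly to 0. *)
Lemma pairing_vanishes (f : R -> V) (q : R) : f \in @L2fun R n -> 0 < q ->
  \forall x \near U, `|ip ((x : H1 R n) - X) f| <= q.
Proof.
move=> lf q0.
have N0 := L2norm_ge0 f; have D0 : 0 <= D by rewrite addr_ge0.
have d0 : 0 < q / (2 * (D + 1)) by rewrite divr_gt0//; lra.
have c0 : 0 < q / (2 * (L2norm f + 1)) by rewrite divr_gt0//; lra.
have [A A0 fA] := energy_tail lf (exprn_gt0 2 d0).
apply: filterS2 difference_bounded (energy_difference_small A0 (exprn_gt0 2 c0)) => x xD xA.
have lx := H1_L2 (x - X).
apply: (@le_trans _ _ (q / (2 * (L2norm f + 1)) * L2norm f + D * (q / (2 * (D + 1))))).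
  apply: (@ip_le_split _ _ `[- A, A]) => //; try exact: ltW.
  - by exact: energy_le_L2norm.
  - apply: le_trans (energy_le_L2norm _ lx) _; [exact: measurableC|].
    by rewrite lee_fin lerXn2r ?nnegrE// L2norm_ge0.
rewrite (mulrC D) [leRHS]splitr; apply: lerD; exact: half_fraction_le.
Qed.

End local_convergence.

Section convergence.
Variables (R : realType) (n : nat).
Local Notation V := 'cV[R]_n.
Local Notation mu := (@lebesgue_measure R).
Let aeF : Filter (nbhs (almost_everywhere mu)) := ae_filter_ringOfSetsType mu.
#[local] Existing Instance aeF.

Variables (J : 'M[R]_n) (h : R -> V -> V).
Hypothesis JT : J^T = - J.
Hypothesis JTJ : J^T *m J = 1%:M.
Hypothesis rh : regular_field h.
Local Notation F := (Fop J h).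

Variables (U : set_system (H1 R n)) (C : R) (X : H1 R n).
Hypothesis UP : ProperFilter U.
#[local] Existing Instance UP.
Hypothesis UC : \forall x \near U, `|x : H1 R n| <= C.
Hypothesis UF : forall e : R, 0 < e -> \forall x \near U, `|F x - F X| <= e.
Hypothesis Uunif : forall e : R, 0 < e ->
  \forall x \near U, forall t : R, `|(x : H1 R n) t - X t| <= e.

Variable x0 : H1 R n.
Local Notation B := (linearization h x0).
Local Notation Tf := (Tfun J B).
Local Notation D := (C + `|X|).

(** T (x - X) is F x - F X up to a remainder, although T is the derivative at x0
    and not at X. Far out x, X and x0 are all close to 0, where the derivative of
    the field is equicontinuous uniformly in time; on bounded intervals x - X is
    small. *)
Lemma linearized_residual_vanishes (q : R) : 0 < q ->
  \forall x \near U, L2norm (Tf (x - X)) <= q.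
Proof.
move=> q0; have [Ch h0 _] := rh.
have C0 : 0 <= C by have [x xC] := filter_ex UC; exact: le_trans xC.
have D0 : 0 <= D by rewrite addr_ge0.
have [K K0 BK] := linearization_bound rh x0.
have [L L0 HL] := regular_lipschitz rh (2 * D).
pose a : R := n%:R * n%:R * n%:R.
have a0 : 0 <= a by rewrite !mulr_ge0.
pose k := q / (8 * (a + 1) * (D + 1)).
have k0 : 0 < k by rewrite divr_gt0// !mulr_gt0//; lra.
have k2 : 0 < k / 2 by exact: divr_gt0.
have [d d0 Hd] := uniformly_equicontinuous_jac 0 Ch k2.
have d2 : 0 < d / 2 by exact: divr_gt0.
have [A1 A10 XA] := H1_decay X d2; have [A2 A20 x0A] := H1_decay x0 d0.
pose A := A1 + A2; have A0 : 0 <= A by rewrite addr_ge0.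
have q8 : 0 < Num.sqrt (q ^+ 2 / 8) by rewrite sqrtr_gt0 divr_gt0// exprn_gt0.
have c0 : 0 < q ^+ 2 / 8 / (2 * (L + K) + 1).
  by rewrite !divr_gt0// ?exprn_gt0//; lra.
have Xloc (A' e : R) : 0 < e -> \forall x \near U, forall t : R, `|t| <= A' ->
    `|(x : H1 R n) t - X t| <= e.
  by move=> e0; apply: filterS (Uunif e0) => x Hx t _; exact: Hx.
have nA := energy_difference_small UP Xloc A0 c0.
apply: filterS3 (filterI UC (difference_bounded X UP UC))
  (filterI (UF q8) (Uunif d2)) nA => x [xC xD] [xF xu] xA.
set u := x - X in xA *; have uE t : u t = x t - X t by [].
have lu : (u : R -> V) \in @L2fun R n := H1_L2 u.
have lr := L2fun_remainder rh x0 x X.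
have mr := L2fun_vmeasurable lr.
have mu_ := L2fun_vmeasurable lu.
have lFx := L2fun_Fun J rh x; have lFX := L2fun_Fun J rh X.
have lFF := L2funB lFx lFX.
have lT : Tf u \in @L2fun R n by exact: L2fun_Tf.
have mA : measurable (~` `[- A, A]%classic) by exact: measurableC.
rewrite L2norm_le//; last exact: ltW.
have -> : energy setT (Tf u) = energy setT ((Fun J h x \- Fun J h X) \+ remainder h x0 x X).
  apply: energy_ae => //; [exact: L2fun_vmeasurable| |].
    by apply: vmeasurableD => //; exact: L2fun_vmeasurable.
  by apply: filterS (Tf_difference J h x0 x X) => t -> _.
apply: le_trans (energyD measurableT (L2fun_vmeasurable lFF) mr) _.
have E1 : (energy setT (Fun J h x \- Fun J h X)%R <= (q ^+ 2 / 8)%:E)%E.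
  rewrite -[X in (_ <= X%:E)%E]sqr_sqrtr; last by rewrite divr_ge0// sqr_ge0.
  by rewrite -L2norm_le ?sqrtr_ge0// -L2class_norm// L2classB.
have E2 : (energy `[(- A)%R, A] (remainder h x0 x X) <= (q ^+ 2 / 8)%:E)%E.
  apply: (@le_trans _ _ ((2 * L + 2 * K)%:E * energy `[(- A)%R, A] u)%E).
    apply: energy_leZ => //; first by rewrite addr_ge0// mulr_ge0.
    move=> t _; apply: le_trans (sqB _ _) _.
    rewrite [leRHS](_ : _ = 2 * (L * sq (u t)) + 2 * (K * sq (u t))); last by ring.
    apply: lerD; last by rewrite ler_pM2l//; exact: BK.
    rewrite ler_pM2l//; apply: HL; apply: le_trans (H1_sup_le _ _) _; rewrite ler_pM2l//.
      by rewrite lerDr.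
    by apply: le_trans xC _; rewrite lerDl.
  apply: le_trans (lee_wpmul2l _ xA) _; first by rewrite lee_fin addr_ge0// mulr_ge0.
  by rewrite -EFinM lee_fin -mulrDr fraction_le ?divr_ge0 ?sqr_ge0 ?mulr_ge0 ?addr_ge0.
have E3 : (energy (~` `[(- A)%R, A]) (remainder h x0 x X) <= (q ^+ 2 / 8)%:E)%E.
  apply: (@le_trans _ _ ((a * k ^+ 2)%:E * energy (~` `[(- A)%R, A]) u)%E).
    apply: energy_leZ => //; first by rewrite mulr_ge0// sqr_ge0.
    move=> t /=; rewrite in_itv/= -ler_norml => /negP; rewrite -ltNge => tA.
    have Xt : `|X t| <= d / 2 by apply/XA/(le_lt_trans _ tA); rewrite lerDl.
    have x0t : `|x0 t| <= d by apply/x0A/(le_lt_trans _ tA); rewrite lerDr.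
    have := @field_mean_value _ _ h t (X t) (x t) (B t) k Ch.
    move=> /(_ _)/wrap[].
      move=> z zX i j.
      have z1 : `|z - 0| <= d.
        apply: le_trans (ler_distD (X t) _ _) _; rewrite subr0 (splitr d).
        by apply: lerD => //; exact: le_trans zX (xu t).
      have x1 : `|x0 t - 0| <= d by rewrite subr0.
      have n0 : `|0 : V| <= 0 by rewrite normr0.
      have := Hd t 0 z n0 z1 i j; have := Hd t 0 (x0 t) n0 x1 i j.
      rewrite /linearization.
      move=> p1 p2; apply: le_trans (ler_distD (jac (h t) 0 i j) _ _) _.
      by rewrite (splitr k); apply: lerD; rewrite // distrC.
    move=> /le_trans; apply; rewrite /remainder uE /a.
    by rewrite (_ : n%:R * _ ^+ 2 = n%:R * n%:R * n%:R * k ^+ 2)//; ring.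
  have uD : (energy (~` `[(- A)%R, A]) u <= (D ^+ 2)%:E)%E.
    apply: le_trans (energy_le_L2norm mA lu) _.
    by rewrite lee_fin lerXn2r ?nnegrE// L2norm_ge0.
  apply: le_trans (lee_wpmul2l _ uD) _; first by rewrite lee_fin mulr_ge0// sqr_ge0.
  by rewrite -EFinM lee_fin; exact: tail_constant_le.
have E4 : (energy setT (remainder h x0 x X) <= (q ^+ 2 / 8 + q ^+ 2 / 8)%:E)%E.
  by rewrite (energy_setC (D := `[- A, A]%classic))// EFinD; exact: leeD.
apply: le_trans (leeD (lee_wpmul2l _ E1) (lee_wpmul2l _ E4)) _ => //.
by rewrite -!EFinM -EFinD lee_fin three_parts_le ?sqr_ge0.
Qed.

Variable d : nat.
Hypothesis BT : forall t, (B t)^T = B t.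
Hypothesis dimK : has_dim [set x | Top J B x = 0] d.
Hypothesis codimR : has_codim (range (Top J B)) d.

(** The a priori bound applies to x - X, whose image under T and whose pairings
    with the kernel of T vanish along U; the derivative follows from the equation. *)
Lemma strong_convergence (e : R) : 0 < e -> \forall x \near U, `|x - X| <= e.
Proof.
move=> e0; have [K K0 BK] := linearization_bound rh x0.
have mB := measurable_linearization rh x0.
have [b [M [M0 HM]]] := a_priori_bound JT JTJ mB K0 BK BT dimK codimR.
pose S := M ^+ 2 * (1 + 2 * K) + 2.
have MK : 0 <= M ^+ 2 * (1 + 2 * K) by rewrite mulr_ge0 ?sqr_ge0//; lra.
have S0 : 0 < S by rewrite /S; lra.
pose q := e / S; have q0 : 0 < q by exact: divr_gt0.
have qS : q * S = e by rewrite /q divfK// gt_eqF.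
have Xloc (A' e' : R) : 0 < e' -> \forall x \near U, forall t : R, `|t| <= A' ->
    `|(x : H1 R n) t - X t| <= e'.
  by move=> e'0; apply: filterS (Uunif e'0) => x Hx t _; exact: Hx.
have pair : \forall x \near U, forall k, `|ip ((x : H1 R n) - X) (b k)| <= q.
  apply: (@filter_forall _ _ _ U) => k.
  exact: (pairing_vanishes UP UC Xloc (H1_L2 (b k)) q0).
apply: filterS2 pair (linearized_residual_vanishes q0) => x xb xT.
set u := x - X in xb xT *.
have uM := HM u q q0 xT xb.
have lT : Tf u \in @L2fun R n by exact: L2fun_Tf.
have du := energy_deriv_le JTJ mB K0 BK u.
rewrite -!L2norm_energy ?H1_L2 ?L2_mem// -!EFinM -EFinD lee_fin in du.
rewrite normH1E /H1norm normL2E -[leRHS](ger0_norm (ltW e0)) -[leRHS]sqrtr_sqr ler_wsqrtr//.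
have h1 : L2norm u ^+ 2 <= (M * q) ^+ 2.
  by rewrite lerXn2r ?nnegrE ?L2norm_ge0// mulr_ge0// (ltW q0).
have h2 : L2norm (Tf u) ^+ 2 <= q ^+ 2.
  by rewrite lerXn2r ?nnegrE ?L2norm_ge0// (ltW q0).
exact: graph_norm_le K0 h1 h2 du qS.
Qed.

End convergence.

(** * Properness *)

Theorem theorem4p9 (R : realType) (N : nat) (J : 'M[R]_(2 * N))
    (H : R -> 'cV[R]_(2 * N) -> R -> R)
    (gp gm : R -> 'cV[R]_(2 * N) -> R -> 'cV[R]_(2 * N))
    (lam : R) (x0 : H1 R (2 * N)) :
  (1 <= N)%N ->
  J \in unitmx -> J^T = invmx J -> invmx J = - J ->
  hypH1 H -> hypH2 H -> hypH3 H -> hypH4 H -> hypHinfty H gp gm ->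
  Phi0 ('d (Fham J H lam) x0) ->
  [set x | Fasym J gp lam x = 0] = [set 0] ->
  [set x | Fasym J gm lam x = 0] = [set 0] ->
  forall W : set (H1 R (2 * N)), closed W -> bounded_set W ->
  forall K : set (L2 R (2 * N)), compact K ->
  compact (W `&` Fham J H lam @^-1` K).
Proof.
move=> _ uJ JTV JV [_ cH H0] _ [Ch _] _ asy.
set n := (2 * N)%N in J H gp gm x0 uJ JTV JV cH H0 Ch asy *.
have [ap am] := asy lam.
have JT : J^T = - J by rewrite JTV.
have JTJ : J^T *m J = 1%:M by rewrite JTV mulVmx.
have JJ : J *m J = - 1%:M by rewrite -JTJ JT mulNmx opprK.
pose h t xi := D_xi H t xi lam.
have rh : regular_field h := hamiltonian_regular (Ch lam) (H0^~ lam) ap am.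
have FE : Fham J H lam = Fop J h by [].
rewrite FE => -[_ _ [d [dimK codimR]]] kp km W cW bW K cK.
have dE := diff_Fop JTJ rh x0; rewrite /= dE in dimK codimR.
have BT t : (linearization h x0 t)^T = linearization h x0 t.
  exact: (D2_xi_sym (Ch lam)).
rewrite compact_ultra => U UU UW.
have UP : ProperFilter U by exact: ultra_proper.
have [C UC] : exists C : R, \forall x \near U, `|x : H1 R n| <= C.
  have [M [_ HM]] := bW; exists (M + 1); apply: filterS UW => x [Wx _].
  by apply: HM Wx; rewrite ltrDl.
have UK : \forall x \near U, K (Fop J h x) by apply: filterS UW => x [].
have [y Ky Uy] := ultra_compact_cvg UU cK UK.
have [|||||||X [XE Xloc]] := @H1_ultra_equation R n (H1 R n) U UU
  id C UC J JJ JTJ (fun x => Fop J h x) (L2fun_of y) (fun=> h) h.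
- by move=> x; exact: L2_mem.
- exact: L2_mem.
- exact: rh.
- by move=> x; apply: continuous_superposition (Ch lam) _; exact: H1_continuous.
- by move=> x; exact: Fop_ae.
- move=> A e e0; have s0 : 0 < Num.sqrt e by rewrite sqrtr_gt0.
  apply: filterS (energy_Fop_le UU Uy s0) => x; rewrite sqr_sqrtr ?(ltW e0)//; apply: le_trans.
  apply: energyS => //; apply: vmeasurableB; exact: L2_vmeasurable.
- by move=> A r e e0; apply: filterE => x t xi _ _; rewrite subrr sq0 (ltW e0).
have FX : Fop J h X = y := Fop_eq rh XE.
have Uunif := uniform_convergence JJ JTJ rh UU UC Uy ap am kp km Xloc.
have UF e : 0 < e -> \forall x \near U, `|Fop J h x - Fop J h X| <= e.
  by rewrite FX; exact: Uy.
have UX : U --> X.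
  apply/cvgrPdist_le => e e0.
  have := strong_convergence JT JTJ rh UP UC UF Uunif BT dimK codimR e0.
  by apply: filterS => x; rewrite distrC.
exists X; split; last exact: UX.
split; last by rewrite /= FX.
apply: cW => B /UX UB; have [x [[Wx _] Bx]] := filter_ex (filterI UW UB).
by exists x.
Qed.
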